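(* Let $p\in\{\infty,\omega\}$ and $\sigma\in\{1,\dots,\tau\}$. If $f=\mathcal I(F)\in\mathcal S_T^p(\Omega_D,A)$, then there exists $g=\mathcal I(G)\in\mathcal S^p_T(\Omega_D,A)$ such that $\Delta_{T_\sigma}f=\Delta_Tf+g$, so in particular $\Delta_{T_\sigma}f\in\mathcal S^p_T(\Omega_D,A)$. For every $K\subseteq\{1,\dots,\tau\}$, the $K$-component of $G\in\mathrm{Stem}^p_T(D,A\otimes\mathbb R^{2^\tau})$ satisfies \[G_K(\alpha,\beta)=\sum_{v\in\{1,\dots,\sigma\}}\frac{t_v-t_{v-1}-1}{\beta_v}(\partial_{\beta_v}F_K)(\alpha,\beta)+\sum_{v\in\{1,\dots,\sigma\}\cap K}\frac{1+t_{v-1}-t_v}{\beta_v^2}F_K(\alpha,\beta)\] for all $(\alpha,\beta)\in D'=\{(\alpha,\beta_1,\dots,\beta_\tau)\in D:\beta_1\cdots\beta_\sigma\ne0\}$.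
   Context: $A$ is a finite-dimensional associative real algebra with unit and a $*$-involution $x\mapsto x^c$; $\mathbb S_A=\{x:x+x^c=0,xx^c=1\}\ne\emptyset$. $V\subseteq A$ has basis $(v_0=1,v_1,\dots,v_N)$, $N\ge1$, $v_s\in\mathbb S_A$ pairwise anticommuting for $s\ge1$, $V\subseteq\bigcup_{J\in\mathbb S_A}(\mathbb R+J\mathbb R)$; $A$ carries the Euclidean norm making a completion of this basis orthonormal. $\mathbb R_{\ell,m}=\mathrm{Span}_{\mathbb R}(v_\ell,\dots,v_m)$, $\mathbb S_{\ell,m}$ its unit sphere. A list of steps $T=(t_0,\dots,t_\tau)$, $0\le t_0<\dots<t_\tau=N$, has torus $\mathbb T=\mathbb S_{t_0+1,t_1}\times\cdots\times\mathbb S_{t_{\tau-1}+1,t_\tau}$ (for $0$ steps: single index $J=\emptyset$, $\beta J=0$); $x=x^0+\dots+x^\tau$, $x^h=\sum_{s=t_{h-1}+1}^{t_h}x_sv_s$ ($t_{-1}=-1$). For $J\in\mathbb T$, $\beta\in\mathbb R^\tau$: $\beta J=\sum\beta_hJ_h$; $J_\emptyset=1$, $J_K=J_{k_1}\cdots J_{k_p}$; $\overline\beta^h$ flips the sign of $\beta_h$. $D\subseteq\mathbb R_{0,t_0}\times\mathbb R^\tau$ open, reflection invariant, $\Omega_D=\{\alpha+\beta J\}$ open. $T$-stem functions $F=\sum_KE_KF_K:D\to A\otimes\mathbb R^{2^\tau}$ ($F_K(\alpha,\overline\beta^h)=F_K$ if $h\notin K$, $-F_K$ if $h\in K$) induce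 $\mathcal I(F)(\alpha+\beta J)=\sum_KJ_KF_K(\alpha,\beta)$ ($\mathcal I$ injective); $\mathrm{Stem}^p_T$, $\mathcal S^p_T$ their $C^p$ versions. Laplacian: writing $\alpha=\sum_{s\le t_0}x_sv_s$, $(\Delta_TF)_K=\sum_{s=0}^{t_0}\partial^2_{x_s}F_K+\sum_{h}\partial^2_{\beta_h}F_K$ and $\Delta_T\mathcal I(F)=\mathcal I(\Delta_TF)$; the same for any list of steps. For $1\le\sigma\le\tau$, $T_\sigma=(t_\sigma,\dots,t_\tau)$ (mirror $\mathbb R_{0,t_\sigma}$), and $\Omega_D=\Omega_{D^\sigma}$ for $T_\sigma$ with $D^\sigma=\{(\alpha+x^1+\dots+x^\sigma,\beta_{\sigma+1},\dots,\beta_\tau):x^v\in\mathbb R_{t_{v-1}+1,t_v},(\alpha,\|x^1\|,\dots,\|x^\sigma\|,\beta_{\sigma+1},\dots)\in D\}$; every element of $\mathcal S^p_T(\Omega_D,A)$, $p\in\{\infty,\omega\}$, is also an element of $\mathcal S^p_{T_\sigma}(\Omega_D,A)$, and $\Delta_{T_\sigma}f$ is computed in that sense. *)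

(* Defs.v *)
From HB Require Import structures.
From mathcomp Require Import all_boot all_order all_algebra all_field.
From mathcomp Require Import all_classical all_reals all_analysis.

Set Implicit Arguments.
Unset Strict Implicit.
Unset Printing Implicit Defensive.

Import Order.TTheory GRing.Theory Num.Theory.
Import numFieldNormedType.Exports.
Local Open Scope classical_set_scope.
Local Open Scope ring_scope.

Inductive regularity := Cinf | Comega.

Section Regularity.
Variable R : realType.

Definition ev (n : nat) (i : 'I_n) : 'rV[R]_n := delta_mx 0 i.

Definition pdR (n m : nat) (i : 'I_n) (g : 'rV[R]_n -> 'rV[R]_m) : 'rV[R]_n -> 'rV[R]_m :=
  fun x => 'D_(ev i) g x.

Definition iter_pd (n m : nat) (l : seq 'I_n) (g : 'rV[R]_n -> 'rV[R]_m) :=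
  foldr (@pdR n m) g l.

Definition smooth_on (n m : nat) (U : set 'rV[R]_n) (g : 'rV[R]_n -> 'rV[R]_m) :=
  forall (l : seq 'I_n) (x : 'rV[R]_n), U x ->
    {for x, continuous (iter_pd l g)} /\ forall i, derivable (iter_pd l g) x (ev i).

Definition monom (n : nat) (x y : 'rV[R]_n) (a : {ffun 'I_n -> nat}) : R :=
  \prod_(i < n) (y 0 i - x 0 i) ^+ a i.

Definition ffnat (n k : nat) (a : {ffun 'I_n -> 'I_k}) : {ffun 'I_n -> nat} :=
  [ffun i => val (a i)].

Definition psum (n m : nat) (c : {ffun 'I_n -> nat} -> 'rV[R]_m) (x y : 'rV[R]_n)
  (k : nat) : 'rV[R]_m :=
  \sum_(a : {ffun 'I_n -> 'I_k.+1}) monom x y (ffnat a) *: c (ffnat a).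

Definition psum_abs (n m : nat) (c : {ffun 'I_n -> nat} -> 'rV[R]_m) (x y : 'rV[R]_n)
  (k : nat) : R :=
  \sum_(a : {ffun 'I_n -> 'I_k.+1}) `|monom x y (ffnat a)| * `|c (ffnat a)|.

Definition analytic_on (n m : nat) (U : set 'rV[R]_n) (g : 'rV[R]_n -> 'rV[R]_m) :=
  forall x, U x -> exists2 r : R, 0 < r &
    exists c : {ffun 'I_n -> nat} -> 'rV[R]_m,
      forall y, `|y - x| < r ->
        (exists M : R, forall k, psum_abs c x y k <= M) /\
        (psum c x y k @[k --> \oo] --> g y).

Definition reg_on (p : regularity) (n m : nat) (U : set 'rV[R]_n)
  (g : 'rV[R]_n -> 'rV[R]_m) :=
  match p with Cinf => smooth_on U g | Comega => analytic_on U g end.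

End Regularity.

Section Algebra.
Variables (R : realType) (A : falgType R).

(* coordinates of A (a finite dimensional real vector space) in a fixed basis;
   used only to transport differentiability / analyticity to A-valued maps *)
Definition coordsA (a : A) : 'rV[R]_(\dim {:A}) :=
  \row_i coord (vbasis fullv) i a.
Definition fromcoords (r : 'rV[R]_(\dim {:A})) : A :=
  \sum_i r 0 i *: (vbasis fullv)`_i.

Definition regA (p : regularity) (n : nat) (U : set 'rV[R]_n) (g : 'rV[R]_n -> A) :=
  reg_on p U (coordsA \o g).

Definition pdA (n : nat) (i : 'I_n) (g : 'rV[R]_n -> A) : 'rV[R]_n -> A :=
  fun x => fromcoords (pdR i (coordsA \o g) x).

Definition laplA (n : nat) (g : 'rV[R]_n -> A) : 'rV[R]_n -> A :=
  fun x => \sum_(i < n) pdA i (pdA i g) x.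

Definition star_involution (c : A -> A) :=
  [/\ forall (a : R) (x y : A), c (a *: x + y) = a *: c x + c y,
      forall x, c (c x) = x,
      forall x y, c (x * y) = c y * c x &
      forall a : R, c (a%:A) = a%:A].

Definition sphA (c : A -> A) : set A := [set J | J + c J = 0 /\ J * c J = 1].

Definition toA (N : nat) (v : 'I_N.+1 -> A) (x : 'rV[R]_N.+1) : A :=
  \sum_(s < N.+1) x 0 s *: v s.

Definition admissible_basis (c : A -> A) (N : nat) (v : 'I_N.+1 -> A) :=
  [/\ v ord0 = 1,
      forall x : 'rV[R]_N.+1, toA v x = 0 -> x = 0,
      forall s : 'I_N.+1, s != ord0 -> sphA c (v s),
      forall s r : 'I_N.+1, s != ord0 -> r != ord0 -> s != r ->
         v s * v r = - (v r * v s) &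
      forall x : 'rV[R]_N.+1, exists J, sphA c J /\ exists a b : R,
         toA v x = a%:A + b *: J].

End Algebra.

(* A list of steps T = (t_0, ..., t_tau) is a function t : nat -> nat,       *)
(* used on 0..tau.  Stem variables (alpha, beta) live in                    *)
(* R^(t_0 + 1 + tau) = 'rV_((t 0).+1 + tau): coordinate s <= t_0 is x_s     *)
(* (alpha = sum_{s<=t_0} x_s v_s) and coordinate (t 0).+1 + h is beta_{h+1}. *)
(* Subsets K of {1..tau} are sets of h : 'I_tau (h standing for h+1).        *)

Section Stems.
Variables (R : realType) (A : falgType R).

Definition steps (t : nat -> nat) (tau N : nat) :=
  (forall h, (h < tau)%N -> (t h < t h.+1)%N) /\ t tau = N.

(* value of the k-th coordinate (0 if out of range) *)
Definition coordn (n : nat) (y : 'rV[R]_n) (k : nat) : R :=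
  \sum_(i < n | val i == k) y 0 i.

Definition betai (t : nat -> nat) (tau : nat) (h : 'I_tau) : 'I_((t 0).+1 + tau) :=
  rshift (t 0).+1 h.

Definition inblock (t : nat -> nat) (h s : nat) := (t h < s <= t h.+1)%N.

(* J in the torus S_{t_0+1,t_1} x ... x S_{t_{tau-1}+1,t_tau}, each J_{h+1}
   given by its coordinates in the basis v *)
Definition torus (t : nat -> nat) (tau N : nat) (J : 'I_tau -> 'rV[R]_N.+1) :=
  forall h : 'I_tau,
    (forall s : 'I_N.+1, ~~ inblock t h s -> J h 0 s = 0) /\
    \sum_(s < N.+1 | inblock t h s) (J h 0 s) ^+ 2 = 1.

(* coordinates of alpha + beta J *)
Definition pt (t : nat -> nat) (tau N : nat) (y : 'rV[R]_((t 0).+1 + tau))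
  (J : 'I_tau -> 'rV[R]_N.+1) : 'rV[R]_N.+1 :=
  \row_(s < N.+1) ((if (s <= t 0)%N then coordn y s else 0) +
                   \sum_(h < tau) y 0 (@betai t tau h) * J h 0 s).

Definition JK (N tau : nat) (v : 'I_N.+1 -> A) (J : 'I_tau -> 'rV[R]_N.+1)
  (K : {set 'I_tau}) : A :=
  \prod_(h < tau | h \in K) toA v (J h).

Definition refl (t : nat -> nat) (tau : nat) (h : 'I_tau)
  (y : 'rV[R]_((t 0).+1 + tau)) : 'rV[R]_((t 0).+1 + tau) :=
  \row_i (if i == @betai t tau h then - y 0 i else y 0 i).

Definition refl_invariant (t : nat -> nat) (tau : nat) (D : set 'rV[R]_((t 0).+1 + tau)) :=
  forall h y, D y -> D (@refl t tau h y).

(* F = sum_K E_K F_K is a T-stem function on D *)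
Definition stem (t : nat -> nat) (tau : nat) (D : set 'rV[R]_((t 0).+1 + tau))
  (F : {set 'I_tau} -> 'rV[R]_((t 0).+1 + tau) -> A) :=
  forall (h : 'I_tau) K y, D y ->
    F K (@refl t tau h y) = if h \in K then - F K y else F K y.

Definition stem_p (p : regularity) (t : nat -> nat) (tau : nat)
  (D : set 'rV[R]_((t 0).+1 + tau)) (F : {set 'I_tau} -> 'rV[R]_((t 0).+1 + tau) -> A) :=
  @stem t tau D F /\ forall K, regA p D (F K).

Definition induces (t : nat -> nat) (tau N : nat) (v : 'I_N.+1 -> A)
  (D : set 'rV[R]_((t 0).+1 + tau)) (F : {set 'I_tau} -> 'rV[R]_((t 0).+1 + tau) -> A)
  (f : A -> A) :=
  forall y J, D y -> @torus t tau N J ->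
    f (toA v (@pt t tau N y J)) = \sum_(K : {set 'I_tau}) JK v J K * F K y.

Definition lapl_stem (n tau : nat) (F : {set 'I_tau} -> 'rV[R]_n -> A) :=
  fun K => laplA (F K).

Definition tsig (t : nat -> nat) (sigma : nat) : nat -> nat := fun h => t (h + sigma).

(* the map (alpha + x^1 + ... + x^sigma, beta_{sigma+1}, ..., beta_tau)
   |-> (alpha, ||x^1||, ..., ||x^sigma||, beta_{sigma+1}, ..., beta_tau) *)
Definition projsig (t : nat -> nat) (tau sigma : nat)
  (y : 'rV[R]_((t sigma).+1 + (tau - sigma))) : 'rV[R]_((t 0).+1 + tau) :=
  \row_(i < (t 0).+1 + tau)
    (if (i <= t 0)%N then coordn y i
     else if (i - (t 0).+1 < sigma)%N then
       Num.sqrt (\sum_(s < (t sigma).+1 | inblock t (i - (t 0).+1) s) (coordn y s) ^+ 2)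
     else coordn y ((t sigma).+1 + (i - (t 0).+1 - sigma))).

Definition Dsig (t : nat -> nat) (tau sigma : nat) (D : set 'rV[R]_((t 0).+1 + tau)) :
  set 'rV[R]_((t sigma).+1 + (tau - sigma)) :=
  [set y | D (@projsig t tau sigma y)].

End Stems.

(* Main.v *)
Require Import Defs.
From HB Require Import structures.
From mathcomp Require Import all_boot all_order all_algebra all_field.
From mathcomp Require Import all_classical all_reals all_analysis.
From mathcomp Require Import ring lra.
Import Order.TTheory GRing.Theory Num.Theory.
Import numFieldNormedType.Exports.
Local Open Scope classical_set_scope.
Local Open Scope ring_scope.
Set Implicit Arguments.
Unset Strict Implicit.
Unset Printing Implicit Defensive.

(* Fix [J'] in the torus of [T_sigma]: by linearity the left-hand side is the Euclidean
   Laplacian of [z |-> f (z J')], whatever the [T_sigma]-stem function inducing [f] is.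
   Writing [beta_h = |x^h|] and [J_h = x^h / |x^h|] for [h <= sigma], this function is the
   sum of the [J_K F_K(beta)], and the terms of G are the usual first order terms of the
   Laplacian of a radial function (h not in K), or of [x^h] times a radial function
   (h in K), in dimension t_h - t_{h-1}.  Only second derivatives along coordinate lines
   are needed.  Points with some [x^h = 0] are reached as limits.
   G extends regularly through [beta_h = 0] because [F_K] is even in [beta_h] for h not
   in K and odd otherwise, and because the quotient by a coordinate of a C^infinity or
   analytic map vanishing with that coordinate is again such a map. *)

(** * Smooth maps and symmetry of second derivatives *)

(** [H] is an arbitrary stem function inducing [f], so its components are never identified: after
    applying a real functional [mu], the sum over [H] and the sum over [F], restricted to a
    coordinate line, are one function of a real variable, and its second derivative is unique. The
    obstacle is that x^h / |x^h| has no continuous extension to x^h = 0. A degenerate point is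
    therefore approached along a ray on which all unit vectors stay constant; only the stem
    variables move, and the limit needs just the continuity of Delta_T F + G and of the Laplacian of
    [H]. This is why G is built, with its regularity across beta_h = 0, before the comparison.
    Smoothness is expressed by iterated partial derivatives, so all of them are needed for g / x_h:
    those in direction h come from a Taylor numerator, the others are moved onto g, which requires
    mixed derivatives to commute. In the analytic case the quotient is formed on the coefficients.
    The conclusion ranges over all presentations of a point, whence a separate check that Delta_T F
    + G gives the same sum for each of them. *)

Lemma is_derive_line {R : realType} {V W : normedModType R} (f : V -> W) (x v : V)
    (s : R) (l : W) :
  is_derive (s *: v + x) v f l <-> is_derive s 1 (fun u : R => f (u *: v + x)) l.
Proof.
have e : (fun h : R => h^-1 *: ((f \o shift (s *: v + x)) (h *: v) - f (s *: v + x)))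
  = (fun h : R => h^-1 *: (((fun u : R => f (u *: v + x)) \o shift s) (h *: 1)
                     - (fun u : R => f (u *: v + x)) s)).
  by apply/funext => h /=; rewrite [h *: 1]mulr1 scalerDl addrA.
by split=> -[d <-]; split; move: d; rewrite /derivable /derive ?e.
Qed.

Lemma is_derive_to_line {R : realType} {V W : normedModType R} (f : V -> W) (x v : V)
    (s : R) (l : W) :
  is_derive (s *: v + x) v f l -> is_derive s 1 (fun u : R => f (u *: v + x)) l.
Proof. by case: (is_derive_line f x v s l). Qed.

Lemma is_derive_of_line {R : realType} {V W : normedModType R} (f : V -> W) (x v : V)
    (s : R) (l : W) :
  is_derive s 1 (fun u : R => f (u *: v + x)) l -> is_derive (s *: v + x) v f l.
Proof. by case: (is_derive_line f x v s l). Qed.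

Lemma near_line {R : realType} {V : normedModType R} (x v : V) (s : R) (P : set V) :
  nbhs (s *: v + x) P -> \forall u \near s, P (u *: v + x).
Proof.
move=> h; have : {for s, continuous (fun u : R => u *: v + x)}.
  by apply: continuousD; [apply: scalel_continuous | apply: cst_continuous].
by move/(_ _ h).
Qed.

Lemma near_eq_continuous {V W : topologicalType} (f g : V -> W) (x : V) :
  {near x, f =1 g} -> {for x, continuous f} -> {for x, continuous g}.
Proof.
move=> fg cf; rewrite /prop_for /continuous_at -(nbhs_singleton fg).
exact: cvg_trans (near_eq_cvg fg) cf.
Qed.

Lemma continuous_rV {R : realType} {V : topologicalType} m (f : V -> 'rV[R]_m) (x : V) :
  (forall j, {for x, continuous (fun y => f y 0 j)}) -> {for x, continuous f}.
Proof.
move=> cf; apply/cvgrPdist_le => /= e e0.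
near=> y; rewrite /Num.Def.normr /= mx_normrE (bigmax_le _ (ltW e0)) //= => -[a j] _.
rewrite !mxE /= !ord1; move: j; near: y; apply: filter_forall => /= j.
by move/cvgrPdist_le : (cf j) => /(_ _ e0).
Unshelve. all: by end_near. Qed.

Section Smooth.
Variables (R : realType) (n : nat).
Implicit Types (U : set 'rV[R]_n) (W : normedModType R).
Local Notation e_ := (ev R).

(** Takes values in any normed module, so that scalar functions are covered as well; on row vectors
    it is convertible to [pdR], and [smooth] to [smooth_on]. *)
Definition pd W (i : 'I_n) (f : 'rV[R]_n -> W) : 'rV[R]_n -> W := fun x => 'D_(e_ i) f x.

Definition smooth W U (f : 'rV[R]_n -> W) :=
  forall (l : seq 'I_n) x, U x ->
    {for x, continuous (foldr (@pd W) f l)} /\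
    forall i, derivable (foldr (@pd W) f l) x (e_ i).

Lemma smooth_pd W U (f : 'rV[R]_n -> W) i : smooth U f -> smooth U (pd i f).
Proof. by move=> sf l; have := sf (rcons l i); rewrite foldr_rcons. Qed.

Lemma smooth_continuous W U (f : 'rV[R]_n -> W) x :
  smooth U f -> U x -> {for x, continuous f}.
Proof. by move=> sf Ux; have [] := sf [::] x Ux. Qed.

Lemma smooth_is_derive W U (f : 'rV[R]_n -> W) x i :
  smooth U f -> U x -> is_derive x (e_ i) f (pd i f x).
Proof. by move=> sf Ux; have [_ /(_ i) /derivableP] := sf [::] x Ux. Qed.

(** Smoothness graded by order instead of by lists of indices. The derivative peeled off is the
    innermost one, so closure properties go by induction on [k] for all functions at once. *)
Fixpoint Ck W U k (f : 'rV[R]_n -> W) : Prop :=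
  (forall x, U x -> {for x, continuous f}) /\
  if k is k'.+1 then
    forall i, (forall x, U x -> derivable f x (e_ i)) /\ Ck U k' (pd i f)
  else True.

Lemma smoothP W U (f : 'rV[R]_n -> W) : smooth U f <-> forall k, Ck U k f.
Proof.
split=> [sf k|Cf].
  elim: k f sf => [|k IH] f sf /=; split=> //.
  - by move=> x; apply: smooth_continuous.
  - by move=> x; apply: smooth_continuous.
  - move=> i; split; last by apply/IH/smooth_pd.
    by move=> x Ux; have [] := smooth_is_derive i sf Ux.
(* The last index of the list is the derivative taken first, the one that [Ck] peels off. *)
move=> l; elim/last_ind: l f Cf => [|l i IH] f Cf.
  move=> x Ux /=; split; first by have [/(_ x Ux)] := Cf 0%N.
  by move=> i; have [_ /(_ i) [/(_ x Ux)]] := Cf 1%N.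
rewrite foldr_rcons; apply: IH => k.
by have [_ /(_ i) []] := Cf k.+1.
Qed.

Lemma eq_pd W U (f g : 'rV[R]_n -> W) i : open U ->
  (forall x, U x -> f x = g x) -> forall x, U x -> pd i f x = pd i g x.
Proof.
move=> oU fg x Ux; apply: near_eq_derive.
by near=> y; apply: fg; near: y; apply: open_nbhs_nbhs.
Unshelve. all: by end_near. Qed.

Lemma eq_Ck W U k (f g : 'rV[R]_n -> W) : open U ->
  (forall x, U x -> f x = g x) -> Ck U k f -> Ck U k g.
Proof.
move=> oU; elim: k f g => [|k IH] f g fg /= [cf df].
all: have nfg x : U x -> \near x, f x = g x.
1,3: by move=> Ux; near=> y; apply: fg; near: y; apply: open_nbhs_nbhs.
all: have cg x : U x -> {for x, continuous g}.
1,3: by move=> Ux; apply: near_eq_continuous (nfg x Ux) (cf x Ux).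
  by [].
split=> // i; have [dfi Cfi] := df i; split.
  by move=> x Ux; apply: near_eq_derivable (nfg x Ux) (dfi x Ux).
by apply: IH Cfi; exact: eq_pd.
Unshelve. all: by end_near. Qed.

Lemma eq_smooth W U (f g : 'rV[R]_n -> W) : open U ->
  (forall x, U x -> f x = g x) -> smooth U f -> smooth U g.
Proof. by move=> oU fg /smoothP sf; apply/smoothP => k; apply: eq_Ck oU fg (sf k). Qed.

Lemma smoothD W U (f g : 'rV[R]_n -> W) : open U ->
  smooth U f -> smooth U g -> smooth U (f + g).
Proof.
move=> oU /smoothP sf /smoothP sg; apply/smoothP => k.
elim: k f g {sf sg}(sf k) (sg k) => [|k IH] f g /= [cf df] [cg dg]; split => //.
1,2: by move=> x Ux; apply: continuousD; [apply: cf | apply: cg].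
move=> i; have [dfi Cfi] := df i; have [dgi Cgi] := dg i; split.
  by move=> x Ux; apply: derivableD; [apply: dfi | apply: dgi].
apply: (eq_Ck oU _ (IH _ _ Cfi Cgi)) => x Ux.
by rewrite /pd deriveD //; [apply: dfi | apply: dgi].
Qed.

Lemma smoothZ W U (a : R) (f : 'rV[R]_n -> W) : open U ->
  smooth U f -> smooth U (a \*: f).
Proof.
move=> oU /smoothP sf; apply/smoothP => k.
elim: k f {sf}(sf k) => [|k IH] f /= [cf df]; split => //.
1,2: by move=> x Ux; apply: continuousZr; apply: cf.
move=> i; have [dfi Cfi] := df i; split.
  by move=> x Ux; apply: derivableZ; apply: dfi.
apply: (eq_Ck oU _ (IH _ Cfi)) => x Ux.
by rewrite /pd deriveZ //; apply: dfi.
Qed.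

Lemma smooth0 W U : smooth U (0 : 'rV[R]_n -> W).
Proof.
apply/smoothP; elim=> [|k IH] /=; split=> //.
1,2: by move=> x _; apply: cst_continuous.
move=> i; split; first by move=> x _; apply: derivable_cst.
suff -> : pd i (0 : 'rV[R]_n -> W) = 0 by [].
by apply/funext => x; apply: derive_cst.
Qed.

Lemma smooth_sum W U (I : Type) (r : seq I) (P : pred I) (f : I -> 'rV[R]_n -> W) :
  open U -> (forall i, P i -> smooth U (f i)) -> smooth U (\sum_(i <- r | P i) f i).
Proof.
move=> oU sf; apply: big_ind => //; first exact: smooth0.
by move=> g h; apply: smoothD.
Qed.

Lemma smooth_coord U m (f : 'rV[R]_n -> 'rV[R]_m) : open U ->
  smooth U f <-> forall j, smooth U (fun x => f x 0 j).
Proof.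
move=> oU.
have pdE (g : _ -> 'rV[R]_m) i j x : derivable g x (e_ i) ->
    (pd i g x : 'rV[R]_m) 0 j = pd i (fun y => g y 0 j) x.
  by move=> d; rewrite /pd derive_mx // mxE.
split=> [sf j|sf].
  apply/smoothP => k; move/smoothP/(_ k) : sf.
  elim: k f => [|k IH] f /= [cf df]; split => //.
  1,2: move=> x Ux; apply: (@continuous_comp _ _ _ f (fun u : 'rV[R]_m => u 0 j)).
  1,3: exact: cf.
  1,2: exact: coord_continuous.
  move=> i; have [dfi Cfi] := df i; split.
    by move=> x Ux; have /derivable_mxP := dfi x Ux.
  by apply: (eq_Ck oU _ (IH _ Cfi)) => x Ux; apply: pdE; apply: dfi.
apply/smoothP => k; have {sf} : forall j, Ck U k (fun x => f x 0 j).
  by move=> j; move/smoothP : (sf j).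
elim: k f => [|k IH] f Cf /=.
all: have cf x : U x -> {for x, continuous f}.
1,3: by move=> Ux; apply: continuous_rV => j; have [/(_ x Ux)] := Cf j.
  by [].
split => // i.
have di x : U x -> derivable f x (e_ i).
  move=> Ux; apply/derivable_mxP => a j; rewrite ord1.
  by have [_ /(_ i) [/(_ x Ux)]] := Cf j.
split=> //; apply: IH => j.
have [_ /(_ i) [_ Cj]] := Cf j.
by apply: (eq_Ck oU _ Cj) => x Ux; rewrite pdE //; apply: di.
Qed.

End Smooth.

(** Treats both signs of [s] at once and asks for no derivative at 0, which is exactly the point
    where [is_derive_extend] does not know it yet. *)
Lemma MVT_abs {R : realType} (f df : R -> R) (s : R) : s != 0 ->
  (forall u : R, 0 < `|u| < `|s| -> is_derive u 1 f (df u)) ->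
  (forall u : R, `|u| <= `|s| -> {for u, continuous f}) ->
  exists2 u, 0 < `|u| < `|s| & f s - f 0 = s * df u.
Proof.
move=> s0 dfu cf; have [sp|sn] := ltP 0 s.
  have [||c /[1!in_itv]/= /andP[c0 cs] E] := @MVT R f df 0 s sp.
  - move=> u /[1!in_itv]/= /andP[u0 us]; apply: dfu.
    by rewrite !gtr0_norm // u0.
  - apply/continuous_in_subspaceT => u /[1!inE]/= /[1!in_itv]/= /andP[u0 us].
    by apply: cf; rewrite !ger0_norm // ltW.
  exists c; first by rewrite !gtr0_norm // c0.
  by rewrite E subr0 mulrC.
have {}sn : s < 0 by rewrite lt_neqAle s0.
have [||c /[1!in_itv]/= /andP[sc c0] E] := @MVT R f df s 0 sn.
- move=> u /[1!in_itv]/= /andP[su u0]; apply: dfu.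
  by rewrite !ltr0_norm // oppr_gt0 u0 ltrN2.
- apply/continuous_in_subspaceT => u /[1!inE]/= /[1!in_itv]/= /andP[su u0].
  by apply: cf; rewrite !ler0_norm // ?lerN2 // ltW.
exists c; first by rewrite !ltr0_norm // oppr_gt0 c0 ltrN2.
by rewrite -opprB E sub0r mulrN opprK mulrC.
Qed.

(** By the mean value theorem the difference quotient at 0 is a value [df u] with u closer to 0, and
    [df] is continuous there. It yields the derivatives of quotients at points of the hyperplane x_h
    = 0. *)
Lemma is_derive_extend {R : realType} (f df : R -> R) :
  nbhs (0 : R) (fun u : R => {for u, continuous f}) ->
  nbhs (0 : R) (fun u : R => u != 0 -> is_derive u 1 f (df u)) ->
  {for (0 : R), continuous df} -> is_derive (0 : R) 1 f (df 0).
Proof.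
move=> cf dfu cdf.
have lim : h^-1 *: ((f \o shift 0) (h *: 1) - f 0) @[h --> 0^'] --> df 0.
  apply/cvgrPdist_le => /= e e0.
  have /cvgrPdist_le/(_ _ e0) cdfe := cdf.
  have [d /= d0 hd] : nbhs_ball (0 : R) (fun u : R => [/\ {for u, continuous f},
      (u != 0 -> is_derive u 1 f (df u)) & `|df 0 - df u| <= e]).
    by apply/nbhs_ballP; apply: filterS3 cf dfu cdfe => u; split.
  have {}hd (u : R) : `|u| < d -> [/\ {for u, continuous f},
      (u != 0 -> is_derive u 1 f (df u)) & `|df 0 - df u| <= e].
    by move=> ud; apply: hd; rewrite /ball /= sub0r normrN.
  near=> h.
  have h0 : h != 0 by near: h; exact: nbhs_dnbhs_neq.
  have hd' : `|h| < d by near: h; exact: dnbhs0_lt.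
  have [||u /andP[u0 uh] E] := @MVT_abs R f df h h0.
  - move=> u /andP[u0 uh]; have [_ + _] := hd u (lt_trans uh hd').
    by apply; rewrite -normr_gt0.
  - by move=> u uh; have [] := hd u (le_lt_trans uh hd').
  have [_ _] := hd u (lt_trans uh hd').
  by rewrite /= addr0 [h *: 1]mulr1 E scalerA mulVf // scale1r.
split; last exact/cvg_lim.
by apply/cvg_ex; exists (df 0).
Unshelve. all: by end_near. Qed.

Section Hadamard.
Variables (R : realType) (n : nat).
Local Notation e_ := (ev R).
Implicit Types (U : set 'rV[R]_n) (f g : 'rV[R]_n -> R).

Lemma evE (i j : 'I_n) : e_ i 0 j = (j == i)%:R.
Proof. by rewrite mxE eqxx. Qed.

Lemma rV_norm_le (x : 'rV[R]_n) (d : R) : 0 <= d ->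
  (forall j, `|x 0 j| <= d) -> `|x| <= d.
Proof.
move=> d0 xd; rewrite /Num.Def.normr /= mx_normrE bigmax_le //= => -[a j] _.
by rewrite ord1; apply: xd.
Qed.

Lemma rV_coord_le (x : 'rV[R]_n) j : `|x 0 j| <= `|x|.
Proof.
rewrite [leRHS]/Num.Def.normr /= mx_normrE.
exact: (le_bigmax _ (fun ij : 'I_1 * 'I_n => `|x ij.1 ij.2|) (0, j)).
Qed.

Lemma ev_norm_le (i : 'I_n) : `|e_ i| <= 1.
Proof. by apply: rV_norm_le => // j; rewrite evE; case: eqP; rewrite ?normr1 ?normr0. Qed.

Lemma smooth_line (W : normedModType R) U (f : 'rV[R]_n -> W) x i u :
  @smooth R n W U f -> U (u *: e_ i + x) ->
  is_derive u 1 (fun s : R => f (s *: e_ i + x)) (pd i f (u *: e_ i + x)).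
Proof. by move=> sf Ux; apply: is_derive_to_line; exact: (smooth_is_derive i sf Ux). Qed.

Lemma continuous_line (W : normedModType R) (f : 'rV[R]_n -> W) (x v : 'rV[R]_n) (u : R) :
  {for u *: v + x, continuous f} -> {for u, continuous (fun s : R => f (s *: v + x))}.
Proof.
move=> cf; have cl : {for u, continuous (fun s : R => s *: v + x)}.
  by apply: continuousD; [apply: scalel_continuous | apply: cst_continuous].
exact: (continuous_comp cl cf).
Qed.

Lemma MVT_pd f x i (s : R) :
  (forall u, `|u| <= `|s| -> {for u *: e_ i + x, continuous f} /\
                             derivable f (u *: e_ i + x) (e_ i)) ->
  exists2 u, `|u| <= `|s| & f (s *: e_ i + x) - f x = s * pd i f (u *: e_ i + x).
Proof.
move=> df; have [->|s0] := eqVneq s 0.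
  by exists 0; rewrite ?normr0 // scale0r add0r subrr mul0r.
have [||u /andP[_ us] E] := @MVT_abs R (fun u => f (u *: e_ i + x))
  (fun u => pd i f (u *: e_ i + x)) s s0.
- by move=> u /andP[_ /ltW us]; apply/is_derive_to_line/derivableP; have [] := df u us.
- by move=> u us; apply: continuous_line; have [] := df u us.
by exists u; rewrite ?(ltW us) // -E scale0r add0r.
Qed.

(** The double difference is the increment along [e_i] of y |-> f (s e_j + y) - f y. The mean value
    theorem in direction i, then in direction j, makes it s^2 times the mixed derivative at a point
    near x. *)
Lemma second_difference U f x i j (e : R) : open U -> smooth U f -> U x -> 0 < e ->
  \forall s \near 0^'+, `|pd j (pd i f) x -
    (f (s *: e_ i + (s *: e_ j + x)) - f (s *: e_ i + x) - f (s *: e_ j + x) + f x)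
      / s ^+ 2| <= e.
Proof.
move=> oU sf Ux e0.
have /cvgrPdist_le/(_ _ e0) ce := smooth_continuous (smooth_pd j (smooth_pd i sf)) Ux.
have [d /= d0 hd] : nbhs_ball x (fun y => U y /\ `|pd j (pd i f) x - pd j (pd i f) y| <= e).
  by apply/nbhs_ballP; apply: filterS2 (open_nbhs_nbhs (conj oU Ux)) ce => y; split.
have {}hd (u w s : R) : `|u| <= s -> `|w| <= s -> s + s < d ->
    U (w *: e_ j + (u *: e_ i + x)) /\
    `|pd j (pd i f) x - pd j (pd i f) (w *: e_ j + (u *: e_ i + x))| <= e.
  move=> us ws sd; apply: hd; rewrite -ball_normE /= (addrC (u *: _)) addrCA.
  rewrite opprD addrA subrr add0r normrN; apply: le_lt_trans sd; apply: le_trans (ler_normD _ _) _.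
  rewrite !normrZ; apply: lerD.
    by apply: le_trans ws; rewrite -[leRHS]mulr1 ler_wpM2l // ev_norm_le.
  by apply: le_trans us; rewrite -[leRHS]mulr1 ler_wpM2l // ev_norm_le.
near=> s.
have s0 : 0 < s by [].
have sd : s + s < d.
  have : s < d / 2 by near: s; apply: nbhs_right_lt; rewrite divr_gt0.
  by move=> ?; rewrite [d]splitr ltrD.
have sE : `|s| = s by rewrite gtr0_norm.
have s'0 : `|0 : R| <= s by rewrite normr0 ltW.
have U0 u : `|u| <= s -> U (u *: e_ i + x).
  by move=> us; have [+ _] := hd u 0 s us s'0 sd; rewrite scale0r add0r.
have U1 u : `|u| <= s -> U (u *: e_ i + (s *: e_ j + x)).
  by move=> us; rewrite addrCA; have [] := hd u s s us _ sd; rewrite ?sE.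
pose g y := f (s *: e_ j + y) - f y.
have dg u : `|u| <= s -> is_derive (u *: e_ i + x) (e_ i) g
    (pd i f (s *: e_ j + (u *: e_ i + x)) - pd i f (u *: e_ i + x)).
  move=> us; apply: is_deriveB; last by apply: smooth_is_derive sf _; apply: U0.
  apply: is_derive_of_line.
  have := @smooth_line R^o U f (s *: e_ j + x) i u sf (U1 _ us).
  by rewrite addrCA; under eq_fun do rewrite addrCA.
have cg u : `|u| <= s -> {for u *: e_ i + x, continuous g}.
  move=> us; apply: continuousB; last by apply: smooth_continuous sf _; apply: U0.
  have cs : {for u *: e_ i + x, continuous (fun y => s *: e_ j + y)}.
    by apply: continuousD; [exact: cst_continuous|exact: cvg_id].
  apply: (continuous_comp cs).
  by apply: smooth_continuous sf _; rewrite addrCA; apply: U1.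
have [u|u us E] := @MVT_pd g x i s.
  by rewrite sE => us; split; [apply: cg|have [] := dg _ us].
rewrite sE in us.
have [w|w ws E2] := @MVT_pd (pd i f) (u *: e_ i + x) j s.
  rewrite sE => ws; have [Uw _] := hd u w s us ws sd.
  have sif := smooth_pd i sf.
  by split; [apply: smooth_continuous sif Uw | have [] := smooth_is_derive j sif Uw].
rewrite sE in ws.
have [_] := hd u w s us ws sd; congr (`| _ - _ | <= _).
have pg : pd i g (u *: e_ i + x) =
    pd i f (s *: e_ j + (u *: e_ i + x)) - pd i f (u *: e_ i + x).
  by case: (dg _ us).
move: E; rewrite pg E2 /g mulrA -expr2 => E.
have -> : f (s *: e_ i + (s *: e_ j + x)) - f (s *: e_ i + x) - f (s *: e_ j + x) + f x
  = s ^+ 2 * pd j (pd i f) (w *: e_ j + (u *: e_ i + x)).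
  by rewrite -E (addrCA (s *: e_ i)); ring.
by rewrite mulrC mulKf // expf_neq0 // gt_eqF.
Unshelve. all: by end_near. Qed.

(** The second difference quotient is symmetric in i and j, and for one small s it is within e / 2
    of both mixed derivatives. *)
Lemma pdC U f x i j : open U -> smooth U f -> U x -> pd i (pd j f) x = pd j (pd i f) x.
Proof.
move=> oU sf Ux; apply/eqP; rewrite -subr_eq0 -normr_le0; apply/ler_addgt0Pl => e e0.
rewrite addr0 [leRHS]splitr.
have e2 : 0 < e / 2 by rewrite divr_gt0.
have [s [h1 h2]] := filter_ex (filterI
  (second_difference i j oU sf Ux e2) (second_difference j i oU sf Ux e2)).
have E : f (s *: e_ j + (s *: e_ i + x)) - f (s *: e_ j + x) - f (s *: e_ i + x) + f x =
  f (s *: e_ i + (s *: e_ j + x)) - f (s *: e_ i + x) - f (s *: e_ j + x) + f x.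
  by rewrite (addrCA (s *: e_ j)); congr (_ + _); rewrite addrAC.
move: h1 h2; rewrite E; set q := _ / _; set a := pd j _ x; set b := pd i _ x => h1 h2.
apply: le_trans (ler_distD q _ _) _.
apply: lerD; first exact: h2.
by rewrite distrC; exact: h1.
Qed.

End Hadamard.

Lemma nbhs_dist {R : realType} {V : normedModType R} (x : V) (P : set V) :
  nbhs x P -> exists2 d : R, 0 < d & forall y, `|x - y| < d -> P y.
Proof.
move=> /nbhs_ballP[d /= d0 hd]; exists d => // y xy.
by apply: hd; rewrite -ball_normE.
Qed.

Lemma dist_nbhs {R : realType} {V : normedModType R} (x : V) (P : set V) (d : R) :
  0 < d -> (forall y, `|x - y| < d -> P y) -> nbhs x P.
Proof.
move=> d0 hd; apply/nbhs_ballP; exists d => // y.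
by rewrite -ball_normE => /hd.
Qed.

Lemma continuous_distP {R : realType} {V W : normedModType R} (f : V -> W) (x : V) :
  {for x, continuous f} <-> forall e : R, 0 < e -> nbhs x (fun y => `|f x - f y| <= e).
Proof. by split=> [/cvgrPdist_le|?]; last exact/cvgrPdist_le. Qed.

(** * Division of smooth functions by a coordinate *)

Section HadamardQuotient.
Variables (R : realType) (n : nat) (h : 'I_n) (U : set 'rV[R]_n).
Hypothesis oU : open U.
Local Notation e_ := (ev R).
Implicit Types (f g : 'rV[R]_n -> R) (x y z : 'rV[R]_n).

Lemma is_derive_coordinate (x : 'rV[R]_n) (i j : 'I_n) :
  is_derive x (e_ i) (fun y : 'rV[R]_n => y 0 j) (j == i)%:R.
Proof.
have {1}-> : x = 0 *: e_ i + x by rewrite scale0r add0r.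
apply: is_derive_of_line.
have -> : (fun u : R => (u *: e_ i + x) 0 j) = (fun u => (j == i)%:R * u + x 0 j).
  by apply/funext => u; rewrite !mxE eqxx /= mulrC.
by apply: is_derive_eq; rewrite /= addr0 [_ *: _]mulr1.
Qed.

Lemma is_derive_coordinateX x k :
  is_derive x (e_ h) (fun y => y 0 h ^+ k) (k%:R * x 0 h ^+ k.-1).
Proof.
have dx := is_derive_coordinate x h h; rewrite eqxx in dx.
have := is_deriveX k dx; rewrite exprfctE => dX; apply: (is_derive_eq dX).
by rewrite [LHS]mulr1.
Qed.

Lemma continuous_coordinateX x k : {for x, continuous (fun y => y 0 h ^+ k)}.
Proof.
elim: k => [|k IH]; first exact: cst_continuous.
have cx : {for x, continuous (fun y => y 0 h)} by apply: coord_continuous.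
have -> : (fun y => y 0 h ^+ k.+1) = (fun y => y 0 h * y 0 h ^+ k).
  by apply/funext => y; rewrite exprS.
exact: (continuousM cx IH).
Qed.

(* [taylor_num k g] is [x_h ^ (k+1)] times the [k]-th derivative of [g / x_h] in the
   direction [h]; its own derivative collapses to [x_h ^ k * d_h^(k+1) g], so the mean
   value theorem controls it near [x_h = 0] when [g] vanishes there *)
Fixpoint taylor_num k g : 'rV[R]_n -> R :=
  if k is k'.+1 then
    fun x => x 0 h ^+ k * iter k (pd h) g x - k%:R * taylor_num k' g x
  else g.

(* continuous extension to [x_h = 0] of the [k]-th derivative of [g / x_h] *)
Definition quot_deriv k g x :=
  if x 0 h == 0 then iter k.+1 (pd h) g x / k.+1%:R else taylor_num k g x / x 0 h ^+ k.+1.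

Lemma smooth_iter_pd k g : smooth U g -> smooth U (iter k (pd h) g).
Proof. by move=> sg; elim: k => [//|k IH]; exact: (smooth_pd h IH). Qed.

Lemma is_derive_taylor_num k g x : smooth U g -> U x ->
  is_derive x (e_ h) (taylor_num k g) (x 0 h ^+ k * iter k.+1 (pd h) g x).
Proof.
move=> sg Ux; elim: k => [|k IH].
  by rewrite expr0 mul1r; apply: smooth_is_derive Ux.
have dg := smooth_is_derive h (smooth_iter_pd k.+1 sg) Ux.
have dX := is_derive_coordinateX x k.+1.
have dM := is_deriveB (is_deriveM dX dg) (is_deriveZ k.+1%:R IH).
apply: (is_derive_eq dM); rewrite /GRing.scale /= /GRing.scale /=.
by ring.
Qed.

Lemma taylor_num0 k g x : (forall y, U y -> y 0 h = 0 -> g y = 0) -> U x -> x 0 h = 0 ->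
  taylor_num k g x = 0.
Proof.
move=> g0 Ux xh; elim: k => [|k IH] /=; first exact: g0.
by rewrite IH mulr0 subr0 xh exprS !mul0r.
Qed.

Lemma continuous_taylor_num k g x : smooth U g -> U x ->
  {for x, continuous (taylor_num k g)}.
Proof.
move=> sg Ux; elim: k => [|k IH]; first exact: smooth_continuous Ux.
apply: continuousB; last by apply: continuousM => //; apply: cst_continuous.
apply: continuousM; last exact: smooth_continuous (smooth_iter_pd k.+1 sg) Ux.
exact: continuous_coordinateX.
Qed.

(** Estimate at a point of the hyperplane: [taylor_num] vanishes at the projection [y0] of y, and
    its derivative carries the factor x_h^k, so the mean value theorem between [y0] and y leaves a
    bounded quotient after division by y_h^(k+1). *)
Lemma quot_deriv_bound k g x (d e : R) : smooth U g ->
  (forall y, U y -> y 0 h = 0 -> g y = 0) -> x 0 h = 0 ->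
  (forall y, `|x - y| < d -> U y /\
     `|iter k.+1 (pd h) g x - iter k.+1 (pd h) g y| <= e) ->
  forall y, `|x - y| < d -> `|quot_deriv k g x - quot_deriv k g y| <= e.
Proof.
move=> sg g0 xh hd y yd; rewrite /quot_deriv xh eqxx.
have [Uy] := hd _ yd.
have k1 : k.+1%:R != 0 :> R by rewrite pnatr_eq0.
case: eqVneq => [yh|yh] Gy.
  rewrite -mulrBl normrM [`|_^-1|]gtr0_norm ?invr_gt0 ?ltr0n //.
  rewrite ler_pdivrMr ?ltr0n //; apply: (le_trans Gy).
  by rewrite ler_peMr // ?ler1n //; apply: le_trans (normr_ge0 _) Gy.
set L := iter k.+1 _ g x in Gy hd *.
(* Projection of y to the hyperplane. For the maximum norm, the whole segment from [y0] to y is at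
   most as far from x as y is. *)
pose y0 := - y 0 h *: e_ h + y.
have y0h : y0 0 h = 0 by rewrite !mxE !eqxx mulr1 addNr.
have yE : y 0 h *: e_ h + y0 = y by rewrite addrA -scalerDl subrr scale0r add0r.
have near_y0 u : `|u| <= `|y 0 h| -> `|x - (u *: e_ h + y0)| < d.
  move=> uy; apply: le_lt_trans yd; apply: rV_norm_le => // j.
  have := rV_coord_le (x - y) j; rewrite !mxE eqxx /= => xyj.
  have [jh|jh] := eqVneq j h; last by move: xyj; rewrite /= !mulr0 !add0r.
  rewrite /= jh xh mulr1 mulr1 addNr addr0 sub0r normrN.
  by apply: le_trans uy _; move: xyj; rewrite jh xh sub0r normrN.
(* The power subtracted is what [taylor_num] would be if the (k+1)-st derivative were the constant
   [L]; the derivative of the difference is x_h^k times the deviation from [L]. *)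
pose f z := taylor_num k g z - L / k.+1%:R * z 0 h ^+ k.+1.
have df z : U z -> is_derive z (e_ h) f (z 0 h ^+ k * (iter k.+1 (pd h) g z - L)).
  move=> Uz; have dt := is_derive_taylor_num k sg Uz.
  have dB := is_deriveB dt (is_deriveZ (L / k.+1%:R) (is_derive_coordinateX z k.+1)).
  by apply: (is_derive_eq dB); rewrite /GRing.scale /= mulrA divfK //; ring.
have [u|u uy E] := @MVT_pd _ _ f y0 h (y 0 h).
  move=> /near_y0/hd[Uu _]; split; last by have [] := df _ Uu.
  apply: continuousB; first exact: continuous_taylor_num.
  apply: continuousM; first exact: cst_continuous.
  exact: continuous_coordinateX.
have [Uu Gu] := hd _ (near_y0 _ uy).
have Uy0 : U y0.
  have [] := hd y0; rewrite // -[y0]add0r -(scale0r (e_ h)).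
  by apply: near_y0; rewrite normr0.
have pdf := @derive_val _ _ _ _ _ _ _ (df _ Uu); rewrite -/(pd h f _) in pdf.
have f0 : f y0 = 0 by rewrite /f taylor_num0 // y0h exprS mul0r mulr0 subr0.
move: E; rewrite pdf yE f0 subr0 /f.
have -> : (u *: e_ h + y0) 0 h = u by rewrite [LHS]mxE y0h addr0 !mxE !eqxx mulr1.
move=> E.
have ye : y 0 h ^+ k.+1 != 0 by rewrite expf_neq0.
have -> : L / k.+1%:R - taylor_num k g y / y 0 h ^+ k.+1 =
   - (y 0 h * (u ^+ k * (iter k.+1 (pd h) g (u *: e_ h + y0) - L))) / y 0 h ^+ k.+1.
  by rewrite -E; field; rewrite ye /= nat1r.
rewrite normrM normfV normrN ler_pdivrMr ?normr_gt0 //.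
rewrite mulrA normrM [leRHS]mulrC distrC ler_pM // normrM [leRHS]normrX exprS normrX.
by rewrite ler_wpM2l // lerXn2r ?nnegrE.
Qed.

Lemma continuous_quot_deriv k g x : smooth U g ->
  (forall y, U y -> y 0 h = 0 -> g y = 0) -> U x -> {for x, continuous (quot_deriv k g)}.
Proof.
move=> sg g0 Ux; have [xh|xh] := eqVneq (x 0 h) 0.
  apply/continuous_distP => e e0.
  have /continuous_distP/(_ _ e0) cG :=
    smooth_continuous (smooth_iter_pd k.+1 sg) Ux.
  have [d d0 hd] := nbhs_dist (filterI (open_nbhs_nbhs (conj oU Ux)) cG).
  apply: (dist_nbhs d0); exact: (quot_deriv_bound sg g0 xh hd).
apply: (@near_eq_continuous _ _ (fun y => taylor_num k g y / y 0 h ^+ k.+1)).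
  have hx : 0 < `|x 0 h| by rewrite normr_gt0.
  apply: (dist_nbhs hx); move=> y xy; rewrite /quot_deriv; case: eqVneq => // yh.
  have := le_lt_trans (rV_coord_le (x - y) h) xy.
  by rewrite !mxE yh subr0 ltxx.
apply: continuousM; first exact: continuous_taylor_num.
apply: continuousV; first by rewrite expf_neq0.
exact: continuous_coordinateX.
Qed.

End HadamardQuotient.

Section HadamardSmooth.
Variables (R : realType) (n : nat) (h : 'I_n) (U : set 'rV[R]_n).
Hypothesis oU : open U.
Local Notation e_ := (ev R).
Implicit Types (f g : 'rV[R]_n -> R) (x y z : 'rV[R]_n).
Local Notation vanishes g := (forall y, U y -> y 0 h = 0 -> g y = 0).

Lemma near_coord_neq0 x (j : 'I_n) : x 0 j != 0 -> nbhs x (fun y => y 0 j != 0).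
Proof.
move=> xj; have hx : 0 < `|x 0 j| by rewrite normr_gt0.
apply: (dist_nbhs hx) => y xy; apply/eqP => yj.
have := le_lt_trans (rV_coord_le (x - y) j) xy.
by rewrite !mxE yj subr0 ltxx.
Qed.

Lemma is_derive_inv f x (v : 'rV[R]_n) (df : R) : f x != 0 -> is_derive x v f df ->
  is_derive x v (fun y => (f y)^-1) (- (f x) ^- 2 * df).
Proof.
move=> fx [d <-]; split; first exact: derivableV.
exact: deriveV.
Qed.

(** Away from the hyperplane this is the quotient rule; the recursion of [taylor_num] is that rule
    cleared of denominators. *)
Lemma is_derive_quot_deriv_neq0 k g x : smooth U g -> U x -> x 0 h != 0 ->
  is_derive x (e_ h) (quot_deriv h k g) (quot_deriv h k.+1 g x).
Proof.
move=> sg Ux xh.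
have xk m : x 0 h ^+ m != 0 by rewrite expf_neq0.
have dM := is_deriveM (is_derive_taylor_num h k sg Ux)
  (@is_derive_inv (fun y => y 0 h ^+ k.+1) _ _ _ (xk k.+1) (is_derive_coordinateX h x k.+1)).
apply: (@near_eq_is_derive _ _ _ (taylor_num h k g * (fun y => (y 0 h ^+ k.+1)^-1))).
  apply: filterS (near_coord_neq0 xh) => y yh.
  by rewrite /quot_deriv (negbTE yh).
apply: (is_derive_eq dM); rewrite /quot_deriv (negbTE xh) /GRing.scale /=.
by rewrite !exprS; field; rewrite xh xk.
Qed.

Lemma is_derive_quot_deriv_eq0 k g x : smooth U g -> vanishes g -> U x -> x 0 h = 0 ->
  is_derive x (e_ h) (quot_deriv h k g) (quot_deriv h k.+1 g x).
Proof.
move=> sg g0 Ux xh.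
have x0 : 0 *: e_ h + x = x by rewrite scale0r add0r.
have near_U : nbhs (0 : R) (fun u : R => U (u *: e_ h + x)).
  by apply: near_line; rewrite x0; apply: open_nbhs_nbhs.
have hd : is_derive (0 : R) 1 (fun u : R => quot_deriv h k g (u *: e_ h + x))
    (quot_deriv h k.+1 g (0 *: e_ h + x)).
  apply: (@is_derive_extend _ (fun u : R => quot_deriv h k g (u *: e_ h + x))
     (fun u : R => quot_deriv h k.+1 g (u *: e_ h + x))).
  - apply: filterS near_U => u Uu.
    exact: (continuous_line (continuous_quot_deriv oU sg g0 Uu)).
  - apply: filterS near_U => u Uu u0; apply: is_derive_to_line.
    apply: is_derive_quot_deriv_neq0 => //.
    by rewrite !mxE !eqxx xh mulr1 addr0.
  - apply: (@continuous_line _ _ _ (quot_deriv h k.+1 g)); rewrite x0.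
    exact: (continuous_quot_deriv oU sg g0 Ux).
by have := is_derive_of_line hd; rewrite !x0.
Qed.

Lemma is_derive_quot_deriv k g x : smooth U g -> vanishes g -> U x ->
  is_derive x (e_ h) (quot_deriv h k g) (quot_deriv h k.+1 g x).
Proof.
move=> sg g0 Ux; have [xh|xh] := eqVneq (x 0 h) 0.
  exact: is_derive_quot_deriv_eq0.
exact: is_derive_quot_deriv_neq0.
Qed.

(** Symmetry of second derivatives enters here: it turns a derivative of [quot_deriv] in another
    direction into [quot_deriv] of a derivative of g. *)
Lemma pd_iterC k g x i : smooth U g -> U x ->
  pd i (iter k (pd h) g) x = iter k (pd h) (pd i g) x.
Proof.
move=> sg; elim: k x => //= k IH x Ux.
rewrite (pdC _ _ oU (smooth_iter_pd h k sg) Ux).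
exact: (eq_pd _ oU IH).
Qed.

Lemma is_derive_coordinateX_neq i x k : h != i ->
  is_derive x (e_ i) (fun y => y 0 h ^+ k) 0.
Proof.
move=> hi; have dx := is_derive_coordinate x i h; rewrite (negbTE hi) in dx.
have := is_deriveX k dx; rewrite exprfctE => dX; apply: (is_derive_eq dX).
by rewrite [LHS]mulr0.
Qed.

Lemma is_derive_taylor_num_neq i k g x : h != i -> smooth U g -> U x ->
  is_derive x (e_ i) (taylor_num h k g) (taylor_num h k (pd i g) x).
Proof.
move=> hi sg Ux; elim: k => [|k IH]; first exact: smooth_is_derive Ux.
have dg := smooth_is_derive i (smooth_iter_pd h k.+1 sg) Ux.
rewrite (pd_iterC _ _ sg Ux) in dg.
have dM := is_deriveB (is_deriveM (is_derive_coordinateX_neq x k.+1 hi) dg)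
  (is_deriveZ k.+1%:R IH).
by apply: (is_derive_eq dM); rewrite /GRing.scale /= /GRing.scale /= mulr0 addr0.
Qed.

Lemma is_derive_quot_deriv_neq i k g x : h != i -> smooth U g -> U x ->
  is_derive x (e_ i) (quot_deriv h k g) (quot_deriv h k (pd i g) x).
Proof.
move=> hi sg Ux; have [xh|xh] := eqVneq (x 0 h) 0; last first.
  have xk m : x 0 h ^+ m != 0 by rewrite expf_neq0.
  have dM := is_deriveM (is_derive_taylor_num_neq k hi sg Ux)
    (@is_derive_inv (fun y => y 0 h ^+ k.+1) _ _ _ (xk k.+1) (is_derive_coordinateX_neq x k.+1 hi)).
  apply: (@near_eq_is_derive _ _ _ (taylor_num h k g * (fun y => (y 0 h ^+ k.+1)^-1))).
    apply: filterS (near_coord_neq0 xh) => y yh.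
    by rewrite /quot_deriv (negbTE yh).
  apply: (is_derive_eq dM); rewrite /quot_deriv (negbTE xh) /GRing.scale /=.
  by rewrite !mulr0 add0r mulrC.
(* At x_h = 0 the line in direction [e_i] stays inside the hyperplane, so only the first branch of
   [quot_deriv] is met on it. *)
have x0 : 0 *: e_ i + x = x by rewrite scale0r add0r.
have dg := smooth_is_derive i (smooth_iter_pd h k.+1 sg) Ux.
rewrite (pd_iterC _ _ sg Ux) -{1}x0 in dg.
have := is_deriveZ k.+1%:R^-1 (is_derive_to_line dg) => dZ.
rewrite -{1}x0; apply: is_derive_of_line.
rewrite /quot_deriv xh eqxx.
have xE u : (u *: e_ i + x) 0 h = 0 by rewrite !mxE eqxx xh (negbTE hi) mulr0 addr0.
under eq_fun do rewrite xE eqxx.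
rewrite (_ : (fun u => _) = k.+1%:R^-1 \*: (fun u : R => iter k.+1 (pd h) g (u *: e_ i + x))).
  by apply: (is_derive_eq dZ); rewrite [LHS]mulrC.
by apply/funext => u /=; rewrite mulrC.
Qed.

(** The family of all [quot_deriv k g] is closed under differentiation: direction h raises k, and
    another direction replaces g by [pd i g], which still vanishes on the hyperplane. Hence the
    induction on the order is for all k and g together. *)
Lemma smooth_quot_deriv k g : smooth U g -> vanishes g -> smooth U (quot_deriv h k g).
Proof.
move=> sg g0; apply/smoothP => m.
elim: m k g sg g0 => [|m IH] k g sg g0 /=; split=> //.
1,2: by move=> x Ux; exact: (continuous_quot_deriv oU sg g0 Ux).
move=> i; split.
  move=> x Ux; have [<-|hi] := eqVneq h i.
    by have [] := is_derive_quot_deriv k sg g0 Ux.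
  by have [] := is_derive_quot_deriv_neq k hi sg Ux.
have [<-|hi] := eqVneq h i.
  apply: (eq_Ck oU _ (IH k.+1 g sg g0)) => x Ux.
  by have [_ <-] := is_derive_quot_deriv k sg g0 Ux.
have pg0 : vanishes (pd i g).
  move=> y Uy yh; have y0 : 0 *: e_ i + y = y by rewrite scale0r add0r.
  have dg : is_derive (0 : R) 1 (fun u : R => g (u *: e_ i + y)) 0.
    apply: (@near_eq_is_derive _ _ _ (cst 0)).
    have : nbhs (0 : R) (fun u : R => U (u *: e_ i + y)).
      by apply: near_line; rewrite y0; apply: open_nbhs_nbhs.
    apply: filterS => u Uu; apply/esym/g0 => //.
    by rewrite !mxE eqxx yh (negbTE hi) mulr0 addr0.
  by have [_] := is_derive_of_line dg; rewrite y0.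
apply: (eq_Ck oU _ (IH k (pd i g) (smooth_pd i sg) pg0)) => x Ux.
by have [_ <-] := is_derive_quot_deriv_neq k hi sg Ux.
Qed.

Lemma smooth_quotient g : smooth U g -> vanishes g ->
  smooth U (fun x => if x 0 h == 0 then pd h g x else g x / x 0 h).
Proof.
move=> sg g0; apply: (eq_smooth oU _ (smooth_quot_deriv 0 sg g0)) => x Ux.
by rewrite /quot_deriv /= divr1 expr1.
Qed.

End HadamardSmooth.

(** * Power series in several variables *)

Section PowerSeries.
Variables (R : realType) (n m : nat).
Implicit Types (x y : 'rV[R]_n) (a : {ffun 'I_n -> nat}) (c : {ffun 'I_n -> nat} -> 'rV[R]_m).
Implicit Types (g : 'rV[R]_n -> 'rV[R]_m) (U : set 'rV[R]_n).

Definition weight a := (\sum_i a i)%N.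
Definition shift_index (h : 'I_n) a : {ffun 'I_n -> nat} := [ffun j => (a j + (j == h))%N].
(* Cauchy estimates: up to shrinking the radius they are equivalent to the bound on
   [psum_abs] and, unlike it, they are stable under shifts of the multi-index *)
Definition coef_bound c (r M : R) := forall a, `|c a| * r ^+ weight a <= M.

Lemma weight_shift h a : weight (shift_index h a) = (weight a).+1.
Proof.
rewrite /weight; under eq_bigr do rewrite ffunE.
rewrite big_split /= -addn1; congr (_ + _)%N.
by rewrite (bigD1 h) //= eqxx big1 ?addn0 // => j /negbTE ->.
Qed.

Lemma leq_weight a i : (a i <= weight a)%N.
Proof. by rewrite /weight (bigD1 i) //= leq_addr. Qed.

Lemma monom_shift x y h a : monom x y (shift_index h a) = (y 0 h - x 0 h) * monom x y a.
Proof.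
rewrite /monom; under eq_bigr do rewrite ffunE exprD.
rewrite big_split /= mulrC; congr (_ * _).
by rewrite (bigD1 h) //= eqxx expr1 big1 ?mulr1 // => j /negbTE ->; rewrite expr0.
Qed.

Lemma monom_le x y a (d : R) : `|y - x| <= d -> `|monom x y a| <= d ^+ weight a.
Proof.
move=> xy; have d0 : 0 <= d by apply: le_trans xy.
rewrite normr_prod -prodrXr; apply: ler_prod => i _; rewrite normr_ge0 /= normrX.
rewrite lerXn2r ?nnegrE //; apply: le_trans xy.
by have := rV_coord_le (y - x) i; rewrite !mxE.
Qed.

Lemma coef_boundW c (r r' M : R) : 0 <= r' -> r' <= r -> coef_bound c r M -> coef_bound c r' M.
Proof.
move=> r0 rr cb a; apply: le_trans (cb a); rewrite ler_wpM2l // lerXn2r ?nnegrE //.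
exact: le_trans rr.
Qed.

Lemma coef_bound_ge0 c (r M : R) : 0 <= r -> coef_bound c r M -> 0 <= M.
Proof. by move=> r0 /(_ [ffun=> 0%N]); apply: le_trans; rewrite mulr_ge0 // exprn_ge0. Qed.

(** Distributing the product over the sums gives n geometric sums, each below 2, whatever k is. *)
Lemma sum_half_weight k :
  \sum_(a : {ffun 'I_n -> 'I_k.+1}) (2^-1 : R) ^+ weight (ffnat a) <= 2 ^+ n.
Proof.
have -> : \sum_(a : {ffun 'I_n -> 'I_k.+1}) (2^-1 : R) ^+ weight (ffnat a) =
   \prod_(i < n) \sum_(j < k.+1) 2^-1 ^+ j.
  rewrite bigA_distr_bigA /=; apply: eq_bigr => a _.
  by rewrite -prodrXr; apply: eq_bigr => i _; rewrite ffunE.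
have -> : 2 ^+ n = \prod_(i < n) (2 : R) by rewrite big_const card_ord iter_mulr_1.
apply: ler_prod => i _; apply/andP; split.
  by apply: sumr_ge0 => j _; rewrite exprn_ge0 // invr_ge0.
suff -> : \sum_(j < k.+1) (2^-1 : R) ^+ j = 2 - 2^-1 ^+ k.
  by rewrite gerBl exprn_ge0 // invr_ge0.
elim: k => [|k IH]; first by rewrite big_ord1 !expr0; lra.
by rewrite big_ord_recr /= IH exprS; lra.
Qed.

Lemma norm_box_sum_le k (P : pred {ffun 'I_n -> 'I_k.+1}) (f : {ffun 'I_n -> nat} -> 'rV[R]_m) (C : R) :
  0 <= C -> (forall a : {ffun 'I_n -> 'I_k.+1}, P a -> `|f (ffnat a)| <= C * 2^-1 ^+ weight (ffnat a)) ->
  `|\sum_(a : {ffun 'I_n -> 'I_k.+1} | P a) f (ffnat a)| <= C * 2 ^+ n.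
Proof.
move=> C0 fC; apply: (le_trans (ler_norm_sum _ _ _)).
apply: (@le_trans _ _ (\sum_(a : {ffun 'I_n -> 'I_k.+1}) C * 2^-1 ^+ weight (ffnat a))).
  rewrite big_mkcond /=; apply: ler_sum => a _; case: ifP => [/fC //|_].
  by rewrite mulr_ge0 // exprn_ge0 // invr_ge0.
by rewrite -mulr_sumr ler_wpM2l // sum_half_weight.
Qed.

(** Partial sums run over the box of exponents at most k, which the shift does not preserve: the
    indices with [b h = k] have no image. They form the boundary sums that are shown to tend to
    0. *)
Lemma reindex_shift k h (f : {ffun 'I_n -> nat} -> 'rV[R]_m) :
  \sum_(a : {ffun 'I_n -> 'I_k.+1} | (0 < a h)%N) f (ffnat a) =
  \sum_(b : {ffun 'I_n -> 'I_k.+1} | (b h < k)%N) f (shift_index h (ffnat b)).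
Proof.
pose up (b : {ffun 'I_n -> 'I_k.+1}) : {ffun 'I_n -> 'I_k.+1} :=
  [ffun j => if j == h then inord (b j).+1 else b j].
pose dn (b : {ffun 'I_n -> 'I_k.+1}) : {ffun 'I_n -> 'I_k.+1} :=
  [ffun j => if j == h then inord (b j).-1 else b j].
rewrite (reindex_onto up dn) /=; last first.
  move=> a a0; apply/ffunP => j; rewrite !ffunE; case: eqVneq => // ->.
  have E : (inord (a h).-1 : 'I_k.+1) = (a h).-1 :> nat.
    by rewrite inordK // (leq_ltn_trans (leq_pred _)).
  by rewrite E prednK // inord_val.
apply: eq_big => [b|b].
  rewrite ffunE eqxx; apply/andP/idP => [[b0 /eqP/ffunP/(_ h)]|bk].
    rewrite !ffunE eqxx => E; rewrite ltn_neqAle -ltnS ltn_ord andbT.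
    (* If [b h = k], then [inord k.+1] is out of range and falls back to 0, against [b0]. *)
    apply: contraTneq b0 => bk; rewrite bk -leqNgt.
    by rewrite /inord /insubd insubN //= ltnn.
  have E : (inord (b h).+1 : 'I_k.+1) = (b h).+1 :> nat by rewrite inordK.
  rewrite E; split=> //; apply/eqP/ffunP => j; rewrite !ffunE.
  by case: eqVneq => // ->; rewrite E inord_val.
move=> /andP[b0 E]; congr f; apply/ffunP => j; rewrite !ffunE.
case: eqVneq => [->|]; last by rewrite addn0.
have bk : (b h < k)%N.
  rewrite ltn_neqAle -ltnS ltn_ord andbT; apply: contraTneq b0 => bk.
  by rewrite ffunE eqxx bk -leqNgt /inord /insubd insubN //= ltnn.
by rewrite [LHS]inordK // addn1.
Qed.

(** At distance r / 4 a term of weight w is at most M 4^-w = M 2^-w 2^-w. One factor is at most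
    2^-k, since [a h >= k] forces w >= k; the other one is summed over the box. *)
Lemma box_sum_boundary c x y (r M : R) k h : 0 < r -> coef_bound c r M -> `|y - x| <= r / 4 ->
  `|\sum_(a : {ffun 'I_n -> 'I_k.+1} | ~~ (a h < k)%N) monom x y (ffnat a) *: c (ffnat a)|
    <= M * 2 ^+ n * 2^-1 ^+ k.
Proof.
move=> r0 cb xy; have M0 := coef_bound_ge0 (ltW r0) cb.
rewrite mulrAC; apply: (@norm_box_sum_le k _ (fun a => monom x y a *: c a)).
  by rewrite mulr_ge0 // exprn_ge0 // invr_ge0.
move=> a; rewrite -leqNgt => ka; set w := weight _.
have kw : (k <= w)%N.
  by apply: leq_trans ka _; have := leq_weight (ffnat a) h; rewrite ffunE.
rewrite normrZ; apply: le_trans (ler_wpM2r (normr_ge0 _) (monom_le _ xy)) _.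
rewrite expr_div_n mulrAC.
have -> : (4 ^+ w)^-1 = 2^-1 ^+ w * 2^-1 ^+ w :> R.
  by rewrite -exprMn -exprVn; congr (_ ^+ _); field.
have h1 : `|c (ffnat a)| * r ^+ w <= M by apply: cb.
have h2 : (2^-1 : R) ^+ w <= 2^-1 ^+ k.
  by rewrite ler_wiXn2l // ?invr_ge0 // invf_le1 // ler1n.
rewrite [r ^+ w * _]mulrC mulrA ler_wpM2r ?exprn_ge0 ?invr_ge0 //.
by rewrite ler_pM // ?mulr_ge0 // exprn_ge0 // ?invr_ge0 // ltW.
Qed.

Lemma cvg_half_pow (C : R) : C * 2^-1 ^+ k @[k --> \oo] --> 0.
Proof.
rewrite -[0](mulr0 C); apply: cvgMr; apply: cvg_expr.
by rewrite ger0_norm ?invr_ge0 // invf_lt1 // ltr1n.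
Qed.

Lemma cvg_boundary c x y (r M : R) h : 0 < r -> coef_bound c r M -> `|y - x| <= r / 4 ->
  (\sum_(a : {ffun 'I_n -> 'I_k.+1} | ~~ (a h < k)%N) monom x y (ffnat a) *: c (ffnat a))
    @[k --> \oo] --> (0 : 'rV[R]_m).
Proof.
move=> r0 cb xy; apply/norm_cvg0P.
apply: (@squeeze_cvgr _ _ _ _ (cst 0) (fun k => M * 2 ^+ n * 2^-1 ^+ k)).
- by apply: nearW => k; rewrite normr_ge0 /=; apply: box_sum_boundary r0 cb xy.
- exact: cvg_cst.
- exact: cvg_half_pow.
Qed.

Definition expands x (r : R) c g := forall y, `|y - x| < r -> psum c x y k @[k --> \oo] --> g y.

Definition pseries_at x g := exists r, 0 < r /\ exists M c, coef_bound c r M /\ expands x r c g.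

Lemma analytic_pseries U g : analytic_on U g -> forall x, U x -> pseries_at x g.
Proof.
move=> ag x Ux; have [r r0 [c hc]] := ag x Ux.
have r2 : 0 <= r / 2 by rewrite divr_ge0 // ltW.
(* At this corner every monomial equals (r / 2)^weight, so each single term of the bounded absolute
   sum is a Cauchy estimate. *)
have yr : `|x + const_mx (r / 2) - x| < r.
  apply: (@le_lt_trans _ _ (r / 2)); last by rewrite ltr_pdivrMr // ltr_pMr // ltr1n.
  by apply: rV_norm_le => // j; rewrite !mxE addrC addKr ger0_norm.
have [[M hM] _] := hc _ yr.
exists (r / 2); split; first by rewrite divr_gt0.
exists M, c; split; last first.
  move=> y xy; apply: (hc y _).2; apply: lt_trans xy _.
  by rewrite ltr_pdivrMr // ltr_pMr // ltr1n.
(* The box of size [weight a] is large enough to contain [a]. *)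
move=> a; pose k := weight a; apply: le_trans (hM k).
have ak i : (a i < k.+1)%N by rewrite ltnS leq_weight.
pose b : {ffun 'I_n -> 'I_k.+1} := [ffun i => Ordinal (ak i)].
have ab : ffnat b = a by apply/ffunP => i; rewrite !ffunE.
rewrite /psum_abs (bigD1 b) //= ab; apply: ler_wpDr.
  by apply: sumr_ge0 => ? _; rewrite mulr_ge0.
rewrite mulrC ler_wpM2r // /monom -prodrXr normr_prod.
rewrite le_eqVlt; apply/orP; left; apply/eqP; apply: eq_bigr => i _.
by rewrite !mxE (addrC (x 0 i)) addrK normrX ger0_norm.
Qed.

Lemma pseries_analytic U g : (forall x, U x -> pseries_at x g) -> analytic_on U g.
Proof.
move=> pg x Ux; have [r [r0 [M [c [cb ex]]]]] := pg x Ux.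
exists (r / 2); first by rewrite divr_gt0.
exists c => y xy; split; last first.
  by apply: ex; apply: lt_trans xy _; rewrite ltr_pdivrMr // ltr_pMr // ltr1n.
exists (M * 2 ^+ n) => k; have M0 := coef_bound_ge0 (ltW r0) cb.
apply: (@le_trans _ _ (\sum_(a : {ffun 'I_n -> 'I_k.+1}) M * 2^-1 ^+ weight (ffnat a))).
  apply: ler_sum => a _.
  apply: le_trans (ler_wpM2r (normr_ge0 _) (monom_le _ (ltW xy))) _.
  rewrite expr_div_n -exprVn mulrAC ler_wpM2r ?exprn_ge0 ?invr_ge0 //.
  by rewrite mulrC; apply: cb.
by rewrite -mulr_sumr ler_wpM2l // sum_half_weight.
Qed.

Lemma pseries_continuous x g : pseries_at x g -> {for x, continuous g}.
Proof.
move=> [r [r0 [M [c [cb ex]]]]]; have M0 := coef_bound_ge0 (ltW r0) cb.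
(* A Lipschitz constant at x valid for all partial sums: for w > 0 a monomial of weight w is at most
   |y - x| (r / 4)^(w - 1), so its term is at most (4 M |y - x| / r) 4^-w, and the sum of 2^-w is at
   most 2^n. *)
pose C := 4 * M * 2 ^+ n / r.
have C0 : 0 <= C by rewrite divr_ge0 ?mulr_ge0 ?exprn_ge0 // ltW.
have est y : `|y - x| <= r / 4 -> `|g y - g x| <= C * `|y - x|.
  move=> xy.
  have r4 : r / 4 < r by rewrite ltr_pdivrMr // ltr_pMr // ltr1n.
  have gy := ex y (le_lt_trans xy r4).
  have gx : psum c x x k @[k --> \oo] --> g x by apply: ex; rewrite subrr normr0.
  have lim : `|psum c x y k - psum c x x k| @[k --> \oo] --> `|g y - g x|.
    by apply: cvg_norm; apply: cvgB.
  apply: (cvgr_to_le lim).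
  apply: nearW => k /=.
  have -> : C * `|y - x| = (4 * M * `|y - x| / r) * 2 ^+ n by rewrite /C; ring.
  rewrite /psum -sumrB.
  pose f a := monom x y a *: c a - monom x x a *: c a.
  apply: (@norm_box_sum_le k predT f).
    by rewrite divr_ge0 ?mulr_ge0 // ltW.
  move=> a _; rewrite /f -scalerBl normrZ; set b := ffnat a.
  have [w0|w0] := posnP (weight b).
    have b0 i : b i = 0%N by apply/eqP; rewrite -leqn0 -w0 leq_weight.
    rewrite /monom !big1 ?subrr ?normr0 ?mul0r; last first.
    - by move=> i _; rewrite b0 expr0.
    - by move=> i _; rewrite b0 expr0.
    by rewrite mulr_ge0 ?exprn_ge0 ?invr_ge0 // divr_ge0 ?mulr_ge0 // ltW.
  have -> : monom x x b = 0.
    apply/eqP; rewrite -normr_le0; have := @monom_le x x b 0.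
    by rewrite subrr normr0 lexx expr0n eqn0Ngt w0; apply.
  rewrite subr0; apply: le_trans (ler_wpM2r (normr_ge0 _) (monom_le _ (lexx _))) _.
  have h1 : `|y - x| ^+ weight b <= `|y - x| * (r / 4) ^+ (weight b).-1.
    by rewrite -{1}(prednK w0) exprS ler_wpM2l // lerXn2r ?nnegrE // divr_ge0 // ltW.
  apply: le_trans (ler_wpM2r (normr_ge0 _) h1) _.
  have -> : (r / 4) ^+ (weight b).-1 = (r / 4) ^+ weight b * (4 / r).
    by rewrite -{2}(prednK w0) exprS; field; rewrite gt_eqF.
  have h2 : `|c b| * r ^+ weight b <= M by apply: cb.
  have h3 : (4^-1 : R) ^+ weight b <= 2^-1 ^+ weight b.
    by rewrite lerXn2r ?nnegrE ?invr_ge0 // lef_pV2 ?posrE // ler_nat.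
  have -> : `|y - x| * ((r / 4) ^+ weight b * (4 / r)) * `|c b| =
     (`|c b| * r ^+ weight b) * 4^-1 ^+ weight b * (4 * `|y - x| / r).
    by rewrite exprMn; ring.
  have -> : 4 * M * `|y - x| / r * 2^-1 ^+ weight b =
     M * 2^-1 ^+ weight b * (4 * `|y - x| / r) by ring.
  apply: ler_wpM2r; first by rewrite divr_ge0 ?mulr_ge0 // ltW.
  by apply: ler_pM => //; rewrite ?mulr_ge0 ?exprn_ge0 ?invr_ge0 // ltW.
apply/continuous_distP => e e0.
have d0 : 0 < Num.min (r / 4) (e / (C + 1)).
  by rewrite lt_min !divr_gt0 // ltr_wpDl.
apply: (dist_nbhs d0) => y; rewrite lt_min => /andP[/ltW xy1 /ltW xy2].
rewrite distrC in xy1 xy2; rewrite distrC; apply: le_trans (est _ xy1) _.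
apply: le_trans (ler_wpM2l C0 xy2) _.
rewrite mulrA ler_pdivrMr ?ltr_wpDl // mulrC ler_wpM2l ?(ltW e0) //.
by rewrite lerDl.
Qed.

End PowerSeries.

Lemma normZ_rV {R : realType} m (k : R) (v : 'rV[R]_m) : `|k *: v| = `|k| * `|v|.
Proof. exact: normrZ. Qed.

(** The factor d^2 stands on the left because d^(k-2) would be meaningless for k < 2. With E_k the
    remainder, E_(k+1) = (s + u) E_k + s^2 k u^(k-1), and the induction closes by k^2 + k <= (k +
    1)^2. *)
Lemma exp_taylor2 {R : realType} (u s d : R) k : `|u| + `|s| <= d ->
  `|(s + u) ^+ k - u ^+ k - s * (k%:R * u ^+ k.-1)| * d ^+ 2 <= s ^+ 2 * k%:R ^+ 2 * d ^+ k.
Proof.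
move=> usd; have d0 : 0 <= d by apply: le_trans usd; rewrite addr_ge0.
have ud : `|u| <= d by apply: le_trans usd; rewrite lerDl.
have sud : `|s + u| <= d by apply: le_trans (ler_normD _ _) _; rewrite addrC.
elim: k => [|k IH].
  by rewrite !expr0 mul0r mulr0 subrr subr0 normr0 mul0r expr0n !mulr0 mul0r.
set E := (s + u) ^+ k - _ - _ in IH.
have -> : (s + u) ^+ k.+1 - u ^+ k.+1 - s * (k.+1%:R * u ^+ k.+1.-1) =
    (s + u) * E + s ^+ 2 * (k%:R * u ^+ k.-1).
  have ku : k%:R * u ^+ k = k%:R * u ^+ k.-1 * u.
    by case: (k) => [|j]; rewrite ?mul0r //= exprSr mulrA.
  rewrite /E -natr1 /= mulrDl mul1r ku !exprS; ring.
have b1 : `|(s + u) * E| * d ^+ 2 <= s ^+ 2 * k%:R ^+ 2 * d ^+ k.+1.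
  have h1 := ler_wpM2r (mulr_ge0 (normr_ge0 E) (sqr_ge0 d)) sud.
  rewrite normrM -[leLHS]mulrA; apply: (le_trans h1).
  by rewrite (exprS d k) [leRHS]mulrCA ler_wpM2l.
have b2 : `|s ^+ 2 * (k%:R * u ^+ k.-1)| * d ^+ 2 <= s ^+ 2 * k%:R * d ^+ k.+1.
  case: (k) => [|j]; first by rewrite (_ : 0%:R = 0) // !(mul0r, mulr0, normr0).
  rewrite /= normrM (ger0_norm (sqr_ge0 s)) normrM normr_nat normrX.
  rewrite (mulrA (s ^+ 2)) -[leLHS]mulrA ler_wpM2l ?(mulr_ge0 (sqr_ge0 s) (ler0n _ _)) //.
  have -> : d ^+ j.+2 = d ^+ j * d ^+ 2 by rewrite -exprD addn2.
  by rewrite ler_wpM2r ?sqr_ge0 // lerXn2r ?nnegrE.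
apply: le_trans (ler_wpM2r (sqr_ge0 d) (ler_normD _ _)) _.
rewrite mulrDl; apply: le_trans (lerD b1 b2) _.
rewrite -mulrDl -mulrDr; apply: ler_wpM2r; first by rewrite exprn_ge0.
apply: ler_wpM2l; first exact: sqr_ge0.
by rewrite -natr1; have := ler0n R k; nra.
Qed.

(** For a limit not known in advance: a sequence uniformly close to convergent ones is Cauchy. *)
Lemma cvg_approx {R : realType} m (u : nat -> 'rV[R]_m) :
  (forall e : R, 0 < e -> exists (v : nat -> 'rV[R]_m) (l : 'rV[R]_m),
     (v k @[k --> \oo] --> l) /\ forall k, `|u k - v k| <= e) ->
  exists l : 'rV[R]_m, u k @[k --> \oo] --> l.
Proof.
move=> H; apply/cvg_ex; apply: cauchy_cvg; apply: cauchy_exP => e e0.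
have e2 : 0 < e / 3 by rewrite divr_gt0.
have [v [l [/cvgrPdist_le/(_ _ e2) vl uv]]] := H _ e2.
exists l; apply: filterS vl => k lk /=; rewrite -ball_normE /=.
rewrite -(subrK (v k) l) -addrA; apply: (le_lt_trans (ler_normD _ _)).
apply: (@le_lt_trans _ _ (e / 3 + e / 3)).
  by apply: lerD => //; rewrite distrC.
by rewrite -mulrDl ltr_pdivrMr // ; lra.
Qed.

(** * Termwise differentiation of power series *)

Section PowerSeriesDerivative.
Variables (R : realType) (n m : nat) (h : 'I_n).
Local Notation e_ := (ev R).
Implicit Types (x y : 'rV[R]_n) (a : {ffun 'I_n -> nat}) (c : {ffun 'I_n -> nat} -> 'rV[R]_m).
Implicit Types (g : 'rV[R]_n -> 'rV[R]_m) (U : set 'rV[R]_n).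

Definition monom_rest x y a := \prod_(j < n | j != h) (y 0 j - x 0 j) ^+ a j.

Lemma monom_split x y a : monom x y a = monom_rest x y a * (y 0 h - x 0 h) ^+ a h.
Proof. by rewrite /monom (bigD1 h) //= mulrC. Qed.

Lemma monom_line x y s a :
  monom x (s *: e_ h + y) a = monom_rest x y a * (s + (y 0 h - x 0 h)) ^+ a h.
Proof.
rewrite monom_split; congr (_ * _); last by rewrite !mxE !eqxx mulr1 addrA.
by apply: eq_bigr => j jh; rewrite !mxE eqxx (negbTE jh) mulr0 add0r.
Qed.

Lemma monom_rest_shift x y a : monom_rest x y (shift_index h a) = monom_rest x y a.
Proof. by apply: eq_bigr => j jh; rewrite ffunE (negbTE jh) addn0. Qed.

Lemma monom_rest_le x y a (d : R) : `|y - x| <= d ->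
  `|monom_rest x y a| * d ^+ a h <= d ^+ weight a.
Proof.
move=> xy; have d0 : 0 <= d by apply: le_trans xy.
rewrite /weight (bigD1 h) //= exprD mulrC ler_wpM2l ?exprn_ge0 //.
rewrite normr_prod -prodrXr; apply: ler_prod => i _; rewrite normr_ge0 /= normrX.
rewrite lerXn2r ?nnegrE //; apply: le_trans xy.
by have := rV_coord_le (y - x) i; rewrite !mxE.
Qed.

Definition deriv_coef c a := (a h).+1%:R *: c (shift_index h a).

(** Halving the radius absorbs the new factor, because a_h + 1 <= 2^(weight a). *)
Lemma deriv_coef_bound c (r M : R) : 0 < r -> coef_bound c r M ->
  coef_bound (deriv_coef c) (r / 2) (M / r).
Proof.
move=> r0 cb a; rewrite /deriv_coef normZ_rV normr_nat ler_pdivlMr //.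
apply: le_trans (cb (shift_index h a)); rewrite weight_shift exprSr mulrA.
apply: ler_wpM2r; first exact: ltW.
have w0 : 0 < 2 ^+ weight a :> R by rewrite exprn_gt0.
have -> : (a h).+1%:R * `|c (shift_index h a)| * (r / 2) ^+ weight a =
    `|c (shift_index h a)| * (r ^+ weight a * ((a h).+1%:R / 2 ^+ weight a)).
  by rewrite expr_div_n; field; rewrite gt_eqF.
apply: ler_wpM2l => //; apply: ler_piMr; first by rewrite exprn_ge0 // ltW.
rewrite ler_pdivrMr // mul1r -natrX ler_nat.
by apply: (leq_trans (ltn_expl (a h) (ltnSn 1))); rewrite leq_exp2l // leq_weight.
Qed.

Definition deriv_sum c x y k :=
  \sum_(a : {ffun 'I_n -> 'I_k.+1})
    (monom_rest x y (ffnat a) * ((a h)%:R * (y 0 h - x 0 h) ^+ (a h).-1)) *: c (ffnat a).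

(** [deriv_sum] is the derivative of a partial sum. Lowering the exponent of y_h by one identifies
    it with the partial sum of the derived series, except for the terms with exponent k. *)
Lemma deriv_sumE c x y k : deriv_sum c x y k = psum (deriv_coef c) x y k -
  \sum_(a : {ffun 'I_n -> 'I_k.+1} | ~~ (a h < k)%N)
     monom x y (ffnat a) *: deriv_coef c (ffnat a).
Proof.
rewrite /psum (bigID (fun a : {ffun 'I_n -> 'I_k.+1} => (a h < k)%N)) /= addrK.
rewrite /deriv_sum (bigID (fun a : {ffun 'I_n -> 'I_k.+1} => (0 < a h)%N)) /=.
rewrite [X in _ + X]big1 ?addr0; last first.
  by move=> a; rewrite -eqn0Ngt => /eqP ->; rewrite mul0r mulr0 scale0r.
pose f a := (monom_rest x y a * ((a h)%:R * (y 0 h - x 0 h) ^+ (a h).-1)) *: c a.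
transitivity (\sum_(a : {ffun 'I_n -> 'I_k.+1} | (0 < a h)%N) f (ffnat a)).
  by apply: eq_bigr => a _; rewrite /f ffunE.
rewrite reindex_shift; apply: eq_bigr => b _; rewrite /f monom_rest_shift ffunE eqxx addn1 /=.
by rewrite /deriv_coef scalerA monom_split mulrA -[in LHS]mulrA [_%:R * _]mulrC mulrA.
Qed.

(** Origin of r / 8: the factor (a_h)^2 of [exp_taylor2] costs at most 4^w on a term of weight w,
    and 8^-w 4^w = 2^-w is still summable, with a bound independent of k. *)
Lemma psum_taylor2 c x y (r M s : R) k : 0 < r -> coef_bound c r M -> `|y - x| + `|s| <= r / 8 ->
  `|psum c x (s *: e_ h + y) k - psum c x y k - s *: deriv_sum c x y k|
    <= s ^+ 2 * (M * 2 ^+ n / (r / 8) ^+ 2).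
Proof.
move=> r0 cb xys; set d := r / 8 in xys *.
have d0 : 0 < d by rewrite divr_gt0.
have M0 := coef_bound_ge0 (ltW r0) cb.
rewrite /psum /deriv_sum scaler_sumr -!sumrB.
pose f a := monom x (s *: e_ h + y) a *: c a - monom x y a *: c a -
  s *: ((monom_rest x y a * ((a h)%:R * (y 0 h - x 0 h) ^+ (a h).-1)) *: c a).
rewrite (eq_bigr (fun a : {ffun 'I_n -> 'I_k.+1} => f (ffnat a))); last by move=> a _; rewrite /f ffunE.
have -> : s ^+ 2 * (M * 2 ^+ n / d ^+ 2) = s ^+ 2 * M / d ^+ 2 * 2 ^+ n by ring.
apply: (@norm_box_sum_le _ _ _ k predT f).
  exact: (divr_ge0 (mulr_ge0 (sqr_ge0 s) M0) (sqr_ge0 d)).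
move=> a _; set b := ffnat a; rewrite /f scalerA -!scalerBl normZ_rV.
rewrite monom_line monom_split; set u := y 0 h - x 0 h.
rewrite mulrCA -!mulrBr normrM [leRHS]mulrAC ler_pdivlMr ?exprn_gt0 //.
have ub : `|u| + `|s| <= d.
  apply: le_trans xys; rewrite lerD2r.
  by have := rV_coord_le (y - x) h; rewrite !mxE.
have t2 := exp_taylor2 (b h) ub.
set E := (s + u) ^+ b h - _ - _ in t2 *.
have -> : `|monom_rest x y b| * `|E| * `|c b| * d ^+ 2 =
   `|monom_rest x y b| * `|c b| * (`|E| * d ^+ 2) by ring.
apply: le_trans (ler_wpM2l (mulr_ge0 (normr_ge0 _) (normr_ge0 _)) t2) _.
have xyd : `|y - x| <= d by apply: le_trans xys; rewrite lerDl.
have -> : `|monom_rest x y b| * `|c b| * (s ^+ 2 * (b h)%:R ^+ 2 * d ^+ b h) =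
   s ^+ 2 * ((`|monom_rest x y b| * d ^+ b h) * `|c b| * (b h)%:R ^+ 2) by ring.
rewrite -[leRHS]mulrA; apply: ler_wpM2l; first exact: sqr_ge0.
apply: (@le_trans _ _ (d ^+ weight b * `|c b| * (2 ^+ weight b * 2 ^+ weight b))).
  apply: ler_pM => //; rewrite ?sqr_ge0 ?mulr_ge0 ?exprn_ge0 // ?(ltW d0) //.
    by apply: ler_wpM2r => //; apply: monom_rest_le.
  have b2 : (b h)%:R <= 2 ^+ weight b :> R.
    rewrite -natrX ler_nat; apply: (leq_trans (ltnW (ltn_expl (b h) (ltnSn 1)))).
    by rewrite leq_exp2l // leq_weight.
  by rewrite expr2 ler_pM.
have -> : d ^+ weight b * `|c b| * (2 ^+ weight b * 2 ^+ weight b) =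
   `|c b| * r ^+ weight b * 2^-1 ^+ weight b.
  have -> : 2^-1 ^+ weight b = 8^-1 ^+ weight b * 2 ^+ weight b * 2 ^+ weight b :> R.
    by rewrite -!exprMn; congr (_ ^+ _); field.
  by rewrite /d exprMn; ring.
by apply: ler_wpM2r; [rewrite exprn_ge0 // invr_ge0 | apply: cb].
Qed.

Lemma derivable_quadratic (W : normedModType R) (f : 'rV[R]_n -> W) y (v : 'rV[R]_n) (l : W) (d C : R) :
  0 < d -> (forall s : R, `|s| < d -> `|f (s *: v + y) - f y - s *: l| <= s ^+ 2 * C) ->
  is_derive y v f l.
Proof.
move=> d0 H.
have C0 : 0 <= `|C| + 1 by rewrite addr_ge0.
have lim : h^-1 *: ((f \o shift y) (h *: v) - f y) @[h --> (0 : R)^'] --> l.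
  apply/cvgrPdist_le => e e0; near=> s.
  have s0 : s != 0 by near: s; exact: nbhs_dnbhs_neq.
  have sd : `|s| < d by near: s; exact: dnbhs0_lt.
  have se : `|s| < e / (`|C| + 1).
    by near: s; apply: dnbhs0_lt; rewrite divr_gt0 // ltr_wpDl.
  have -> : l - s^-1 *: ((f \o shift y) (s *: v) - f y) =
      - (s^-1 *: (f (s *: v + y) - f y - s *: l)).
    by rewrite [in RHS]scalerBr scalerA mulVf // scale1r opprB.
  rewrite normrN normrZ normfV ler_pdivrMl ?normr_gt0 //.
  apply: le_trans (H _ sd) _; rewrite -(real_normK (num_real s)) expr2 -mulrA ler_wpM2l //.
  move: se; rewrite ltr_pdivlMr ?ltr_wpDl // => /ltW; apply: le_trans.
  by rewrite ler_wpM2l // (le_trans (ler_norm _)) // lerDl.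
by split; [apply/cvg_ex; exists l | apply/cvg_lim].
Unshelve. all: by end_near. Qed.

(* [psum_taylor2] is uniform in [k]: it makes the differentiated partial sums Cauchy and
   survives the limit [k --> oo] *)
Lemma expands_is_derive x y c g (r M : R) : 0 < r -> coef_bound c r M -> expands x r c g ->
  `|y - x| < r / 16 ->
  derivable g y (e_ h) /\ (psum (deriv_coef c) x y k @[k --> \oo] --> pd h g y).
Proof.
move=> r0 cb ex xy; have M0 := coef_bound_ge0 (ltW r0) cb.
pose C := M * 2 ^+ n / (r / 8) ^+ 2.
have C0 : 0 <= C.
  by apply: divr_ge0; [apply: mulr_ge0 => //; apply: exprn_ge0 | apply: sqr_ge0].
(* One r / 16 for |y - x| and one for |s| make up the r / 8 of [psum_taylor2]. *)
have r16 : 0 < r / 16 by rewrite divr_gt0.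
have xys (s : R) : `|s| < r / 16 -> `|y - x| + `|s| <= r / 8.
  by move=> sr; apply: le_trans (lerD (ltW xy) (ltW sr)) _; lra.
have est (s : R) k : `|s| < r / 16 ->
    `|psum c x (s *: e_ h + y) k - psum c x y k - s *: deriv_sum c x y k| <= s ^+ 2 * C.
  by move=> sr; exact: (psum_taylor2 k r0 cb (xys _ sr)).
have lim (s : R) : `|s| < r / 16 -> psum c x (s *: e_ h + y) k @[k --> \oo] --> g (s *: e_ h + y).
  move=> sr; apply: ex; rewrite -addrA; apply: le_lt_trans (ler_normD _ _) _.
  apply: (@le_lt_trans _ _ (r / 8)); last by lra.
  apply: le_trans (xys _ sr); rewrite [leLHS]addrC lerD2l normZ_rV.
  by rewrite -[leRHS]mulr1 ler_wpM2l // ev_norm_le.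
have lim0 : psum c x y k @[k --> \oo] --> g y.
  by have := lim 0; rewrite scale0r add0r normr0 => /(_ r16).
have [l dl] : exists l : 'rV[R]_m, deriv_sum c x y k @[k --> \oo] --> l.
  apply: cvg_approx => e e0; pose s := Num.min (r / 32) (e / (C + 1)).
  have s0 : 0 < s by rewrite lt_min !divr_gt0 // ltr_wpDl.
  have sr : `|s| < r / 16.
    by rewrite gtr0_norm // gt_min; apply/orP; left; lra.
  exists (fun k => s^-1 *: (psum c x (s *: e_ h + y) k - psum c x y k)).
  exists (s^-1 *: (g (s *: e_ h + y) - g y)); split.
    by apply: cvgZr; apply: cvgB => //; apply: lim.
  move=> k; rewrite distrC.
  have -> : s^-1 *: (psum c x (s *: e_ h + y) k - psum c x y k) - deriv_sum c x y k =
     s^-1 *: (psum c x (s *: e_ h + y) k - psum c x y k - s *: deriv_sum c x y k).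
    by rewrite [in RHS]scalerBr scalerA mulVf ?gt_eqF // scale1r.
  rewrite normZ_rV gtr0_norm ?invr_gt0 // ler_pdivrMl //.
  apply: le_trans (est s k sr) _; rewrite expr2 -mulrA ler_wpM2l ?(ltW s0) //.
  have : s <= e / (C + 1) by rewrite ge_min lexx orbT.
  rewrite ler_pdivlMr ?ltr_wpDl //; apply: le_trans.
  by rewrite ler_wpM2l ?(ltW s0) // lerDl.
have der : is_derive y (e_ h) g l.
  apply: (@derivable_quadratic _ _ _ _ _ _ C r16) => s sr.
  have lm : `|psum c x (s *: e_ h + y) k - psum c x y k - s *: deriv_sum c x y k|
      @[k --> \oo] --> `|g (s *: e_ h + y) - g y - s *: l|.
    by apply: cvg_norm; apply: cvgB; [apply: cvgB => //; apply: lim | apply: cvgZr].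
  by apply: (cvgr_to_le lm); apply: nearW => k; apply: est.
have [dg gl] := der; split=> //; rewrite /pd gl -[l]addr0.
have r20 : 0 < r / 2 by rewrite divr_gt0.
have xy2 : `|y - x| <= r / 2 / 4 by apply: (le_trans (ltW xy)); lra.
have bd := cvg_boundary h r20 (deriv_coef_bound r0 cb) xy2.
rewrite (_ : (fun k => _) = (fun k => deriv_sum c x y k +
  \sum_(a : {ffun 'I_n -> 'I_k.+1} | ~~ (a h < k)%N)
     monom x y (ffnat a) *: deriv_coef c (ffnat a))); first exact: cvgD.
by apply/funext => k; rewrite deriv_sumE subrK.
Qed.

Lemma pseries_pd x g : pseries_at x g -> pseries_at x (pd h g).
Proof.
move=> [r [r0 [M [c [cb ex]]]]]; exists (r / 16); split; first by rewrite divr_gt0.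
exists (M / r), (deriv_coef c); split.
  by apply: coef_boundW (deriv_coef_bound r0 cb); lra.
by move=> y xy; have [] := expands_is_derive r0 cb ex xy.
Qed.

Lemma pseries_derivable x g : pseries_at x g -> derivable g x (e_ h).
Proof.
move=> [r [r0 [M [c [cb ex]]]]].
have xx : `|x - x| < r / 16 by rewrite subrr normr0 divr_gt0.
by have [] := expands_is_derive r0 cb ex xx.
Qed.

End PowerSeriesDerivative.

Lemma analytic_smooth {R : realType} n m (U : set 'rV[R]_n) (g : 'rV[R]_n -> 'rV[R]_m) :
  analytic_on U g -> smooth U g.
Proof.
move=> /analytic_pseries ag l; elim/last_ind: l g ag => [|l i IH] g ag x Ux.
  by split; [apply: pseries_continuous (ag x Ux) | move=> i; apply: pseries_derivable (ag x Ux)].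
by rewrite foldr_rcons; apply: IH Ux => y Uy; apply/pseries_pd/ag.
Qed.

(** * Division of power series by a coordinate *)

Section PowerSeriesQuotient.
Variables (R : realType) (n m : nat) (h : 'I_n).
Local Notation e_ := (ev R).
Implicit Types (x y : 'rV[R]_n) (a : {ffun 'I_n -> nat}) (c : {ffun 'I_n -> nat} -> 'rV[R]_m).
Implicit Types (g : 'rV[R]_n -> 'rV[R]_m) (U : set 'rV[R]_n).

(** The continuous extension of g / y_h, provided that g vanishes on y_h = 0. *)
Definition quot g : 'rV[R]_n -> 'rV[R]_m :=
  fun y => if y 0 h == 0 then pd h g y else (y 0 h)^-1 *: g y.

Lemma coef_bound_shift c (r M : R) : 0 < r -> coef_bound c r M ->
  coef_bound (c \o shift_index h) r (M / r).
Proof.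
move=> r0 cb a; rewrite ler_pdivlMr // -mulrA -exprSr -(weight_shift h).
exact: cb.
Qed.

Lemma psum_shift c x y k :
  (y 0 h - x 0 h) *: psum (c \o shift_index h) x y k =
  \sum_(a : {ffun 'I_n -> 'I_k.+1} | (0 < a h)%N) monom x y (ffnat a) *: c (ffnat a) +
  (y 0 h - x 0 h) *: \sum_(a : {ffun 'I_n -> 'I_k.+1} | ~~ (a h < k)%N)
     monom x y (ffnat a) *: (c \o shift_index h) (ffnat a).
Proof.
rewrite (@reindex_shift R n m k h (fun a => monom x y a *: c a)) /psum.
rewrite (bigID (fun a : {ffun 'I_n -> 'I_k.+1} => (a h < k)%N)) /= scalerDr scaler_sumr.
by congr (_ + _); apply: eq_bigr => b _; rewrite monom_shift scalerA.
Qed.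

(* since [g] vanishes where [y_h = 0], [g y] is the difference of the expansions at [y] and
   at its projection, in which only monomials divisible by [y_h] survive *)
Lemma pseries_quot_eq0 x g : nbhs x (fun y : 'rV[R]_n => y 0 h = 0 -> g y = 0) -> x 0 h = 0 ->
  pseries_at x g -> pseries_at x (quot g).
Proof.
move=> /nbhs_dist[d d0 g0] xh [r [r0 [M [c [cb ex]]]]].
pose r' := Num.min d (r / 16).
have r'0 : 0 < r' by rewrite lt_min d0 divr_gt0.
have r'd : r' <= d by rewrite ge_min lexx.
have r'r : r' <= r / 16 by rewrite ge_min lexx orbT.
exists r'; split=> //; exists (M / r), (c \o shift_index h); split.
  by apply: coef_boundW (coef_bound_shift r0 cb); [exact: ltW | lra].
move=> y xy; rewrite /quot.
have [dg pdg] := expands_is_derive h r0 cb ex (lt_le_trans xy r'r).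
case: eqVneq => yh.
  apply: cvg_trans pdg; apply: near_eq_cvg; apply: nearW => k.
  apply: eq_bigr => a _; rewrite /= /deriv_coef /=.
  have [b0|b0] := posnP (ffnat a h); first by rewrite b0 scale1r.
  rewrite (monom_split h) xh yh subrr.
  by rewrite expr0n eqn0Ngt b0 /= mulr0 !scale0r.
have -> : psum (c \o shift_index h) x y = fun k => (y 0 h)^-1 *:
  (psum c x y k - psum c x (- y 0 h *: e_ h + y) k) +
  \sum_(a : {ffun 'I_n -> 'I_k.+1} | ~~ (a h < k)%N)
     monom x y (ffnat a) *: (c \o shift_index h) (ffnat a).
  apply/funext => k; apply: (scalerI yh); rewrite scalerDr scalerA mulfV // scale1r.
  have := psum_shift c x y k; rewrite xh subr0 => ->; congr (_ + _).
  rewrite /psum -sumrB big_mkcond /=; apply: eq_bigr => a _.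
  have -> : (0 < a h)%N = (0 < ffnat a h)%N by rewrite ffunE.
  rewrite -scalerBl monom_line (monom_split h) xh subr0 addNr -mulrBr expr0n.
  have [a0|a0] := posnP (ffnat a h); first by rewrite a0 /= expr0 subrr mulr0 scale0r.
  by rewrite subr0.
have y0xd : `|x - (- y 0 h *: e_ h + y)| < r'.
  apply: le_lt_trans xy; apply: rV_norm_le => // j.
  rewrite !mxE eqxx /=; have [jh|jh] := eqVneq j h.
    by rewrite jh xh mulr1 addNr subrr normr0.
  by rewrite mulr0 add0r distrC; have := rV_coord_le (y - x) j; rewrite !mxE.
have gy0 : g (- y 0 h *: e_ h + y) = 0.
  apply: g0; first exact: lt_le_trans r'd.
  by rewrite !mxE !eqxx mulr1 addNr.
have r'r1 : r' < r by lra.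
rewrite -[_ *: g y]addr0; apply: cvgD; last first.
  by apply: cvg_boundary (coef_bound_shift r0 cb) _ => //; lra.
apply: cvgZr; rewrite -[g y]subr0 -gy0; apply: cvgB; apply: ex.
  exact: lt_trans xy r'r1.
by rewrite distrC; apply: lt_trans y0xd r'r1.
Qed.

Definition set_index a k : {ffun 'I_n -> nat} := [ffun j => if j == h then k else a j].

(* coefficients of [g / y_h] at a point with [y_h = b <> 0], obtained by solving
   [(b + (y_h - b)) * (sum of d_a (y - x)^a) = (sum of c_a (y - x)^a)] for [d],
   recursively in the exponent of [y_h - b] *)
Fixpoint div_coef_rec c (b : R) a k : 'rV[R]_m :=
  b^-1 *: (c (set_index a k) - if k is k'.+1 then div_coef_rec c b a k' else 0).

Definition div_coef c (b : R) a := div_coef_rec c b a (a h).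

Lemma div_coef_rec_ext c b a a' k : (forall j, j != h -> a j = a' j) ->
  div_coef_rec c b a k = div_coef_rec c b a' k.
Proof.
move=> aa; have ss j : set_index a j = set_index a' j.
  by apply/ffunP => i; rewrite !ffunE; case: eqVneq => // /aa.
by elim: k => [|k IH] /=; rewrite ss // IH.
Qed.

Lemma div_coef_eq0 c b a : b != 0 -> a h = 0%N -> b *: div_coef c b a = c a.
Proof.
move=> b0 a0; rewrite /div_coef a0 /= subr0 scalerA mulfV // scale1r; congr c.
by apply/ffunP => i; rewrite !ffunE; case: eqVneq => // ->.
Qed.

Lemma div_coef_shift c b a : b != 0 ->
  b *: div_coef c b (shift_index h a) + div_coef c b a = c (shift_index h a).
Proof.
move=> b0; rewrite /div_coef ffunE eqxx addn1 /= scalerA mulfV // scale1r.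
rewrite (@div_coef_rec_ext _ _ (shift_index h a) a); last first.
  by move=> j /negbTE jh; rewrite ffunE jh addn0.
rewrite subrK; congr c; apply/ffunP => j; rewrite !ffunE.
by case: eqVneq => [->|]; rewrite ?addn1.
Qed.

(** The bound reproduces itself through the recursion: r <= |b| / 2 makes the previous coefficient
    contribute at most M, the coefficient of the given series contributes another M, and the
    division by b gives 2 M / |b| again. *)
Lemma div_coef_bound c (b r M : R) : b != 0 -> 0 < r -> r <= `|b| / 2 -> coef_bound c r M ->
  coef_bound (div_coef c b) r (2 * M / `|b|).
Proof.
move=> b0 r0 rb cb a.
have bp : 0 < `|b| by rewrite normr_gt0.
have M0 := coef_bound_ge0 (ltW r0) cb.
(* Frees the exponent of y_h, on which the induction runs. *)
have -> : weight a = weight (set_index a (a h)).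
  by congr weight; apply/ffunP => j; rewrite ffunE; case: eqVneq => // ->.
rewrite /div_coef; elim: (a h) => [|k IH] /=.
  rewrite subr0 normZ_rV normfV -mulrA ler_pdivrMl //.
  apply: le_trans (cb _) _; rewrite mulrC divfK ?gt_eqF //.
  by rewrite ler_peMl // ler1n.
rewrite normZ_rV normfV -mulrA ler_pdivrMl // mulrC [leRHS]mulrC divfK ?gt_eqF //.
rewrite mulrC; apply: le_trans (ler_wpM2r _ (ler_normB _ _)) _.
  by rewrite exprn_ge0 // ltW.
rewrite mulrDl; have -> : 2 * M = M + M by ring.
apply: lerD; first exact: cb.
have -> : set_index a k.+1 = shift_index h (set_index a k).
  by apply/ffunP => j; rewrite !ffunE; case: eqVneq; rewrite ?addn1 ?addn0.
rewrite weight_shift exprSr mulrA.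
apply: le_trans (ler_pM _ (ltW r0) IH rb) _.
  by rewrite mulr_ge0 // exprn_ge0 // ltW.
by rewrite le_eqVlt; apply/orP; left; apply/eqP; field; rewrite gt_eqF.
Qed.

(** Finite form of the equation solved by [div_coef]. Multiplication by y_h - x_h pushes the
    exponents equal to k out of the box, and the resulting error tends to 0 by [cvg_boundary]. *)
Lemma psum_div_coef c (b : R) x y k : b != 0 ->
  (b + (y 0 h - x 0 h)) *: psum (div_coef c b) x y k = psum c x y k +
  (y 0 h - x 0 h) *: \sum_(a : {ffun 'I_n -> 'I_k.+1} | ~~ (a h < k)%N)
     monom x y (ffnat a) *: div_coef c b (ffnat a).
Proof.
move=> b0; rewrite scalerDl.
have E : (y 0 h - x 0 h) *: psum (div_coef c b) x y k =
  \sum_(a : {ffun 'I_n -> 'I_k.+1} | (a h < k)%N)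
    monom x y (shift_index h (ffnat a)) *: div_coef c b (ffnat a) +
  (y 0 h - x 0 h) *: \sum_(a : {ffun 'I_n -> 'I_k.+1} | ~~ (a h < k)%N)
     monom x y (ffnat a) *: div_coef c b (ffnat a).
  rewrite /psum (bigID (fun a : {ffun 'I_n -> 'I_k.+1} => (a h < k)%N)) /= scalerDr scaler_sumr.
  by congr (_ + _); apply: eq_bigr => a _; rewrite monom_shift scalerA.
rewrite E addrA; congr (_ + _).
rewrite /psum scaler_sumr (bigID (fun a : {ffun 'I_n -> 'I_k.+1} => (0 < a h)%N)) /=.
rewrite [in RHS](bigID (fun a : {ffun 'I_n -> 'I_k.+1} => (0 < a h)%N)) /=.
rewrite (@reindex_shift R n m k h (fun a => b *: (monom x y a *: div_coef c b a))).
rewrite (@reindex_shift R n m k h (fun a => monom x y a *: c a)).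
rewrite addrAC -big_split /=; congr (_ + _); apply: eq_bigr => a ah.
  by rewrite scalerA mulrC -scalerA -scalerDr div_coef_shift.
rewrite scalerA mulrC -scalerA div_coef_eq0 // ffunE.
by apply/eqP; rewrite -leqn0 leqNgt.
Qed.

Lemma pseries_quot_neq0 x g : x 0 h != 0 -> pseries_at x g -> pseries_at x (quot g).
Proof.
move=> xh [r [r0 [M [c [cb ex]]]]].
have xp : 0 < `|x 0 h| by rewrite normr_gt0.
pose s := Num.min r (`|x 0 h| / 2).
have s0 : 0 < s by rewrite lt_min r0 divr_gt0.
have sr : s <= r by rewrite ge_min lexx.
have sx : s <= `|x 0 h| / 2 by rewrite ge_min lexx orbT.
have db := div_coef_bound xh s0 sx (coef_boundW (ltW s0) sr cb).
exists (s / 4); split; first by rewrite divr_gt0.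
exists (2 * M / `|x 0 h|), (div_coef c (x 0 h)); split.
  by apply: coef_boundW db; lra.
move=> y xy.
have yh : y 0 h != 0.
  apply/eqP => yh; have := rV_coord_le (y - x) h.
  rewrite !mxE yh sub0r normrN => /le_lt_trans/(_ xy) xs.
  have sx4 : s / 4 <= `|x 0 h| by lra.
  by have := lt_le_trans xs sx4; rewrite ltxx.
have -> : psum (div_coef c (x 0 h)) x y = fun k => (y 0 h)^-1 *: (psum c x y k +
  (y 0 h - x 0 h) *: \sum_(a : {ffun 'I_n -> 'I_k.+1} | ~~ (a h < k)%N)
     monom x y (ffnat a) *: div_coef c (x 0 h) (ffnat a)).
  apply/funext => k; rewrite -psum_div_coef // addrC subrK scalerA mulVf //.
  by rewrite scale1r.
rewrite /quot (negbTE yh) (_ : g y = g y + (y 0 h - x 0 h) *: 0); last first.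
  by rewrite scaler0 addr0.
apply: cvgZr; apply: cvgD; first by apply: ex; lra.
by apply: cvgZr; exact: (cvg_boundary h s0 db (ltW xy)).
Qed.

Lemma analytic_quot U g : open U -> (forall y, U y -> y 0 h = 0 -> g y = 0) ->
  analytic_on U g -> analytic_on U (quot g).
Proof.
move=> oU g0 /analytic_pseries ag; apply: pseries_analytic => x Ux.
have [xh|xh] := eqVneq (x 0 h) 0; last exact: pseries_quot_neq0 (ag x Ux).
apply: pseries_quot_eq0 xh (ag x Ux).
by apply: filterS (open_nbhs_nbhs (conj oU Ux)) => y; apply: g0.
Qed.

Lemma smooth_quot U g : open U -> (forall y, U y -> y 0 h = 0 -> g y = 0) ->
  smooth U g -> smooth U (quot g).
Proof.
move=> oU g0 sg; apply/(smooth_coord _ oU) => j.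
have sgj := (smooth_coord _ oU).1 sg j.
have g0j y : U y -> y 0 h = 0 -> g y 0 j = 0.
  by move=> Uy yh; rewrite g0 // mxE.
apply: (eq_smooth oU _ (smooth_quotient oU sgj g0j)) => x Ux.
rewrite /quot; case: eqVneq => xh; last by rewrite mxE mulrC.
by rewrite /pd derive_mx ?mxE //; have [] := smooth_is_derive h sg Ux.
Qed.

Lemma pseries0 x : pseries_at x (0 : 'rV[R]_n -> 'rV[R]_m).
Proof.
exists 1; split=> //; exists 0, (fun=> 0); split=> [a|y _].
  by rewrite normr0 mul0r.
have -> : psum (fun=> (0 : 'rV[R]_m)) x y = (fun=> 0).
  by apply/funext => k; apply: big1 => a _; rewrite scaler0.
exact: cvg_cst.
Qed.

Lemma pseriesD x f g : pseries_at x f -> pseries_at x g -> pseries_at x (f + g).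
Proof.
move=> [r [r0 [M [c [cb ex]]]]] [s [s0 [L [d [db ey]]]]].
pose q := Num.min r s.
have q0 : 0 < q by rewrite lt_min r0.
have qr : q <= r by rewrite ge_min lexx.
have qs : q <= s by rewrite ge_min lexx orbT.
exists q; split=> //; exists (M + L), (fun a => c a + d a); split.
  move=> a; apply: le_trans (ler_wpM2r _ (ler_normD _ _)) _.
    by rewrite exprn_ge0 // ltW.
  by rewrite mulrDl lerD //; [apply: coef_boundW cb a | apply: coef_boundW db a]; rewrite // ltW.
move=> y xy.
have -> : psum (fun a => c a + d a) x y = fun k => psum c x y k + psum d x y k.
  apply/funext => k; rewrite /psum -big_split /=.
  by apply: eq_bigr => a _; rewrite scalerDr.
by apply: cvgD; [apply: ex | apply: ey]; apply: lt_le_trans xy _.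
Qed.

Lemma pseriesZ x (b : R) g : pseries_at x g -> pseries_at x (b \*: g).
Proof.
move=> [r [r0 [M [c [cb ex]]]]].
exists r; split=> //; exists (`|b| * M), (fun a => b *: c a); split.
  by move=> a; rewrite normZ_rV -mulrA ler_wpM2l.
move=> y xy.
have -> : psum (fun a => b *: c a) x y = fun k => b *: psum c x y k.
  apply/funext => k; rewrite /psum scaler_sumr.
  by apply: eq_bigr => a _; rewrite !scalerA mulrC.
by apply: cvgZr; apply: ex.
Qed.

End PowerSeriesQuotient.

(** * Closure properties shared by the two regularity classes *)

Section Regularity.
Variables (R : realType) (n m : nat) (p : regularity).
Implicit Types (U : set 'rV[R]_n) (f g : 'rV[R]_n -> 'rV[R]_m).

Lemma reg_smooth U f : reg_on p U f -> smooth U f.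
Proof. by case: p => //; apply: analytic_smooth. Qed.

Lemma reg_pd U f i : reg_on p U f -> reg_on p U (pd i f).
Proof.
case: p => /=; first exact: smooth_pd.
by move=> /analytic_pseries af; apply: pseries_analytic => x /af; apply: pseries_pd.
Qed.

Lemma reg_quot U f h : open U -> (forall y, U y -> y 0 h = 0 -> f y = 0) ->
  reg_on p U f -> reg_on p U (quot h f).
Proof. by case: p => oU f0; [apply: smooth_quot | apply: analytic_quot]. Qed.

Lemma reg0 U : reg_on p U (0 : 'rV[R]_n -> 'rV[R]_m).
Proof.
case: p => /=; first exact: smooth0.
by apply: pseries_analytic => x _; apply: pseries0.
Qed.

Lemma regD U f g : open U -> reg_on p U f -> reg_on p U g -> reg_on p U (f + g).
Proof.
case: p => oU /=; first exact: smoothD.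
move=> /analytic_pseries af /analytic_pseries ag; apply: pseries_analytic => x Ux.
by apply: pseriesD; [apply: af | apply: ag].
Qed.

Lemma regZ U b f : open U -> reg_on p U f -> reg_on p U (b \*: f).
Proof.
case: p => oU /=; first exact: smoothZ.
by move=> /analytic_pseries af; apply: pseries_analytic => x /af; apply: pseriesZ.
Qed.

Lemma reg_sum U (I : Type) (r : seq I) (P : pred I) (f : I -> 'rV[R]_n -> 'rV[R]_m) :
  open U -> (forall i, P i -> reg_on p U (f i)) -> reg_on p U (\sum_(i <- r | P i) f i).
Proof.
move=> oU rf; apply: big_ind => //; first exact: reg0.
by move=> f1 f2; apply: regD.
Qed.

End Regularity.

(** * Maps with values in the algebra *)

Section Functionals.
Variables (R : realType) (A : falgType R).

Implicit Types (a b : A) (mu : A -> R) (k : R).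

(** Linearity as a predicate on plain functions, so that [fun x => mu (a * x)] and similar
    expressions qualify as they are. Testing with functionals moves identities in [A] to [R], where
    [ring] and [field] apply. *)
Definition functional (mu : A -> R) := forall k a b, mu (k *: a + b) = k * mu a + mu b.

Lemma functional0 mu : functional mu -> mu 0 = 0.
Proof.
move=> lm; have := lm 1 0 0; rewrite scale1r addr0 mul1r.
by move=> /eqP; rewrite -subr_eq subrr eq_sym => /eqP.
Qed.

Lemma functionalD mu a b : functional mu -> mu (a + b) = mu a + mu b.
Proof. by move=> lm; have := lm 1 a b; rewrite scale1r mul1r. Qed.

Lemma functionalZ mu k a : functional mu -> mu (k *: a) = k * mu a.
Proof. by move=> lm; have := lm k a 0; rewrite !addr0 functional0 // addr0. Qed.

Lemma functional_sum mu (I : Type) (r : seq I) (P : pred I) (f : I -> A) : functional mu ->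
  mu (\sum_(i <- r | P i) f i) = \sum_(i <- r | P i) mu (f i).
Proof.
move=> lm; apply: (big_morph mu); last exact: functional0.
by move=> a b; apply: functionalD.
Qed.

Lemma functional_mulr mu a : functional mu -> functional (fun x => mu (a * x)).
Proof. by move=> lm k x y; rewrite mulrDr -scalerAr lm. Qed.

Lemma coordsA_sum a : a = \sum_(i < \dim {:A}) coordsA a 0 i *: (vbasis {:A})`_i.
Proof.
rewrite {1}(coord_vbasis (memvf a)); apply: eq_bigr => i _.
by rewrite mxE.
Qed.

Lemma coordsAK : cancel (@coordsA R A) (@fromcoords R A).
Proof. by move=> a; rewrite /fromcoords -coordsA_sum. Qed.

Lemma fromcoordsK : cancel (@fromcoords R A) (@coordsA R A).
Proof.
move=> r; apply/rowP => i; rewrite mxE /fromcoords.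
exact: (coord_sum_free (fun j => r 0 j) i (basis_free (vbasisP _))).
Qed.

Lemma coordsAP k a b : coordsA (k *: a + b) = k *: coordsA a + coordsA b.
Proof. by apply/rowP => i; rewrite !mxE linearP. Qed.

Lemma coordsAD a b : coordsA (a + b) = coordsA a + coordsA b.
Proof. by rewrite -[a]scale1r coordsAP !scale1r. Qed.

Lemma coordsA0 : coordsA (0 : A) = 0.
Proof. by apply/rowP => i; rewrite !mxE linear0. Qed.

Lemma coordsAZ k a : coordsA (k *: a) = k *: coordsA a.
Proof. by rewrite -[k *: a]addr0 coordsAP coordsA0 addr0. Qed.

Lemma coordsAN a : coordsA (- a) = - coordsA a.
Proof. by rewrite -scaleN1r coordsAZ scaleN1r. Qed.

Lemma coordsA_bigsum (I : Type) (r : seq I) (P : pred I) (f : I -> A) :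
  coordsA (\sum_(i <- r | P i) f i) = \sum_(i <- r | P i) coordsA (f i).
Proof. by apply: (big_morph (@coordsA R A) coordsAD); rewrite coordsA0. Qed.

Lemma functional_coords i : functional (fun a => coordsA a 0 i).
Proof. by move=> k a b; rewrite coordsAP !mxE. Qed.

Lemma functional_eq a b : (forall mu, functional mu -> mu a = mu b) -> a = b.
Proof.
move=> ab; apply: (can_inj coordsAK); apply/rowP => i.
exact: (ab _ (functional_coords i)).
Qed.

Lemma functional_coordsE mu a : functional mu ->
  mu a = \sum_(i < \dim {:A}) mu ((vbasis {:A})`_i) * coordsA a 0 i.
Proof.
move=> lm; rewrite {1}[a]coordsA_sum functional_sum //.
by apply: eq_bigr => i _; rewrite functionalZ // mulrC.
Qed.

Variables (n : nat) (U : set 'rV[R]_n).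
Hypothesis oU : open U.
Implicit Types (g : 'rV[R]_n -> A).

Definition smoothA g := smooth U (@coordsA R A \o g).

Lemma smooth_functional mu g : functional mu -> smoothA g -> smooth U (mu \o g).
Proof.
move=> lm /(smooth_coord _ oU) sg.
have -> : mu \o g =
    \sum_(i < \dim {:A}) (mu ((vbasis {:A})`_i) \*: (fun x => coordsA (g x) 0 i)).
  by apply/funext => x; rewrite fct_sumE /= functional_coordsE.
by apply: smooth_sum => // i _; apply: smoothZ => //; apply: sg.
Qed.

Lemma coordsA_pdA i g : @coordsA R A \o pdA i g = pd i (@coordsA R A \o g).
Proof. by apply/funext => x /=; rewrite fromcoordsK. Qed.

Lemma smoothA_pdA i g : smoothA g -> smoothA (pdA i g).
Proof. by rewrite /smoothA coordsA_pdA; apply: smooth_pd. Qed.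

Lemma functional_pdA mu i g x : functional mu -> smoothA g -> U x ->
  mu (pdA i g x) = pd i (mu \o g) x.
Proof.
move=> lm sg Ux.
have dg := smooth_is_derive i sg Ux.
have dj j : is_derive x (ev R i) (fun y => coordsA (g y) 0 j) (pd i (@coordsA R A \o g) x 0 j).
  have [d _] := dg; rewrite /pd derive_mx // mxE.
  by apply: derivableP; move/derivable_mxP : d.
rewrite functional_coordsE //.
have -> : mu \o g =
    \sum_(i < \dim {:A}) (mu ((vbasis {:A})`_i) \*: (fun x => coordsA (g x) 0 i)).
  by apply/funext => y; rewrite fct_sumE /= functional_coordsE.
rewrite /pd derive_sum; last by move=> j; apply: derivableZ; case: (dj j).
apply: eq_bigr => j _; rewrite deriveZ; last by case: (dj j).
by have [_ ->] := dj j; rewrite fromcoordsK.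
Qed.

Lemma functional_laplA mu g x : functional mu -> smoothA g -> U x ->
  mu (laplA g x) = \sum_i pd i (pd i (mu \o g)) x.
Proof.
move=> lm sg Ux; rewrite functional_sum //; apply: eq_bigr => i _.
have -> := functional_pdA i lm (smoothA_pdA i sg) Ux.
by apply: (eq_pd i oU _ Ux) => y Uy; exact: (functional_pdA i lm sg Uy).
Qed.

End Functionals.

(** * Second derivatives in one variable *)

Section SecondDerivative.
Variable R : realType.
Implicit Types (f g : R -> R) (x : R).

Lemma nbhs_forall x (P : set R) : (forall s, P s) -> nbhs x P.
Proof. by move=> H; apply: filterS (@filterT _ (nbhs x) _) => s _. Qed.

(** A relation carrying the values of both derivatives at [x], so that sum, product and chain rules
    compute second derivatives explicitly; it asks for a first derivative near [x] and a second one
    at [x] only. *)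
Definition has_der2 f x a b := exists f1 : R -> R,
  [/\ nbhs x (fun s => is_derive s 1 f (f1 s)), f1 x = a & is_derive x 1 f1 b].

Lemma is_derive_near f g x l : {near x, f =1 g} -> is_derive x 1 f l -> is_derive x 1 g l.
Proof. by move=> fg; apply: near_eq_is_derive. Qed.

Lemma is_derive_unique f x l l' : is_derive x 1 f l -> is_derive x 1 f l' -> l = l'.
Proof. by move=> [_ <-] [_ <-]. Qed.

Lemma is_derive_cont f x l : is_derive x 1 f l -> {for x, continuous f}.
Proof. by move=> [d _]; apply: differentiable_continuous; apply/derivable1_diffP. Qed.

Lemma has_der2_near f g x a b : {near x, f =1 g} -> has_der2 f x a b -> has_der2 g x a b.
Proof.
move=> /near_join fg [f1 [df f1a df1]]; exists f1; split=> //.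
by apply: filterS2 fg df => s /= fs; apply: is_derive_near.
Qed.

Lemma has_der2_unique f x a b a' b' : has_der2 f x a b -> has_der2 f x a' b' -> b = b'.
Proof.
move=> [f1 [df f1a df1]] [g1 [dg g1a dg1]]; apply: is_derive_unique df1 _.
apply: is_derive_near dg1; apply: filterS2 dg df => s ds es.
exact: is_derive_unique ds es.
Qed.

Lemma has_der2_der1 f x a b : has_der2 f x a b -> is_derive x 1 f a.
Proof. by move=> [f1 [/nbhs_singleton df <- _]]. Qed.

Lemma has_der2_cst k x : has_der2 (fun=> k) x 0 0.
Proof.
exists (fun=> 0); split=> //; last exact: is_derive_cst.
by apply: nbhs_forall => s; apply: is_derive_cst.
Qed.

Lemma has_der2_id x : has_der2 (fun s => s) x 1 0.
Proof.
exists (fun=> 1); split=> //; last exact: is_derive_cst.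
by apply: nbhs_forall => s; apply: is_derive_id.
Qed.

Lemma has_der2D f g x a b c d : has_der2 f x a b -> has_der2 g x c d ->
  has_der2 (fun s => f s + g s) x (a + c) (b + d).
Proof.
move=> [f1 [df <- df1]] [g1 [dg <- dg1]]; exists (fun s => f1 s + g1 s); split=> //.
  by apply: filterS2 df dg => s; apply: is_deriveD.
exact: is_deriveD.
Qed.

Lemma is_derive_mul f g x a c : is_derive x 1 f a -> is_derive x 1 g c ->
  is_derive x 1 (fun s => f s * g s) (a * g x + f x * c).
Proof.
move=> df dg; apply: is_derive_eq (is_deriveM df dg) _.
by rewrite /GRing.scale /= addrC mulrC [a * _]mulrC [_ * c]mulrC.
Qed.

Lemma has_der2M f g x a b c d : has_der2 f x a b -> has_der2 g x c d ->
  has_der2 (fun s => f s * g s) x (a * g x + f x * c) (b * g x + 2 * a * c + f x * d).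
Proof.
move=> hf hg; have df0 := has_der2_der1 hf; have dg0 := has_der2_der1 hg.
move: hf hg => [f1 [df f1a df1]] [g1 [dg g1c dg1]].
exists (fun s => f1 s * g s + f s * g1 s); split.
- by apply: filterS2 df dg => s; apply: is_derive_mul.
- by rewrite f1a g1c.
- have := is_deriveD (is_derive_mul df1 dg0) (is_derive_mul df0 dg1).
  by move/is_derive_eq; apply; rewrite f1a g1c; ring.
Qed.

Lemma has_der2Z k f x a b : has_der2 f x a b -> has_der2 (fun s => k * f s) x (k * a) (k * b).
Proof.
move=> hf; have := has_der2M (has_der2_cst k x) hf.
by rewrite !(mul0r, mulr0, add0r).
Qed.

Lemma has_der2_sum (I : Type) (r : seq I) (f : I -> R -> R) x (a b : I -> R) :
  (forall i, has_der2 (f i) x (a i) (b i)) ->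
  has_der2 (fun s => \sum_(i <- r) f i s) x (\sum_(i <- r) a i) (\sum_(i <- r) b i).
Proof.
move=> hf; elim: r => [|i r IH].
  under eq_fun do rewrite big_nil; rewrite !big_nil; exact: has_der2_cst.
under eq_fun do rewrite big_cons; rewrite !big_cons; exact: has_der2D.
Qed.

Lemma has_der2_comp f g x a b c d : has_der2 f (g x) a b -> has_der2 g x c d ->
  has_der2 (fun s => f (g s)) x (a * c) (b * c ^+ 2 + a * d).
Proof.
move=> hf hg; have df0 := has_der2_der1 hf; have dg0 := has_der2_der1 hg.
move: hf hg => [f1 [df f1a df1]] [g1 [dg g1c dg1]].
have cg := is_derive_cont dg0.
exists (fun s => f1 (g s) * g1 s); split.
- have nf : nbhs x (fun s => is_derive (g s) 1 f (f1 (g s))).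
    by exact: (cg (fun s : R => is_derive s 1 f (f1 s)) df).
  apply: filterS2 nf dg => s dfs dgs.
  exact: (is_derive1_comp dfs dgs).
- by rewrite f1a g1c.
- apply: is_derive_eq (is_derive_mul (is_derive1_comp df1 dg0) dg1) _.
  by rewrite /= f1a g1c; ring.
Qed.

Lemma has_der2_inv x : x != 0 -> has_der2 (fun s => s^-1) x (- x ^- 2) (2 * x ^- 3).
Proof.
move=> x0; exists (fun s => - s ^- 2); split=> //.
- have nx : nbhs x (fun s : R => s != 0) by apply: open_nbhs_nbhs; split=> //; exact: open_neq.
  apply: filterS nx => s s0; apply: is_derive_eq (is_deriveV s0 (is_derive_id _ _)) _.
  by rewrite [LHS]mulr1.
- have dX := is_deriveX 2 (is_derive_id x (1 : R)).
  have x2 : (id ^+ 2 : R -> R) x != 0 by rewrite exprfctE expf_neq0.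
  have := is_deriveN (is_deriveV x2 dX); rewrite exprfctE => dN.
  apply: is_derive_eq dN _; rewrite /GRing.scale /= mulr1.
  by field.
Qed.

Lemma has_der2_sqrt x : 0 < x ->
  has_der2 (@Num.sqrt R) x (2 * Num.sqrt x)^-1 (- (4 * Num.sqrt x ^+ 3)^-1).
Proof.
move=> x0; exists (fun s => (2 * Num.sqrt s)^-1); split=> //.
  have nx : nbhs x (fun s : R => 0 < s) by apply: open_nbhs_nbhs; split=> //; exact: open_gt.
  by apply: filterS nx => s; apply: is_derive1_sqrt.
have r0 : 2 * Num.sqrt x != 0 by rewrite mulf_neq0 // gt_eqF // sqrtr_gt0.
have dZ := is_derive_mul (is_derive_cst (2 : R) x 1) (is_derive1_sqrt x0).
apply: is_derive_eq (@is_deriveV _ (fun s => 2 * Num.sqrt s) _ _ _ r0 dZ) _.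
have q0 : Num.sqrt x != 0 by rewrite gt_eqF // sqrtr_gt0.
by rewrite /GRing.scale /=; field.
Qed.

Lemma has_der2_shift f x y a b : has_der2 f (x + y) a b -> has_der2 (fun s => f (s + y)) x a b.
Proof.
move=> hf; have h1 := has_der2D (has_der2_id x) (has_der2_cst y x).
have := has_der2_comp (g := fun s => s + y) hf h1.
by rewrite !addr0 !mulr1 expr1n mulr1 mulr0 addr0.
Qed.

Lemma has_der2_pd n (U : set 'rV[R]_n) (phi : 'rV[R]_n -> R) i (y : 'rV[R]_n) :
  open U -> smooth U phi -> U y ->
  has_der2 (fun s => phi (s *: ev R i + y)) 0 (pd i phi y) (pd i (pd i phi) y).
Proof.
move=> oU sp Uy; have y0 : 0 *: ev R i + y = y by rewrite scale0r add0r.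
exists (fun s => pd i phi (s *: ev R i + y)); split.
- have : nbhs (0 : R) (fun s : R => U (s *: ev R i + y)).
    by apply: near_line; rewrite y0; apply: open_nbhs_nbhs.
  by apply: filterS => s Us; apply: (smooth_line sp Us).
- by rewrite y0.
- have U0 : U (0 *: ev R i + y) by rewrite y0.
  by have := smooth_line (smooth_pd i sp) U0; rewrite y0.
Qed.

End SecondDerivative.

Lemma is_derive_oppv {R : realType} {V W : normedModType R} (f : V -> W) (x v : V) (l : W) :
  is_derive x v f l -> is_derive x (- v) f (- l).
Proof.
move=> [/cvg_ex[l' lim] dl].
have {dl}El : l' = l by rewrite -dl; apply/esym/cvg_lim.
have lim' : h^-1 *: ((f \o shift x) (h *: - v) - f x) @[h --> (0 : R)^'] --> - l.
  apply/cvgrPdist_le => e e0.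
  have /cvgrPdist_le/(_ _ e0) near0 := lim.
  have [d d0 hd] := @nbhs_dist R R^o 0 (fun s => s != 0 ->
    `|l' - s^-1 *: ((f \o shift x) (s *: v) - f x)| <= e) near0.
  apply: (@dist_nbhs R R^o 0 (fun s => s != 0 ->
    `|- l - s^-1 *: ((f \o shift x) (s *: - v) - f x)| <= e) d d0) => s sd s0.
  have s0' : - s != 0 by rewrite oppr_eq0.
  have sd' : `|0 - - s| < d by move: sd; rewrite !sub0r opprK normrN.
  have := hd (- s) sd' s0'.
  by rewrite El invrN !scaleNr scalerN opprK -normrN opprD.
by split; [apply/cvg_ex; exists (- l) | apply/cvg_lim].
Qed.

(** * Stem functions *)

Section Parity.
Variables (R : realType) (t : nat -> nat) (tau : nat) (D : set 'rV[R]_((t 0).+1 + tau)).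
Hypothesis oD : open D.
Local Notation n := ((t 0).+1 + tau)%N.
Local Notation refl_ := (@refl R t tau).
Local Notation b_ := (@betai t tau).
Local Notation e_ := (ev R).
Implicit Types (y : 'rV[R]_n) (h : 'I_tau).

Lemma refl_line h i (s : R) y :
  refl_ h (s *: e_ i + y) = (if i == b_ h then - s else s) *: e_ i + refl_ h y.
Proof.
apply/rowP => j; rewrite !mxE eqxx /=; have [->|ji] := eqVneq j i.
  by case: eqVneq => _; rewrite !mulr1 // opprD.
by rewrite !mulr0 !add0r.
Qed.

(** With [eps] equal to 1 or -1: even or odd in beta_h. *)
Definition parity (W : lmodType R) h (eps : R) (f : 'rV[R]_n -> W) :=
  forall y, D y -> f (refl_ h y) = eps *: f y.

Definition flip_sign h (i : 'I_n) : R := if i == b_ h then -1 else 1.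

(** The reflection reverses lines in direction beta_h and preserves the direction of all other
    coordinate lines, so exactly the derivative in beta_h changes the parity. *)
Lemma parity_pd (W : normedModType R) h eps (f : 'rV[R]_n -> W) i : smooth D f ->
  parity h eps f -> parity h (eps * flip_sign h i) (pd i f).
Proof.
move=> sf pf y Dy.
have y0 : 0 *: (flip_sign h i *: e_ i) + y = y by rewrite scale0r add0r.
have dv : is_derive y (flip_sign h i *: e_ i) f (flip_sign h i *: pd i f y).
  rewrite /flip_sign; case: ifP => _; last by rewrite !scale1r; apply: smooth_is_derive Dy.
  by rewrite !scaleN1r; apply: is_derive_oppv; apply: smooth_is_derive Dy.
rewrite -{1}y0 in dv.
have dl := is_deriveZ eps (is_derive_to_line dv).
have nD : nbhs (0 : R) (fun s : R => D (s *: (flip_sign h i *: e_ i) + y)).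
  by apply: near_line; rewrite y0; apply: open_nbhs_nbhs.
have ddl : is_derive (0 : R) 1 (fun s : R => f (s *: e_ i + refl_ h y))
    (eps *: (flip_sign h i *: pd i f y)).
  apply: near_eq_is_derive dl; apply: filterS nD => s Ds /=.
  rewrite -pf //; congr f.
  rewrite scalerA refl_line /flip_sign; case: eqVneq => _.
    by rewrite mulrN1 opprK.
  by rewrite mulr1.
have := is_derive_of_line ddl; rewrite scale0r add0r => -[_].
by rewrite /pd => ->; rewrite scalerA.
Qed.

Lemma parity_vanish (W : lmodType R) h (f : 'rV[R]_n -> W) : parity h (-1) f ->
  forall y, D y -> y 0 (b_ h) = 0 -> f y = 0.
Proof.
move=> pf y Dy yh; have := pf y Dy.
have -> : refl_ h y = y.
  by apply/rowP => j; rewrite mxE; case: eqVneq => // ->; rewrite yh oppr0.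
rewrite scaleN1r => /eqP; rewrite -addr_eq0 -mulr2n -scaler_nat scaler_eq0.
by rewrite pnatr_eq0 /= => /eqP.
Qed.

Lemma parity_quot m h k eps (f : 'rV[R]_n -> 'rV[R]_m) : smooth D f ->
  parity h eps f -> parity h (eps * flip_sign h (b_ k)) (quot (b_ k) f).
Proof.
move=> sf pf y Dy; rewrite /quot.
have -> : refl_ h y 0 (b_ k) = flip_sign h (b_ k) * y 0 (b_ k).
  by rewrite mxE /flip_sign; case: eqP; rewrite ?mulN1r ?mul1r.
have f0 : flip_sign h (b_ k) != 0.
  by rewrite /flip_sign; case: ifP => _; rewrite ?oppr_eq0 oner_eq0.
rewrite mulf_eq0 (negbTE f0) /=; case: eqVneq => yk.
  by rewrite (parity_pd _ sf pf).
rewrite pf // !scalerA; congr (_ *: _); rewrite invfM.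
have -> : (flip_sign h (b_ k))^-1 = flip_sign h (b_ k).
  by rewrite /flip_sign; case: eqP; rewrite ?invrN invr1.
by rewrite mulrC mulrA mulrAC.
Qed.

Lemma flip_sign_sqr h i : flip_sign h i * flip_sign h i = 1.
Proof. by rewrite /flip_sign; case: eqP; rewrite ?mulrNN mulr1. Qed.

Lemma parity0 (W : lmodType R) h eps : parity h eps (0 : 'rV[R]_n -> W).
Proof. by move=> y _; rewrite [RHS]scaler0. Qed.

Lemma parityD (W : lmodType R) h eps (f g : 'rV[R]_n -> W) :
  parity h eps f -> parity h eps g -> parity h eps (f + g).
Proof. by move=> pf pg y Dy; rewrite -[LHS]/(f (refl_ h y) + g (refl_ h y)) pf // pg // -scalerDr. Qed.

Lemma parityZ (W : lmodType R) h eps k (f : 'rV[R]_n -> W) :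
  parity h eps f -> parity h eps (k \*: f).
Proof. by move=> pf y Dy; rewrite /= pf // !scalerA mulrC. Qed.

Lemma parity_sum (W : lmodType R) h eps (I : Type) (r : seq I) (P : pred I)
    (f : I -> 'rV[R]_n -> W) :
  (forall i, P i -> parity h eps (f i)) -> parity h eps (\sum_(i <- r | P i) f i).
Proof.
move=> pf; apply: big_ind => //; first exact: parity0.
by move=> f1 f2; apply: parityD.
Qed.

End Parity.

(** * Operators on stem functions and the correction G *)

Section StemOperators.
Variables (R : realType) (A : falgType R) (t : nat -> nat) (tau : nat).
Variable (D : set 'rV[R]_((t 0).+1 + tau)).
Hypothesis oD : open D.
Local Notation n := ((t 0).+1 + tau)%N.
Local Notation b_ := (@betai t tau).
Implicit Types (F : {set 'I_tau} -> 'rV[R]_n -> A) (K : {set 'I_tau}) (h : 'I_tau).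

Definition sgn h K : R := if h \in K then -1 else 1.

Lemma stem_parity F : @stem R A t tau D F <->
  forall h K, parity D h (sgn h K) (@coordsA R A \o F K).
Proof.
split=> [sF h K y Dy|pF h K y Dy].
  by rewrite /= sF // /sgn; case: ifP => _; rewrite ?scaleN1r ?scale1r ?coordsAN.
apply: (can_inj (@coordsAK R A)).
have := pF h K y Dy; rewrite /= => ->; rewrite /sgn; case: ifP => _.
  by rewrite scaleN1r coordsAN.
by rewrite scale1r.
Qed.

Lemma coordsA_laplA m (g : 'rV[R]_m -> A) :
  @coordsA R A \o laplA g = \sum_i pd i (pd i (@coordsA R A \o g)).
Proof.
apply/funext => y; rewrite /= coordsA_bigsum fct_sumE; apply: eq_bigr => i _.
by rewrite -!coordsA_pdA.
Qed.

Lemma stem_lapl F : (forall K, smooth D (@coordsA R A \o F K)) -> @stem R A t tau D F ->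
  @stem R A t tau D (lapl_stem F).
Proof.
move=> sF /stem_parity pF; apply/stem_parity => h K; rewrite coordsA_laplA.
apply: parity_sum => i _.
have := parity_pd oD i (smooth_pd i (sF K)) (parity_pd oD i (sF K) (pF h K)).
by rewrite -mulrA flip_sign_sqr mulr1.
Qed.

Lemma stemD F G : @stem R A t tau D F -> @stem R A t tau D G ->
  @stem R A t tau D (fun K y => F K y + G K y).
Proof. by move=> sF sG h K y Dy; rewrite sF // sG //; case: ifP => // _; rewrite opprD. Qed.

Variable sigma : nat.

(** Dimension of the block minus one; [h] stands for the index h + 1 of the statement. *)
Definition block_coef h : R := (t h.+1)%:R - (t h)%:R - 1.

(* coordinates of the stem function G of the theorem: at [beta_h = 0] the quotients by
   [beta_h] take their limit values, and the two terms with [h \in K] combine into the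
   derivative of [F_K / beta_h] *)
Definition correction_coords F K : 'rV[R]_n -> 'rV[R]_(\dim {:A}) :=
  \sum_(h < tau | (h < sigma)%N) (block_coef h \*:
    (if h \in K then pd (b_ h) (quot (b_ h) (@coordsA R A \o F K))
     else quot (b_ h) (pd (b_ h) (@coordsA R A \o F K)))).

Definition correction F K y := fromcoords (correction_coords F K y).

Variable p : regularity.

Lemma coordsA_correction F K : @coordsA R A \o correction F K = correction_coords F K.
Proof. by apply/funext => y; rewrite /= fromcoordsK. Qed.

Lemma flip_sign_self h : flip_sign R h (b_ h) = -1.
Proof. by rewrite /flip_sign eqxx. Qed.

Lemma stem_vanish F h K y : @stem R A t tau D F -> D y -> y 0 (b_ h) = 0 -> h \in K ->
  F K y = 0.
Proof.
move=> /stem_parity pF Dy yh hK; apply: (can_inj (@coordsAK R A)); rewrite coordsA0.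
by have := pF h K; rewrite /sgn hK => /parity_vanish; apply.
Qed.

Lemma pd_stem_vanish F h K y : (forall K, smooth D (@coordsA R A \o F K)) ->
  @stem R A t tau D F -> D y -> y 0 (b_ h) = 0 -> h \notin K ->
  pd (b_ h) (@coordsA R A \o F K) y = 0.
Proof.
move=> sF /stem_parity pF Dy yh hK.
have := parity_pd oD (b_ h) (sF K) (pF h K).
by rewrite flip_sign_self /sgn (negbTE hK) mul1r => /parity_vanish; apply.
Qed.

(** Each term involves one division and one derivative in beta_k, so the parity changes twice and is
    that of F_K. The order of the two operations is such that the map being divided is odd in
    beta_k: F_K itself for k in K, its derivative otherwise. *)
Lemma correction_stem F : @stem_p R A p t tau D F -> @stem_p R A p t tau D (correction F).
Proof.
move=> [sF rF].
have smF K : smooth D (@coordsA R A \o F K) by apply: reg_smooth (rF K).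
have F0 h K : h \in K -> forall y, D y -> y 0 (b_ h) = 0 -> (@coordsA R A \o F K) y = 0.
  by move=> hK y Dy yh; rewrite /= (stem_vanish sF Dy yh hK) coordsA0.
have dF0 h K : h \notin K -> forall y, D y -> y 0 (b_ h) = 0 ->
    pd (b_ h) (@coordsA R A \o F K) y = 0.
  by move=> hK y Dy yh; apply: pd_stem_vanish.
split; last first.
  move=> K; rewrite /regA coordsA_correction; apply: reg_sum => // h _; apply: regZ => //.
  case: ifPn => hK.
    by apply: reg_pd; apply: reg_quot (rF K) => //; apply: F0.
  by apply: reg_quot (reg_pd _ (rF K)) => //; apply: dF0.
apply/stem_parity => h K; rewrite coordsA_correction.
move/stem_parity : (sF) => pF.
apply: parity_sum => k _; apply: parityZ; case: ifPn => kK.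
  have sq : smooth D (quot (b_ k) (@coordsA R A \o F K)).
    by apply: smooth_quot => //; apply: F0.
  have := parity_pd oD (b_ k) sq (parity_quot oD k (smF K) (pF h K)).
  by rewrite -mulrA flip_sign_sqr mulr1.
have := parity_quot oD k (smooth_pd (b_ k) (smF K)) (parity_pd oD (b_ k) (smF K) (pF h K)).
by rewrite -mulrA flip_sign_sqr mulr1.
Qed.

(** For h in K, the quotient rule applied to F_K / beta_h produces one term of each sum; for h not
    in K there is only a term of the first sum. *)
Lemma correctionE F : @stem_p R A p t tau D F ->
  forall y, D y -> \prod_(h < tau | (h < sigma)%N) y 0 (betai t h) != 0 ->
  forall K, correction F K y =
    \sum_(h < tau | (h < sigma)%N)
      (((t h.+1)%:R - (t h)%:R - 1) / y 0 (betai t h)) *: @pdA R A _ (betai t h) (F K) y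
    + \sum_(h < tau | (h < sigma)%N && (h \in K))
      ((1 + (t h)%:R - (t h.+1)%:R) / (y 0 (betai t h)) ^+ 2) *: F K y.
Proof.
move=> [sF rF] y Dy yh K.
have smF : smooth D (@coordsA R A \o F K) by apply: reg_smooth (rF K).
apply: (can_inj (@coordsAK R A)); rewrite fromcoordsK coordsAD !coordsA_bigsum.
rewrite [X in _ + X]big_mkcondr /= -big_split /= /correction_coords fct_sumE; apply: eq_bigr => h hs.
have {}yh : y 0 (b_ h) != 0.
  by move: yh; rewrite prodf_seq_neq0 => /allP/(_ h); rewrite mem_index_enum hs; apply.
have cp : coordsA (pdA (b_ h) (F K) y) = pd (b_ h) (@coordsA R A \o F K) y.
  by rewrite -coordsA_pdA.
rewrite /= coordsAZ cp; case: ifPn => hK; last first.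
  by rewrite addr0 /quot (negbTE yh) scalerA.
rewrite coordsAZ.
have dq : is_derive y (ev R (b_ h)) (quot (b_ h) (@coordsA R A \o F K))
    ((y 0 (b_ h))^-1 *: pd (b_ h) (@coordsA R A \o F K) y
      - (y 0 (b_ h)) ^- 2 *: coordsA (F K y)).
  pose q (z : 'rV[R]_n) : 'rV[R]_(\dim {:A}) := (z 0 (b_ h))^-1 *: coordsA (F K z).
  apply: (@near_eq_is_derive R _ _ q).
    apply: filterS (near_coord_neq0 yh) => z zh.
    by rewrite /quot (negbTE zh).
  have [df pf] := smooth_is_derive (b_ h) smF Dy.
  have dj j : is_derive y (ev R (b_ h)) (fun z => (z 0 (b_ h))^-1 * coordsA (F K z) 0 j)
     ((y 0 (b_ h))^-1 * pd (b_ h) (@coordsA R A \o F K) y 0 j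
        - (y 0 (b_ h)) ^- 2 * coordsA (F K y) 0 j).
    have d1 := is_derive_coordinate y (b_ h) (b_ h).
    have d2 := is_derive_inv yh d1; rewrite eqxx mulr1 in d2.
    have d3 : is_derive y (ev R (b_ h)) (fun z => coordsA (F K z) 0 j)
        (pd (b_ h) (@coordsA R A \o F K) y 0 j).
      rewrite /pd derive_mx // mxE.
      by apply: derivableP; move/derivable_mxP : df.
    apply: is_derive_eq (is_deriveM d2 d3) _.
    by rewrite /GRing.scale /= mulrN [X in _ - X]mulrC.
  have dz : derivable q y (ev R (b_ h)).
    apply/derivable_mxP => i j; rewrite ord1 (_ : (fun z => q z 0 j) =
        (fun z => (z 0 (b_ h))^-1 * coordsA (F K z) 0 j)); first by case: (dj j).
    by apply/funext => z; rewrite mxE.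
  split=> //; rewrite derive_mx //; apply/rowP => j; rewrite mxE.
  have comb (a b : R) (P Q : 'rV[R]_(\dim {:A})) :
    (a *: P - b *: Q) 0 j = a * P 0 j - b * Q 0 j by rewrite !mxE.
  rewrite comb (_ : (fun z => q z 0 j) =
        (fun z => (z 0 (b_ h))^-1 * coordsA (F K z) 0 j)); first by case: (dj j).
  by apply/funext => z; rewrite mxE.
rewrite [pd _ (quot _ _) y](@derive_val _ _ _ _ _ _ _ dq) /block_coef scalerBr !scalerA; congr (_ + _).
by rewrite -scaleNr; congr (_ *: _); rewrite -mulNr; congr (_ / _); ring.
Qed.

End StemOperators.

Lemma coordnE {R : realType} n (y : 'rV[R]_n) (i : 'I_n) : coordn y i = y 0 i.
Proof. by rewrite /coordn (big_pred1 i) // => j; rewrite /= -val_eqE. Qed.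

Lemma coordn_line {R : realType} n (y : 'rV[R]_n) (i : 'I_n) (s : R) k :
  coordn (s *: ev R i + y) k = (if val i == k then s else 0) + coordn y k.
Proof.
rewrite /coordn; under eq_bigr do rewrite !mxE eqxx /=.
rewrite big_split /=; congr (_ + _).
case: eqVneq => [<-|ik].
  by rewrite (big_pred1 i) ?eqxx ?mulr1 // => j; rewrite /= -val_eqE.
by apply: big1 => j /eqP jk; rewrite -val_eqE /= jk eq_sym (negbTE ik) mulr0.
Qed.

(** * Blocks of coordinates and the torus *)

Section Steps.
Variables (t : nat -> nat) (tau N : nat).
Hypothesis st : steps t tau N.

Lemma steps_le i j : (i <= j)%N -> (j <= tau)%N -> (t i <= t j)%N.
Proof.
elim: j => [|j IH]; first by rewrite leqn0 => /eqP ->.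
rewrite leq_eqVlt => /orP[/eqP -> //|ij] jt.
exact: leq_trans (IH ij (ltnW jt)) (ltnW (st.1 j jt)).
Qed.

Lemma steps_lt h : (h < tau)%N -> (t h < t h.+1)%N.
Proof. exact: st.1. Qed.

Lemma inblock_uniq h k s : (h < tau)%N -> (k < tau)%N ->
  inblock t h s -> inblock t k s -> h = k.
Proof.
move=> ht kt /andP[h1 h2] /andP[k1 k2].
have [hk|kh|//] := ltngtP h k.
  by have := leq_ltn_trans (leq_trans h2 (steps_le hk (ltnW kt))) k1; rewrite ltnn.
by have := leq_ltn_trans (leq_trans k2 (steps_le kh (ltnW ht))) h1; rewrite ltnn.
Qed.

Lemma block_or_mirror s k : (k <= tau)%N -> (s <= t k)%N ->
  (s <= t 0%N)%N \/ exists2 h, (h < k)%N & inblock t h s.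
Proof.
elim: k => [|k IH] kt sk; first by left.
have [sk'|ks] := leqP s (t k).
  by have [|[h hk hb]] := IH (ltnW kt) sk'; [left | right; exists h => //; rewrite ltnS ltnW].
by right; exists k => //; rewrite /inblock ks.
Qed.

Lemma inblock_gt0 h s : (h < tau)%N -> inblock t h s -> (t 0%N < s)%N.
Proof. by move=> ht /andP[hs _]; apply: leq_ltn_trans hs; apply: steps_le (ltnW ht). Qed.

Lemma inblock_le h s k : (h < k)%N -> (k <= tau)%N -> inblock t h s -> (s <= t k)%N.
Proof. by move=> hk kt /andP[_ /leq_trans]; apply; apply: steps_le. Qed.

End Steps.

(** * Independence of the presentation of a point *)

Section WellDefined.
Variables (R : realType) (A : falgType R) (t : nat -> nat) (tau N : nat).
Variables (v : 'I_N.+1 -> A) (D : set 'rV[R]_((t 0).+1 + tau)).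
Hypothesis st : steps t tau N.
Local Notation n := ((t 0).+1 + tau)%N.
Local Notation b_ := (@betai t tau).
Local Notation refl_ := (@refl R t tau).
Implicit Types (y z : 'rV[R]_n) (J : 'I_tau -> 'rV[R]_N.+1) (h : 'I_tau) (K : {set 'I_tau}).

Lemma pt_mirror y J (s : 'I_N.+1) : @torus R t tau N J -> (s <= t 0%N)%N ->
  pt y J 0 s = coordn y s.
Proof.
move=> tJ s0; rewrite mxE s0 big1 ?addr0 // => h _.
rewrite (tJ h).1 ?mulr0 //; apply/negP => /(inblock_gt0 st (ltn_ord h)).
by rewrite ltnNge s0.
Qed.

Lemma pt_block y J h (s : 'I_N.+1) : @torus R t tau N J -> inblock t h s ->
  pt y J 0 s = y 0 (b_ h) * J h 0 s.
Proof.
move=> tJ hs; have s0 := inblock_gt0 st (ltn_ord h) hs.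
rewrite mxE leqNgt s0 add0r (bigD1 h) //= big1 ?addr0 // => k kh.
rewrite (tJ k).1 ?mulr0 //; apply/negP => ks; case/negP: kh.
by apply/eqP/val_inj; exact: (inblock_uniq st (ltn_ord k) (ltn_ord h) ks hs).
Qed.

Lemma pt_inj_block y z J L : @torus R t tau N J -> @torus R t tau N L ->
  pt y J = pt z L -> forall h, y 0 (b_ h) *: J h = z 0 (b_ h) *: L h.
Proof.
move=> tJ tL E h; apply/rowP => s; rewrite !mxE.
have [hs|hs] := boolP (inblock t h s); last by rewrite (tJ h).1 // (tL h).1 // !mulr0.
by rewrite -(pt_block _ tJ hs) -(pt_block _ tL hs) E.
Qed.

Lemma eq_rows_stem y z : (forall a : 'I_(t 0).+1, y 0 (lshift tau a) = z 0 (lshift tau a)) ->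
  (forall h, y 0 (b_ h) = z 0 (b_ h)) -> y = z.
Proof.
move=> ya yb; apply/rowP => i; case: (split_ordP i) => [a ->|h ->]; first exact: ya.
exact: yb.
Qed.

(** Both sides are the squared length of the common block vector, because J_h and L_h have length
    1. *)
Lemma pt_inj_sqr y z J L : @torus R t tau N J -> @torus R t tau N L ->
  pt y J = pt z L -> forall h, y 0 (b_ h) ^+ 2 = z 0 (b_ h) ^+ 2.
Proof.
move=> tJ tL E h; have Eh := pt_inj_block tJ tL E h.
rewrite -[LHS]mulr1 -[RHS]mulr1 -{1}(tJ h).2 -(tL h).2 !mulr_sumr.
apply: eq_bigr => s _; rewrite -!exprMn; congr (_ ^+ 2).
by have := congr1 (fun w : 'rV[R]_N.+1 => w 0 s) Eh; rewrite !mxE.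
Qed.

Definition flips (l : seq 'I_tau) y := foldr refl_ y l.

Lemma flipsE l y i : uniq l ->
  flips l y 0 i = if i \in map b_ l then - y 0 i else y 0 i.
Proof.
elim: l i => [//|h l IH] i /= /andP[hl ul]; rewrite mxE in_cons.
case: eqVneq => [->|_] /=; last exact: IH.
rewrite -/(flips l y) (IH _ ul) ifF //; apply/negP => /mapP[k kl /rshift_inj hk].
by rewrite hk kl in hl.
Qed.

Lemma flips_stem S l y K : @refl_invariant R t tau D -> @stem R A t tau D S -> D y ->
  D (flips l y) /\ S K (flips l y) = (\prod_(h <- l) sgn R h K) *: S K y.
Proof.
move=> rD sS Dy; elim: l => [|h l [Dl Sl]] /=; first by rewrite big_nil scale1r.
split; first exact: rD.
rewrite sS // Sl big_cons /sgn -scalerA.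
by case: ifP => _; rewrite ?scaleN1r ?scale1r.
Qed.

(* two presentations of a point differ by reflections, except that [J_h] is arbitrary when
   [beta_h = 0]; but then [S_K] vanishes for all [K] containing [h] *)
Lemma stem_sum_eq S y z J L : @refl_invariant R t tau D -> @stem R A t tau D S ->
  D y -> D z -> @torus R t tau N J -> @torus R t tau N L -> pt y J = pt z L ->
  \sum_(K : {set 'I_tau}) JK v J K * S K y = \sum_(K : {set 'I_tau}) JK v L K * S K z.
Proof.
move=> rD sS Dy Dz tJ tL E; apply: eq_bigr => K _.
have [/existsP[h /andP[hK /eqP yh]]|] :=
  boolP [exists h, (h \in K) && (y 0 (b_ h) == 0)].
  have zh : z 0 (b_ h) = 0.
    by apply/eqP; rewrite -sqrf_eq0 -(pt_inj_sqr tJ tL E) yh expr0n.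
  by rewrite (stem_vanish sS Dy yh hK) (stem_vanish sS Dz zh hK) !mulr0.
rewrite negb_exists => /forallP y0.
pose E0 : {set 'I_tau} := finset (fun h => z 0 (b_ h) != y 0 (b_ h)).
have zN h : h \in E0 -> z 0 (b_ h) = - y 0 (b_ h).
  rewrite inE => zy; have := pt_inj_sqr tJ tL E h; move/eqP; rewrite eqf_sqr.
  by rewrite eq_sym (negbTE zy) /= => /eqP ->; rewrite opprK.
have zE : z = flips (enum E0) y.
  apply: eq_rows_stem => [a|h]; rewrite flipsE ?enum_uniq //.
    rewrite ifF; last by apply/negP => /mapP[k _ /eqP]; rewrite eq_lrshift.
    have aN : (a < N.+1)%N.
      apply: leq_trans (ltn_ord a) _; rewrite ltnS -st.2.
      exact: (steps_le st (leq0n tau)).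
    have a0 : (a <= t 0%N)%N by rewrite -ltnS; apply: (ltn_ord a).
    have Ez := @pt_mirror z L (Ordinal aN) tL a0.
    have Ey := @pt_mirror y J (Ordinal aN) tJ a0.
    have := Ez; rewrite -E Ey /=.
    by rewrite -[a : nat]/(lshift tau a : nat) !coordnE.
  rewrite mem_map ?mem_enum; last by move=> i j; apply: rshift_inj.
  have [hE|hE] := boolP (h \in E0); first exact: zN.
  by move: hE; rewrite inE negbK => /eqP.
have Sz : S K z = (\prod_(h <- enum E0) sgn R h K) *: S K y.
  by rewrite {1}zE; have [] := flips_stem (enum E0) K rD sS Dy.
have -> : JK v J K = \prod_(h < tau | h \in K) ((if h \in E0 then -1 else 1) *: toA v (L h)).
  apply: eq_bigr => h hK; have := pt_inj_block tJ tL E h.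
  have yh : y 0 (b_ h) != 0 by have := y0 h; rewrite hK.
  case: ifPn => hE.
    rewrite zN // scaleNr -scalerN => /(scalerI yh) ->.
    by rewrite /toA scaleN1r -sumrN; apply: eq_bigr => s _; rewrite mxE scaleNr.
  move: hE; rewrite inE negbK => /eqP -> /(scalerI yh) ->.
  by rewrite scale1r.
rewrite scaler_prod -/(JK v L K) Sz.
rewrite -scalerAl -scalerAr; congr (_ *: _).
rewrite big_enum /= big_mkcond [RHS]big_mkcond /=; apply: eq_bigr => h _.
by rewrite /sgn; do 2 case: ifP.
Qed.

End WellDefined.

(** * From presentations for T_sigma to presentations for T *)

Section Projection.
Variables (R : realType) (t : nat -> nat) (tau sigma N : nat).
Hypotheses (st : steps t tau N) (s_tau : (sigma <= tau)%N).
Local Notation n := ((t 0).+1 + tau)%N.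
Local Notation n' := ((t sigma).+1 + (tau - sigma))%N.
Local Notation b_ := (@betai t tau).
Local Notation proj := (@projsig R t tau sigma).
Implicit Types (w : 'rV[R]_n') (L : 'I_(tau - sigma) -> 'rV[R]_N.+1) (h : 'I_tau).

Lemma inblock_tsig k s : inblock (tsig t sigma) k s = inblock t (k + sigma)%N s.
Proof. by []. Qed.

Lemma steps_tsig : steps (tsig t sigma) (tau - sigma) N.
Proof.
split=> [h hs|]; last by rewrite -st.2 -[LHS]/(t (tau - sigma + sigma)%N) subnK.
by apply: (st.1 (h + sigma)%N); rewrite addnC -ltn_subRL.
Qed.

Definition blocknorm w k := Num.sqrt (\sum_(s < (t sigma).+1 | inblock t k s) coordn w s ^+ 2).

Lemma projsig_mirror w (a : 'I_(t 0).+1) : proj w 0 (lshift tau a) = coordn w a.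
Proof.
rewrite mxE /= ifT //; rewrite -ltnS; exact: (ltn_ord a).
Qed.

Lemma projsig_block w h : (h < sigma)%N -> proj w 0 (b_ h) = blocknorm w h.
Proof.
move=> hs; rewrite mxE /= -[(t 0).+1]/((t 0%N).+1) ifF; last by rewrite leqNgt leq_addr.
by rewrite addKn hs.
Qed.

Lemma projsig_tail w h : (sigma <= h)%N ->
  proj w 0 (b_ h) = coordn w ((t sigma).+1 + (h - sigma)).
Proof.
move=> hs; rewrite mxE /= -[(t 0).+1]/((t 0%N).+1) ifF; last by rewrite leqNgt leq_addr.
by rewrite addKn ltnNge hs.
Qed.

Lemma blocknorm_ge0 w k : 0 <= blocknorm w k.
Proof. exact: sqrtr_ge0. Qed.

Lemma blocknorm_sqr w k :
  blocknorm w k ^+ 2 = \sum_(s < (t sigma).+1 | inblock t k s) coordn w s ^+ 2.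
Proof. by rewrite sqr_sqrtr // sumr_ge0 // => s _; rewrite sqr_ge0. Qed.

Lemma blocknorm_eq0 w h (s : nat) : (h < sigma)%N -> blocknorm w h = 0 -> inblock t h s ->
  coordn w s = 0.
Proof.
move=> hs w0 bs; have ss : (s < (t sigma).+1)%N by rewrite ltnS; exact: (inblock_le st hs s_tau bs).
have := blocknorm_sqr w h; rewrite w0 expr0n /= => /esym/eqP.
rewrite psumr_eq0 => [|i _]; last exact: sqr_ge0.
move=> /allP/(_ (Ordinal ss)); rewrite mem_index_enum /= bs /= sqrf_eq0.
by move=> /(_ isT)/eqP.
Qed.

Lemma eq_blocknorm w z h : (forall s, inblock t h s -> coordn w s = coordn z s) ->
  blocknorm w h = blocknorm z h.
Proof. by move=> wz; congr Num.sqrt; apply: eq_bigr => s /wz ->. Qed.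

(* the unit vectors x^h / |x^h|, with an arbitrary choice where x^h = 0 *)
Definition dirs w L h : 'rV[R]_N.+1 :=
  if (h < sigma)%N then
    if blocknorm w h == 0 then ev R (inord (t h).+1)
    else \row_s (if inblock t h s then coordn w s / blocknorm w h else 0)
  else oapp L 0 (insub (h - sigma)%N).

Lemma eq_dirs w z L h : (forall s, inblock t h s -> coordn w s = coordn z s) ->
  dirs w L h = dirs z L h.
Proof.
move=> wz; rewrite /dirs (eq_blocknorm wz); case: ifP => // _; case: ifP => // _.
by apply/rowP => s; rewrite !mxE; case: ifP => // /wz ->.
Qed.

Lemma t_le_N k : (k <= tau)%N -> (t k <= N)%N.
Proof. by move=> kt; rewrite -st.2; apply: (steps_le st kt). Qed.

Lemma dirs_degenerate h (s : 'I_N.+1) :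
  (ev R (inord (t h).+1) : 'rV[R]_N.+1) 0 s = ((s : nat) == (t h).+1)%:R.
Proof.
have hN : ((t h).+1 < N.+1)%N.
  by rewrite ltnS; apply: leq_trans (steps_lt st (ltn_ord h)) (t_le_N (ltn_ord h)).
by rewrite evE -val_eqE /= inordK.
Qed.

Lemma dirs_block w L h (s : 'I_N.+1) : (h < sigma)%N -> inblock t h s ->
  blocknorm w h * dirs w L h 0 s = coordn w s.
Proof.
move=> hs bs; rewrite /dirs hs; case: eqVneq => w0.
  by rewrite w0 mul0r (blocknorm_eq0 hs w0 bs).
by rewrite mxE bs mulrC divfK.
Qed.

Lemma dirs_tail w L h (hs : (h - sigma < tau - sigma)%N) : (sigma <= h)%N ->
  dirs w L h = L (Ordinal hs).
Proof. by move=> sh; rewrite /dirs ltnNge sh /= insubT. Qed.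

Lemma inblock_first h : inblock t h (t h).+1.
Proof. by rewrite /inblock leqnn; apply: (steps_lt st). Qed.

Lemma sum_block_widen (f : nat -> R) h : (h < sigma)%N ->
  \sum_(s < N.+1 | inblock t h s) f s = \sum_(s < (t sigma).+1 | inblock t h s) f s.
Proof.
move=> hs; have sN : ((t sigma).+1 <= N.+1)%N by rewrite ltnS t_le_N.
rewrite (big_ord_widen_cond _ (fun s => inblock t h s) f sN).
apply: eq_bigl => s; have [bs|//] := boolP (inblock t h s).
by rewrite /= ltnS (inblock_le st hs s_tau bs).
Qed.

Lemma torus_dirs w L : @torus R (tsig t sigma) (tau - sigma) N L ->
  @torus R t tau N (dirs w L).
Proof.
move=> tL h; have [hs|sh] := ltnP h sigma; last first.
  have hs : (h - sigma < tau - sigma)%N by rewrite ltn_sub2r // (leq_ltn_trans sh).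
  rewrite (dirs_tail w L hs sh); have [L0 L1] := tL (Ordinal hs).
  have bE s : inblock (tsig t sigma) (Ordinal hs) s = inblock t h s.
    by rewrite inblock_tsig /= subnK.
  split; first by move=> s bs; apply: L0; rewrite bE.
  by rewrite -[RHS]L1; apply: eq_bigl => s; rewrite bE.
rewrite /dirs hs; case: eqVneq => w0.
  have hb := inblock_first h; split.
    move=> s bs; rewrite dirs_degenerate; case: eqP => // sE.
    by rewrite sE hb in bs.
  have hN : ((t h).+1 < N.+1)%N.
    by rewrite ltnS; apply: leq_trans (steps_lt st (ltn_ord h)) (t_le_N (ltn_ord h)).
  rewrite (bigD1 (Ordinal hN)) //= dirs_degenerate eqxx expr1n big1 ?addr0 //.
  move=> s /andP[_ sE]; rewrite dirs_degenerate.
  by rewrite -val_eqE /= in sE; rewrite (negbTE sE) expr0n.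
split; first by move=> s /negbTE bs; rewrite mxE bs.
under eq_bigr => s bs do rewrite mxE bs expr_div_n.
rewrite -mulr_suml (sum_block_widen (fun s => coordn w s ^+ 2) hs) -blocknorm_sqr mulfV //.
by rewrite expf_neq0.
Qed.

(** The link between the two stem structures: a point presented for T_sigma is also presented for T,
    and there the values of [f] through [F] and through [H] can be compared. *)
Lemma pt_dirs w L : @torus R (tsig t sigma) (tau - sigma) N L ->
  pt (proj w) (dirs w L) = @pt R (tsig t sigma) (tau - sigma) N w L.
Proof.
move=> tL; have tD := torus_dirs w tL; apply/rowP => s.
have sN : (s <= t tau)%N by rewrite st.2 -ltnS.
have [s0|[k kt ks]] := block_or_mirror (leqnn tau) sN.
  rewrite (pt_mirror st _ tD s0).
  have s0' : (s <= tsig t sigma 0%N)%N by apply: leq_trans s0 _; apply: (steps_le st (leq0n _)).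
  rewrite (pt_mirror steps_tsig _ tL s0').
  have -> : (s : nat) = Ordinal (s0 : (s < (t 0%N).+1)%N) by [].
  by rewrite -projsig_mirror -coordnE.
pose h := Ordinal kt; rewrite (pt_block st _ tD (h := h) ks).
have [hs|sh] := ltnP k sigma.
  rewrite projsig_block // dirs_block //.
  have sS : (s <= tsig t sigma 0%N)%N by apply: (inblock_le st hs s_tau ks).
  by rewrite (pt_mirror steps_tsig _ tL sS).
have hs : (h - sigma < tau - sigma)%N by rewrite ltn_sub2r // (leq_ltn_trans sh).
rewrite (dirs_tail w L hs sh) projsig_tail //.
have ks' : inblock (tsig t sigma) (Ordinal hs) s by rewrite inblock_tsig /= subnK.
rewrite (pt_block steps_tsig _ tL ks'); congr (_ * _).
have := coordnE w (betai (tsig t sigma) (Ordinal hs)).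
by rewrite /=.
Qed.

Lemma continuous_coordn m k : continuous (fun w : 'rV[R]_m => coordn w k).
Proof.
move=> x; rewrite /coordn.
have -> : (fun w : 'rV[R]_m => \sum_(i < m | val i == k) w 0 i) =
   \sum_(i < m | val i == k) (fun w : 'rV[R]_m => w 0 i).
  by apply/funext => w; rewrite fct_sumE.
apply: (big_ind (fun g : 'rV[R]_m -> R => {for x, continuous g})).
- exact: cst_continuous.
- by move=> f g cf cg; apply: continuousD.
- by move=> i _; apply: coord_continuous.
Qed.

Lemma continuous_blocknorm k : continuous (fun w => blocknorm w k).
Proof.
move=> x; apply: (@continuous_comp _ _ _
  (fun w => \sum_(s < (t sigma).+1 | inblock t k s) coordn w s ^+ 2) (@Num.sqrt R));
  last exact: sqrt_continuous.
have -> : (fun w => \sum_(s < (t sigma).+1 | inblock t k s) coordn w s ^+ 2) =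
   \sum_(s < (t sigma).+1 | inblock t k s) (fun w => coordn w s * coordn w s).
  by apply/funext => w; rewrite fct_sumE.
apply: (big_ind (fun g : 'rV[R]_n' -> R => {for x, continuous g})).
- exact: cst_continuous.
- by move=> f g cf cg; apply: continuousD.
- by move=> i _; apply: continuousM; apply: continuous_coordn.
Qed.

Lemma continuous_projsig : continuous proj.
Proof.
move=> x; apply: continuous_rV => j.
have sub (f : 'rV[R]_n' -> R) : continuous f -> (forall w, f w = proj w 0 j) ->
    {for x, continuous (fun w => proj w 0 j)}.
  by move=> cf /funext fE; rewrite -fE; exact: cf.
case: (split_ordP j) sub => [a ->|h ->] sub.
  by apply: sub (@continuous_coordn _ a) _ => w; rewrite projsig_mirror.
have [hs|sh] := ltnP h sigma.
  by apply: sub (@continuous_blocknorm h) _ => w; rewrite (projsig_block _ hs).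
by apply: sub (@continuous_coordn _ _) _ => w; rewrite (projsig_tail _ sh).
Qed.

Lemma open_Dsig (D : set 'rV[R]_n) : open D -> open (@Dsig R t tau sigma D).
Proof. by move=> oD; apply: open_comp => // x _; apply: continuous_projsig. Qed.

End Projection.

Lemma has_der2_eq {R : realType} (f : R -> R) x a b a' b' :
  has_der2 f x a b -> a = a' -> b = b' -> has_der2 f x a' b'.
Proof. by move=> hf <- <-. Qed.

(** * Linearity of J_K in one of its factors *)

Section TorusProducts.
Variables (R : realType) (A : falgType R) (N tau : nat) (v : 'I_N.+1 -> A).
Implicit Types (J : 'I_tau -> 'rV[R]_N.+1) (h : 'I_tau) (K : {set 'I_tau}).

Definition upd J h (u : 'rV[R]_N.+1) : 'I_tau -> 'rV[R]_N.+1 :=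
  fun k => if k == h then u else J k.

Lemma upd_id J h : upd J h (J h) = J.
Proof. by apply/funext => k; rewrite /upd; case: eqVneq => // ->. Qed.

Lemma JK_upd_notin J h u K : h \notin K -> JK v (upd J h u) K = JK v J K.
Proof.
move=> hK; apply: eq_bigr => k kK; rewrite /upd ifF //.
by apply: contraNF hK => /eqP <-.
Qed.

(** [A] need not be commutative: the ordered product is cut at the only occurrence of [h], which
    leaves a factor on each side of the new vector. *)
Lemma JK_upd_in J h K : h \in K ->
  exists a b, forall u, JK v (upd J h u) K = a * toA v u * b.
Proof.
move=> hK; rewrite /JK.
move: (mem_index_enum h) (index_enum_uniq 'I_tau).
case/splitPr: (index_enum _) / => p1 p2.
rewrite cat_uniq /= negb_or => /and3P[_ /andP[hp1 _] /andP[hp2 _]].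
exists (\prod_(k <- p1 | k \in K) toA v (J k)), (\prod_(k <- p2 | k \in K) toA v (J k)) => u.
rewrite big_cat big_cons hK /= {2}/upd eqxx mulrA; congr (_ * _ * _).
  rewrite big_seq_cond [RHS]big_seq_cond; apply: eq_bigr => k /andP[kp _].
  by rewrite /upd ifF //; apply: contraNF hp1 => /eqP <-.
rewrite big_seq_cond [RHS]big_seq_cond; apply: eq_bigr => k /andP[kp _].
by rewrite /upd ifF //; apply: contraNF hp2 => /eqP <-.
Qed.

Lemma toA_linear k (u u' : 'rV[R]_N.+1) : toA v (k *: u + u') = k *: toA v u + toA v u'.
Proof.
rewrite /toA scaler_sumr -big_split /=; apply: eq_bigr => s _.
by rewrite !mxE scalerDl scalerA.
Qed.

Lemma JK_upd_linear J h K k u u' : h \in K ->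
  JK v (upd J h (k *: u + u')) K = k *: JK v (upd J h u) K + JK v (upd J h u') K.
Proof.
move=> hK; have [a [b E]] := JK_upd_in J hK.
by rewrite !E toA_linear mulrDr mulrDl -scalerAr -scalerAl.
Qed.

End TorusProducts.

(** * Block norms and unit vectors along coordinate lines *)

Section Lines.
Variables (R : realType) (t : nat -> nat) (tau sigma N : nat).
Hypotheses (st : steps t tau N) (s_tau : (sigma <= tau)%N).
Local Notation n := ((t 0).+1 + tau)%N.
Local Notation n' := ((t sigma).+1 + (tau - sigma))%N.
Local Notation b_ := (@betai t tau).
Local Notation e_ := (ev R).
Local Notation proj := (@projsig R t tau sigma).
Implicit Types (w : 'rV[R]_n') (L : 'I_(tau - sigma) -> 'rV[R]_N.+1) (h : 'I_tau).
Implicit Types (a : 'I_(t sigma).+1) (j : 'I_(tau - sigma)) (s : R).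

Definition mir a : 'I_n' := lshift (tau - sigma) a.
Definition tail j : 'I_n' := rshift (t sigma).+1 j.

Lemma tail_lt j : (j + sigma < tau)%N.
Proof. by rewrite addnC -ltn_subRL. Qed.

Definition up_ord j : 'I_tau := Ordinal (tail_lt j).

Lemma coordn_mir w a s k : coordn (s *: e_ (mir a) + w) k = (if (a : nat) == k then s else 0) + coordn w k.
Proof. exact: coordn_line. Qed.

Lemma coordn_tail w j s k :
  coordn (s *: e_ (tail j) + w) k = (if ((t sigma).+1 + j)%N == k then s else 0) + coordn w k.
Proof. exact: coordn_line. Qed.

Lemma inblock_le_sigma h k : (h < sigma)%N -> inblock t h k -> (k <= t sigma)%N.
Proof. by move=> hs; exact: (inblock_le st hs s_tau). Qed.

Lemma dirs_line_const w L i s : (forall h, (h < sigma)%N -> ~~ inblock t h (i : 'I_n')) ->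
  dirs (s *: e_ i + w) L = dirs w L.
Proof.
move=> ib; apply/funext => h; have [hs|sh] := ltnP h sigma; last first.
  by rewrite /dirs ltnNge sh.
apply: eq_dirs => k hk; rewrite coordn_line ifF ?add0r //.
by apply: contraTF hk => /eqP <-; apply: ib.
Qed.

Lemma blocknorm_line_const w i s h : ~~ inblock t h (i : 'I_n') ->
  blocknorm (s *: e_ i + w) h = blocknorm w h.
Proof.
move=> ib; apply: eq_blocknorm => k hk; rewrite coordn_line ifF ?add0r //.
by apply: contraTF hk => /eqP <-.
Qed.

Lemma projsig_line_mirror w a s : (a <= t 0%N)%N ->
  proj (s *: e_ (mir a) + w) = s *: e_ (lshift tau (inord a)) + proj w.
Proof.
move=> a0; apply: eq_rows_stem => [b|h]; rewrite [RHS]mxE [X in _ = X + _]mxE evE.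
  rewrite !projsig_mirror coordn_mir; congr (_ + _).
  rewrite (inj_eq (@lshift_inj _ _)) -val_eqE /= inordK ?ltnS // eq_sym.
  by case: eqP; rewrite ?mulr1 ?mulr0.
rewrite eq_rlshift mulr0 add0r; have [hs|sh] := ltnP h sigma.
  rewrite !projsig_block // blocknorm_line_const //.
  by apply/negP => /(inblock_gt0 st (ltn_ord h)); rewrite ltnNge a0.
rewrite !projsig_tail // coordn_mir ifF ?add0r //.
by apply/negP => /eqP E; have := ltn_ord a; rewrite E ltnNge leq_addr.
Qed.

Lemma projsig_line_tail w j s :
  proj (s *: e_ (tail j) + w) = s *: e_ (b_ (up_ord j)) + proj w.
Proof.
apply: eq_rows_stem => [b|h]; rewrite [RHS]mxE [X in _ = X + _]mxE evE.
  rewrite !projsig_mirror coordn_tail eq_lrshift mulr0 ifF //.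
  apply/negP => /eqP E; have := ltn_ord b; rewrite -E ltnNge.
  by rewrite (leq_trans _ (leq_addr _ _)) // ltnS (steps_le st).
rewrite (inj_eq (@rshift_inj _ _)) -val_eqE /=; have [hs|sh] := ltnP h sigma.
  rewrite !projsig_block // blocknorm_line_const //.
    by rewrite ltn_eqF ?mulr0 ?add0r // (leq_trans hs) // leq_addl.
  by apply/negP => /(inblock_le_sigma hs) /=; rewrite leqNgt ltnS leq_addr.
rewrite !projsig_tail // coordn_tail eqn_add2l; congr (_ + _).
by rewrite -(eqn_add2r sigma) subnK // eq_sym; case: eqP; rewrite ?mulr1 ?mulr0.
Qed.

Lemma projsig_line_block w a s h : (h < sigma)%N -> inblock t h a ->
  proj (s *: e_ (mir a) + w) =
  (blocknorm (s *: e_ (mir a) + w) h - blocknorm w h) *: e_ (b_ h) + proj w.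
Proof.
move=> hs ha; apply: eq_rows_stem => [b|k]; rewrite [RHS]mxE [X in _ = X + _]mxE evE.
  rewrite !projsig_mirror coordn_mir eq_lrshift mulr0 ifF //.
  apply/negP => /eqP E; have := inblock_gt0 st (ltn_ord h) ha.
  by rewrite E ltnNge -ltnS (ltn_ord b).
rewrite (inj_eq (@rshift_inj _ _)); have [->|kh] := eqVneq k h.
  by rewrite mulr1 !projsig_block // subrK.
rewrite mulr0 add0r; have [ks|sk] := ltnP k sigma.
  rewrite !projsig_block // blocknorm_line_const //; apply: contra kh => ka.
  by apply/eqP/val_inj; exact: (inblock_uniq st (ltn_ord k) (ltn_ord h) ka ha).
rewrite !projsig_tail // coordn_mir ifF ?add0r //.
by apply/negP => /eqP E; have := ltn_ord a; rewrite E ltnNge leq_addr.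
Qed.

Lemma blocknorm_line w a s h : inblock t h a ->
  blocknorm (s *: e_ (mir a) + w) h =
  Num.sqrt (blocknorm w h ^+ 2 + 2 * coordn w a * s + s * s).
Proof.
move=> ha; rewrite blocknorm_sqr /blocknorm; congr Num.sqrt.
rewrite (bigD1 a) //= [in RHS](bigD1 a) //= coordn_mir eqxx.
rewrite (eq_bigr (fun i : 'I_(t sigma).+1 => coordn w i ^+ 2)); last first.
  move=> i /andP[_ ia]; rewrite coordn_mir ifF ?add0r //.
  by rewrite eq_sym; apply/negbTE.
by ring.
Qed.

Lemma has_der2_blocknorm w a h : inblock t h a -> blocknorm w h != 0 ->
  has_der2 (fun s => blocknorm (s *: e_ (mir a) + w) h) 0 (coordn w a / blocknorm w h)
    ((blocknorm w h)^-1 - coordn w a ^+ 2 / blocknorm w h ^+ 3).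
Proof.
move=> ha w0; set r := blocknorm w h in w0 *; set x := coordn w a.
have r0 : 0 < r by rewrite lt_neqAle eq_sym w0 blocknorm_ge0.
under eq_fun do rewrite blocknorm_line // -/r -/x.
have h0 := has_der2_id (0 : R).
have h1 := has_der2D (has_der2D (has_der2_cst (r ^+ 2) 0) (has_der2Z (2 * x) h0)) (has_der2M h0 h0).
have e0 : r ^+ 2 + 2 * x * 0 + 0 * 0 = r ^+ 2 by ring.
have h2 : 0 < r ^+ 2 + 2 * x * 0 + 0 * 0 by rewrite e0 exprn_gt0.
have := @has_der2_comp R (@Num.sqrt R) (fun s => r ^+ 2 + 2 * x * s + s * s) 0 _ _ _ _
  (has_der2_sqrt h2) h1; rewrite e0 sqrtr_sqr gtr0_norm //.
move=> h3; by apply: (has_der2_eq h3); field.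
Qed.

Lemma near_blocknorm w i h : blocknorm w h != 0 ->
  nbhs (0 : R) (fun s : R => blocknorm (s *: e_ i + w) h != 0).
Proof.
move=> w0; apply: (@near_line _ _ w (e_ i) 0 (fun z => blocknorm z h != 0)); rewrite scale0r add0r.
have cb : {for w, continuous (fun z => blocknorm z h)} by apply: continuous_blocknorm.
by apply: (cb (fun r => r != 0)); apply: open_nbhs_nbhs; split=> //; exact: open_neq.
Qed.

(** The moved unit vector is expressed by the fixed vectors [e_ (inord a)] and [dirs w L h] with
    scalar coefficients, the form to which linearity of J_K applies in [coord_term_block]. *)
Lemma dirs_line_block w L a s h : (h < sigma)%N -> inblock t h a -> blocknorm w h != 0 ->
  blocknorm (s *: e_ (mir a) + w) h != 0 ->
  dirs (s *: e_ (mir a) + w) L = upd (dirs w L) h ((blocknorm (s *: e_ (mir a) + w) h)^-1 *: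
    (s *: e_ (inord a) + blocknorm w h *: dirs w L h)).
Proof.
move=> hs ha w0 ws0; apply/funext => k; rewrite /upd; case: eqVneq => [->|kh]; last first.
  have [ks|sk] := ltnP k sigma; last by rewrite /dirs ltnNge sk.
  apply: eq_dirs => l kl; rewrite coordn_mir ifF ?add0r //.
  apply: contraTF kl => /eqP <-; apply: contra kh => ka.
  by apply/eqP/val_inj; exact: (inblock_uniq st (ltn_ord k) (ltn_ord h) ka ha).
rewrite /dirs hs (negbTE w0) (negbTE ws0); apply/rowP => l.
rewrite !mxE eqxx /= coordn_mir.
have aN : (a < N.+1)%N.
  by rewrite ltnS; apply: leq_trans (inblock_le_sigma hs ha) (t_le_N st s_tau).
rewrite -val_eqE /= inordK // eq_sym.
case: ifPn => lh.
  by rewrite [in RHS](mulrC (blocknorm w h)) divfK // mulrC; case: eqP; rewrite ?mulr1 ?mulr0.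
have al : ((a : nat) == l) = false by apply: contraNF lh => /eqP <-.
have la : ((l : nat) == a) = false by rewrite eq_sym.
by rewrite ?al ?la !(mulr0, addr0).
Qed.

Lemma sum_dirs w L h : (h < sigma)%N -> blocknorm w h != 0 ->
  blocknorm w h *: dirs w L h = \sum_(a : 'I_(t sigma).+1 | inblock t h a) coordn w a *: e_ (inord a).
Proof.
move=> hs w0; apply/rowP => l; rewrite summxE mxE.
have aN (a : 'I_(t sigma).+1) : (a < N.+1)%N.
  by apply: leq_trans (ltn_ord a) _; rewrite ltnS (t_le_N st s_tau).
have [lh|lh] := boolP (inblock t h l); last first.
  rewrite /dirs hs (negbTE w0) mxE (negbTE lh) mulr0 big1 // => a ah.
  rewrite mxE evE -val_eqE /= inordK // (_ : ((l : nat) == a) = false) ?mulr0 //.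
  by apply: contraNF lh => /eqP ->.
rewrite (dirs_block st s_tau) //.
have ls : (l < (t sigma).+1)%N by rewrite ltnS (inblock_le_sigma hs lh).
rewrite (bigD1 (Ordinal ls)) //= mxE evE -val_eqE /= inordK ?ltn_ord // eqxx mulr1.
rewrite big1 ?addr0 // => a /andP[_ al]; rewrite mxE evE -val_eqE /= inordK //.
by rewrite -val_eqE /= eq_sym in al; rewrite (negbTE al) mulr0.
Qed.

Lemma card_block h : (h < sigma)%N ->
  \sum_(a : 'I_(t sigma).+1 | inblock t h a) (1 : R) = (t h.+1)%:R - (t h)%:R.
Proof.
move=> hs; have hts : ((t h.+1).+1 <= (t sigma).+1)%N by rewrite ltnS (steps_le st).
have -> : \sum_(a : 'I_(t sigma).+1 | inblock t h a) (1 : R) =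
    \sum_(a < (t h.+1).+1 | (t h < a)%N) (1 : R).
  rewrite (big_ord_widen_cond _ (fun i => (t h < i)%N) (fun=> 1) hts).
  by apply: eq_bigl => a; rewrite ltnS.
rewrite -(big_geq_mkord _ _ predT (fun=> 1)) sumr_const_nat subSS natrB //.
by rewrite ltnW // (steps_lt st).
Qed.

End Lines.

Lemma has_der2_div_id {R : realType} (f : R -> R) x a b : x != 0 -> has_der2 f x a b ->
  has_der2 (fun s => f s * s^-1) x (a / x - f x / x ^+ 2)
    (b / x - 2 * a / x ^+ 2 + 2 * f x / x ^+ 3).
Proof.
move=> x0 hf; have H := has_der2M hf (has_der2_inv x0).
by apply: (has_der2_eq H); field.
Qed.

(** * The Laplacian at points with nonzero blocks *)

Section BlockAlgebra.
Variables (R : fieldType) (r : R).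
Hypothesis r0 : r != 0.

(** Arranged so that summation over a block uses only that the x_a^2 add up to r^2 and the units to
    the dimension. *)
Lemma block_term_notin (x d1 d2 : R) :
  d2 * (x / r) ^+ 2 + d1 * (r^-1 - x ^+ 2 / r ^+ 3) =
  (d2 / r ^+ 2 - d1 / r ^+ 3) * x ^+ 2 + d1 / r * 1.
Proof. by field. Qed.

Lemma block_sum_notin (c d1 d2 : R) :
  (d2 / r ^+ 2 - d1 / r ^+ 3) * r ^+ 2 + d1 / r * c = d2 + (c - 1) / r * d1 + 0.
Proof. by field. Qed.

(** [u0] and [u1] are values with J_h replaced by a basis vector; they are grouped with x because
    the sum of the x_a e_a is r J_h. *)
Lemma block_term_in (x q1 q2 u0 u1 : R) :
  r * (q2 * (x / r) ^+ 2 + q1 * (r^-1 - x ^+ 2 / r ^+ 3)) +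
    2 * (u1 / r - u0 / r ^+ 2) * (x / r) =
  (q2 / r - q1 / r ^+ 2) * x ^+ 2 + q1 * 1 + (2 / r ^+ 2 * (x * u1) - 2 / r ^+ 3 * (x * u0)).
Proof. by field. Qed.

Lemma block_sum_in (m k d0 d1 d2 : R) :
  let q1 := d1 / r - d0 / r ^+ 2 in
  let q2 := d2 / r - 2 * d1 / r ^+ 2 + 2 * d0 / r ^+ 3 in
  (q2 / r - q1 / r ^+ 2) * r ^+ 2 + q1 * (m - k) +
    (2 / r ^+ 2 * (r * d1) - 2 / r ^+ 3 * (r * d0)) =
  d2 + (m - k - 1) / r * d1 + (1 + k - m) / r ^+ 2 * d0.
Proof. by move=> q1 q2; rewrite /q1 /q2; field. Qed.

End BlockAlgebra.

Section GenericPoint.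
Variables (R : realType) (A : falgType R) (t : nat -> nat) (tau sigma N : nat).
Variables (v : 'I_N.+1 -> A) (D : set 'rV[R]_((t 0).+1 + tau)).
Variable (F : {set 'I_tau} -> 'rV[R]_((t 0).+1 + tau) -> A).
Hypotheses (st : steps t tau N) (s_tau : (sigma <= tau)%N) (oD : open D).
Hypothesis sF : forall K, smoothA D (F K).
Local Notation n := ((t 0).+1 + tau)%N.
Local Notation n' := ((t sigma).+1 + (tau - sigma))%N.
Local Notation b_ := (@betai t tau).
Local Notation e_ := (ev R).
Local Notation proj := (@projsig R t tau sigma).
Local Notation mir := (@mir t tau sigma).
Local Notation tail := (@tail t tau sigma).
Variables (w : 'rV[R]_n') (L : 'I_(tau - sigma) -> 'rV[R]_N.+1).
Hypothesis Dw : D (proj w).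
Hypothesis gen : forall h : 'I_tau, (h < sigma)%N -> blocknorm w h != 0.
Variable mu : A -> R.
Hypothesis lin_mu : functional mu.
Implicit Types (h : 'I_tau) (K : {set 'I_tau}) (a : 'I_(t sigma).+1).
Local Notation z := (proj w).
Local Notation J := (dirs w L).
Local Notation r_ h := (blocknorm w h).
Local Notation x_ a := (coordn w a).

Definition dir_coef K (P : A) := mu (JK v J K * P).
Definition unit_coef h K a (P : A) := mu (JK v (upd J h (e_ (inord a))) K * P).
Definition second_coef K i := dir_coef K (pdA i (pdA i (F K)) z).

(* second derivative at [w] along the coordinate [a] of the block [h] of [J_K F_K], where
   [J_K F_K] depends on [x^h] through [|x^h|] only if [h \notin K], and is linear in [x^h]
   times a function of [|x^h|] if [h \in K] *)
Definition block_second h K a : R :=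
  let r := r_ h in let x := x_ a in
  let P0 := F K z in let P1 := pdA (b_ h) (F K) z in let P2 := pdA (b_ h) (pdA (b_ h) (F K)) z in
  if h \in K then
    r * ((dir_coef K P2 / r - 2 * dir_coef K P1 / r ^+ 2 + 2 * dir_coef K P0 / r ^+ 3) * (x / r) ^+ 2
         + (dir_coef K P1 / r - dir_coef K P0 / r ^+ 2) * (r^-1 - x ^+ 2 / r ^+ 3))
    + 2 * (unit_coef h K a P1 / r - unit_coef h K a P0 / r ^+ 2) * (x / r)
  else dir_coef K P2 * (x / r) ^+ 2 + dir_coef K P1 * (r^-1 - x ^+ 2 / r ^+ 3).

Definition coord_term K i : R -> R := fun s =>
  mu (JK v (dirs (s *: e_ i + w) L) K * F K (proj (s *: e_ i + w))).

Lemma functional_dir K : functional (dir_coef K).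
Proof. exact: functional_mulr. Qed.

Lemma functional_unit h K a : functional (unit_coef h K a).
Proof. exact: functional_mulr. Qed.

Lemma has_der2_functional nu K i : functional nu ->
  has_der2 (fun s => nu (F K (s *: e_ i + z))) 0
    (nu (pdA i (F K) z)) (nu (pdA i (pdA i (F K)) z)).
Proof.
move=> ln; have sn := smooth_functional oD ln (sF K).
have := has_der2_pd i oD sn Dw.
rewrite -(functional_pdA i ln (sF K) Dw).
rewrite -(eq_pd i oD (fun y Dy => functional_pdA i ln (sF K) Dy) Dw).
by rewrite -(functional_pdA i ln (smoothA_pdA i (sF K)) Dw).
Qed.

Lemma coord_term_mirror K a : (a <= t 0%N)%N ->
  exists d, has_der2 (coord_term K (mir a)) 0 d (second_coef K (lshift tau (inord a))).
Proof.
move=> a0; exists (dir_coef K (pdA (lshift tau (inord a)) (F K) z)).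
have := has_der2_functional K (lshift tau (inord a)) (functional_dir K).
apply: has_der2_near; apply: nbhs_forall => s.
rewrite /coord_term (projsig_line_mirror st w s a0) dirs_line_const // => h hs.
by apply/negP => /(inblock_gt0 st (ltn_ord h)); rewrite ltnNge a0.
Qed.

Lemma coord_term_tail K (j : 'I_(tau - sigma)) :
  exists d, has_der2 (coord_term K (tail j)) 0 d (second_coef K (b_ (up_ord j))).
Proof.
exists (dir_coef K (pdA (b_ (up_ord j)) (F K) z)).
have := has_der2_functional K (b_ (up_ord j)) (functional_dir K).
apply: has_der2_near; apply: nbhs_forall => s.
rewrite /coord_term (projsig_line_tail st s_tau) dirs_line_const // => h hs.
by apply/negP => /(inblock_le_sigma st s_tau hs) /=; rewrite leqNgt ltnS leq_addr.
Qed.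

Lemma has_der2_radial nu K h : functional nu ->
  has_der2 (fun b => nu (F K ((b - r_ h) *: e_ (b_ h) + z))) (r_ h)
    (nu (pdA (b_ h) (F K) z)) (nu (pdA (b_ h) (pdA (b_ h) (F K)) z)).
Proof.
move=> ln; apply: (@has_der2_shift _ (fun s => nu (F K (s *: e_ (b_ h) + z)))).
by rewrite subrr; apply: has_der2_functional.
Qed.

(** Let rho be |x^h| along the line. If h is not in K, the unit vectors in J_K are constant and the
    chain rule for rho suffices. If h is in K, the term splits into r q_J(s) + s q_e(s), where q_J
    and q_e are F_K / rho multiplied on the left by J_K and by its variant with e_a in place of J_h;
    at s = 0 the second summand contributes just twice the derivative of q_e. *)
Lemma coord_term_block K h a : (h < sigma)%N -> inblock t h a ->
  exists d, has_der2 (coord_term K (mir a)) 0 d (block_second h K a).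
Proof.
move=> hs ha; have r0 := gen hs.
have dr := has_der2_blocknorm ha r0.
pose rho s := blocknorm (s *: e_ (mir a) + w) h.
have rho0 : rho 0 = r_ h by rewrite /rho scale0r add0r.
have nr : nbhs (0 : R) (fun s : R => rho s != 0) by apply: near_blocknorm.
have ra s : rho s != 0 -> coord_term K (mir a) s =
    mu (JK v (upd J h ((rho s)^-1 *: (s *: e_ (inord a) + r_ h *: J h))) K
        * F K ((rho s - r_ h) *: e_ (b_ h) + z)).
  move=> rs; rewrite /coord_term (projsig_line_block st w s hs ha).
  by rewrite (dirs_line_block st s_tau L hs ha r0 rs).
rewrite /block_second; case: ifPn => hK; last first.
  have hk := has_der2_radial K h (functional_dir K); rewrite -rho0 in hk.
  have := @has_der2_comp R (fun b => dir_coef K (F K ((b - rho 0) *: e_ (b_ h) + z))) rho 0 _ _ _ _ hk dr.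
  move=> H; exists (dir_coef K (pdA (b_ h) (F K) z) * (x_ a / r_ h)).
  apply: (has_der2_near _ H); apply: filterS nr => s rs.
  by rewrite ra // JK_upd_notin // rho0.
have q nu : functional nu -> has_der2 (fun s => nu (F K ((rho s - r_ h) *: e_ (b_ h) + z)) * (rho s)^-1) 0
    ((nu (pdA (b_ h) (F K) z) / r_ h - nu (F K z) / r_ h ^+ 2) * (x_ a / r_ h))
    ((nu (pdA (b_ h) (pdA (b_ h) (F K)) z) / r_ h - 2 * nu (pdA (b_ h) (F K) z) / r_ h ^+ 2
       + 2 * nu (F K z) / r_ h ^+ 3) * (x_ a / r_ h) ^+ 2
     + (nu (pdA (b_ h) (F K) z) / r_ h - nu (F K z) / r_ h ^+ 2) *
       ((r_ h)^-1 - x_ a ^+ 2 / r_ h ^+ 3)).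
  move=> ln; have hk := has_der2_div_id r0 (has_der2_radial K h ln).
  have z0 : (r_ h - r_ h) *: e_ (b_ h) + z = z by rewrite subrr scale0r add0r.
  rewrite z0 -[X in has_der2 _ X]rho0 in hk.
  exact: (@has_der2_comp R (fun b => nu (F K ((b - r_ h) *: e_ (b_ h) + z)) * b^-1) rho 0 _ _ _ _ hk dr).
have H := has_der2D (has_der2Z (r_ h) (q _ (functional_dir K)))
  (has_der2M (has_der2_id 0) (q _ (functional_unit h K a))).
eexists; apply: has_der2_near; last first.
  by apply: (has_der2_eq H erefl); rewrite mul0r mul0r add0r addr0 mulr1 mulrA.
(* Adding 0 gives the argument the shape k u + u' of [JK_upd_linear]; the extra term disappears
   because J_K vanishes when a factor is 0. *)
apply: filterS nr => s rs; rewrite ra //= -[_ *: (_ + _)]addr0 JK_upd_linear // JK_upd_linear //.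
have -> : JK v (upd J h (0 : 'rV[R]_N.+1)) K = 0.
  have := JK_upd_linear v J (-1) 0 (0 : 'rV[R]_N.+1) hK.
  by rewrite scaler0 addr0 scaleN1r addNr.
have := JK_upd_linear v J (r_ h) (J h) 0 hK.
have -> : JK v (upd J h (0 : 'rV[R]_N.+1)) K = 0.
  have := JK_upd_linear v J (-1) 0 (0 : 'rV[R]_N.+1) hK.
  by rewrite scaler0 addr0 scaleN1r addNr.
rewrite !addr0 upd_id => ->.
rewrite -scalerAl (functionalZ _ _ lin_mu) mulrDl (functionalD _ _ lin_mu) -!scalerAl.
by rewrite !(functionalZ _ _ lin_mu) /dir_coef /unit_coef; ring.
Qed.

(** The index [a] lies in the mirror or in exactly one block, so a single term survives; the sum
    over all blocks is there to be exchanged with the sum over [a]. *)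
Definition mirror_second K a : R :=
  (if (a <= t 0%N)%N then second_coef K (lshift tau (inord a)) else 0) +
  \sum_(h < tau | (h < sigma)%N) (if inblock t h a then block_second h K a else 0).

Lemma coord_term_mir K a : exists d, has_der2 (coord_term K (mir a)) 0 d (mirror_second K a).
Proof.
have as_ : (a <= t sigma)%N by rewrite -ltnS.
rewrite /mirror_second; have [a0|[k ks ka]] := block_or_mirror s_tau as_.
  rewrite a0 big1 ?addr0; first exact: coord_term_mirror.
  move=> h hs; rewrite ifN //.
  by apply/negP => /(inblock_gt0 st (ltn_ord h)); rewrite ltnNge a0.
pose h : 'I_tau := Ordinal (leq_trans ks s_tau).
rewrite ifN; last by rewrite -ltnNge (inblock_gt0 st (ltn_ord h) ka).
rewrite add0r (bigD1 h) //= ka big1 ?addr0; first exact: coord_term_block.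
move=> l /andP[_ lh]; rewrite ifN //; apply: contra lh => la.
by apply/eqP/val_inj; exact: (inblock_uniq st (ltn_ord l) (ltn_ord h) la ka).
Qed.

(** J_K is linear in its factor of index h, and the x_a e_a add up to x^h = r J_h. *)
Lemma sum_unit_coef h K P : (h < sigma)%N -> h \in K ->
  \sum_(a : 'I_(t sigma).+1 | inblock t h a) x_ a * unit_coef h K a P = r_ h * dir_coef K P.
Proof.
move=> hs hK; have [l [m E]] := JK_upd_in v J hK.
have lin : functional (fun y => mu (l * y * m * P)).
  by move=> *; rewrite mulrDr !mulrDl -scalerAr -!scalerAl lin_mu.
rewrite /dir_coef -(upd_id J h) E.
have <- : mu (l * toA v (r_ h *: J h) * m * P) = r_ h * mu (l * toA v (J h) * m * P).
  have := toA_linear v (r_ h) (J h) 0; rewrite !addr0 => ->.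
  have -> : toA v (0 : 'rV[R]_N.+1) = 0 by apply: big1 => s _; rewrite mxE scale0r.
  by rewrite addr0 (functionalZ _ _ lin).
rewrite (sum_dirs st s_tau L hs (gen hs)).
have -> : toA v (\sum_(a : 'I_(t sigma).+1 | inblock t h a) x_ a *: e_ (inord a)) =
  \sum_(a : 'I_(t sigma).+1 | inblock t h a) x_ a *: toA v (e_ (inord a)).
  apply: (big_rec2 (fun u y => toA v u = y)); first by apply: big1 => s _; rewrite mxE scale0r.
  by move=> i u y _ <-; rewrite toA_linear.
rewrite (functional_sum _ _ _ lin); apply: eq_bigr => a _.
by rewrite (functionalZ _ _ lin) /unit_coef E.
Qed.

(** Source of the coefficients of G. In a block of dimension m, a radial function has Laplacian d2 +
    (m - 1) d1 / r. For h in K put q = F_K / r: the cross terms add 2 q' to the radial Laplacian of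
    r-multiplied q, so the sum is r q'' + (m + 1) q', as for a radial function in dimension m + 2,
    and expanding q gives the zeroth order term. *)
Lemma sum_block_second h K : (h < sigma)%N ->
  \sum_(a : 'I_(t sigma).+1 | inblock t h a) block_second h K a =
  second_coef K (b_ h) +
  ((t h.+1)%:R - (t h)%:R - 1) / r_ h * dir_coef K (pdA (b_ h) (F K) z) +
  (if h \in K then (1 + (t h)%:R - (t h.+1)%:R) / r_ h ^+ 2 * dir_coef K (F K z) else 0).
Proof.
move=> hs; have r0 := gen hs; have rs := blocknorm_sqr w h.
have cb := card_block R st s_tau hs.
rewrite /second_coef; set P2 := pdA _ (pdA _ _) _; set P1 := pdA _ _ _; set P0 := F K z.
case: (boolP (h \in K)) => hK; last first.
  have -> : \sum_(a : 'I_(t sigma).+1 | inblock t h a) block_second h K a =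
    (dir_coef K P2 / r_ h ^+ 2 - dir_coef K P1 / r_ h ^+ 3) *
      (\sum_(a : 'I_(t sigma).+1 | inblock t h a) x_ a ^+ 2) +
    dir_coef K P1 / r_ h * (\sum_(a : 'I_(t sigma).+1 | inblock t h a) 1).
    rewrite !mulr_sumr -big_split /=; apply: eq_bigr => a _.
    by rewrite /block_second (negbTE hK) -/P1 -/P2 (block_term_notin r0).
  by rewrite -rs cb (block_sum_notin r0).
pose q1 := dir_coef K P1 / r_ h - dir_coef K P0 / r_ h ^+ 2.
pose q2 := dir_coef K P2 / r_ h - 2 * dir_coef K P1 / r_ h ^+ 2 + 2 * dir_coef K P0 / r_ h ^+ 3.
have -> : \sum_(a : 'I_(t sigma).+1 | inblock t h a) block_second h K a =
  (q2 / r_ h - q1 / r_ h ^+ 2) * (\sum_(a : 'I_(t sigma).+1 | inblock t h a) x_ a ^+ 2) +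
  q1 * (\sum_(a : 'I_(t sigma).+1 | inblock t h a) 1) +
  (2 / r_ h ^+ 2 * (\sum_(a : 'I_(t sigma).+1 | inblock t h a) x_ a * unit_coef h K a P1) -
   2 / r_ h ^+ 3 * (\sum_(a : 'I_(t sigma).+1 | inblock t h a) x_ a * unit_coef h K a P0)).
  rewrite !mulr_sumr -sumrB -!big_split /=; apply: eq_bigr => a _.
  by rewrite /block_second hK -/P1 -/P2 -/P0 (block_term_in r0).
by rewrite -rs cb !(sum_unit_coef _ hs hK) (block_sum_in r0).
Qed.

Lemma sum_mirror_ord (f : 'I_n -> R) :
  \sum_(a : 'I_(t sigma).+1) (if (a <= t 0%N)%N then f (lshift tau (inord a)) else 0) =
  \sum_(b : 'I_(t 0).+1) f (lshift tau b).
Proof.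
have le0 : ((t 0%N).+1 <= (t sigma).+1)%N by rewrite ltnS (steps_le st).
rewrite -big_mkcond /= (eq_bigl (fun a : 'I_(t sigma).+1 => (a < (t 0%N).+1)%N)); last by [].
rewrite (big_ord_narrow le0); apply: eq_bigr => b _; congr (f (lshift _ _)).
by apply: val_inj; rewrite /= inordK // ltn_ord.
Qed.

Lemma sum_tail_ord (g : 'I_tau -> R) :
  \sum_(j : 'I_(tau - sigma)) g (up_ord j) = \sum_(h < tau | ~~ (h < sigma)%N) g h.
Proof.
(* Extended by 0 to all of [nat], so that the shift by sigma is a reindexing of a range. *)
pose g' k := oapp g 0 (insub k : option 'I_tau).
have gE (h : 'I_tau) : g h = g' h by rewrite /g' valK.
rewrite (eq_bigr (fun h : 'I_tau => g' h)) => [|h _]; last exact: gE.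
rewrite (eq_bigl (fun h : 'I_tau => true && (sigma <= h)%N)) => [|h]; last by rewrite -leqNgt.
rewrite -(big_geq_mkord _ _ predT g').
have := @big_addn _ 0 +%R 0%N tau sigma predT g'; rewrite add0n => ->; rewrite big_mkord.
by apply: eq_bigr => j _; rewrite gE.
Qed.

Lemma sum_second K :
  \sum_(a : 'I_(t sigma).+1) mirror_second K a + \sum_(j : 'I_(tau - sigma)) second_coef K (b_ (up_ord j)) =
  dir_coef K (laplA (F K) z) +
  (\sum_(h < tau | (h < sigma)%N) ((t h.+1)%:R - (t h)%:R - 1) / r_ h * dir_coef K (pdA (b_ h) (F K) z) +
   \sum_(h < tau | (h < sigma)%N && (h \in K)) (1 + (t h)%:R - (t h.+1)%:R) / r_ h ^+ 2 * dir_coef K (F K z)).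
Proof.
rewrite /mirror_second big_split /= (sum_mirror_ord (second_coef K)).
rewrite (sum_tail_ord (fun h => second_coef K (b_ h))) exchange_big /=.
have -> : \sum_(h < tau | (h < sigma)%N) \sum_(a : 'I_(t sigma).+1)
      (if inblock t h a then block_second h K a else 0) =
    \sum_(h < tau | (h < sigma)%N) (second_coef K (b_ h) +
      ((t h.+1)%:R - (t h)%:R - 1) / r_ h * dir_coef K (pdA (b_ h) (F K) z) +
      (if h \in K then (1 + (t h)%:R - (t h.+1)%:R) / r_ h ^+ 2 * dir_coef K (F K z) else 0)).
  by apply: eq_bigr => h hs; rewrite -big_mkcond /= sum_block_second.
rewrite !big_split /= -big_mkcondr /=.
have -> : dir_coef K (laplA (F K) z) = \sum_(b : 'I_(t 0).+1) second_coef K (lshift tau b) +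
    (\sum_(h < tau | (h < sigma)%N) second_coef K (b_ h) +
     \sum_(h < tau | ~~ (h < sigma)%N) second_coef K (b_ h)).
  rewrite /laplA (functional_sum _ _ _ (functional_dir K)) big_split_ord /=.
  by congr (_ + _); rewrite (bigID (fun h : 'I_tau => (h < sigma)%N)).
set s1 := \sum_(b : _) _; set s2 := \sum_(h | _) second_coef _ _.
set s3 := \sum_(h | _) _ * dir_coef _ (pdA _ _ _); set s4 := \sum_(h | _) _ * dir_coef _ (F _ _).
set s5 := \sum_(h | _) _.
by clear; ring.
Qed.

End GenericPoint.

(** Agreement on one side of 0 suffices. Only s > 0 is available: for s < 0 the unit vectors of the
    degenerate blocks would be reversed. *)
Lemma eq_at_limit {R : realType} (f g : R -> R) :
  {for 0, continuous f} -> {for 0, continuous g} ->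
  nbhs (0 : R) (fun s => 0 < s -> f s = g s) -> f 0 = g 0.
Proof.
move=> cf cg fg; apply/eqP; rewrite -subr_eq0 -normr_le0; apply/ler_addgt0Pl => e e0.
have e2 : 0 < e / 2 by rewrite divr_gt0.
have /continuous_distP/(_ _ e2) nf := cf.
have /continuous_distP/(_ _ e2) ng := cg.
have [d d0 hd] := @nbhs_dist R R^o 0 _ (filterI (filterI nf ng) fg).
have sd : `|0 - d / 2| < d by rewrite sub0r normrN gtr0_norm ?divr_gt0 // ltr_pdivrMr // ltr_pMr // ltr1n.
have [[h1 h2] h3] := hd (d / 2) sd.
have d2 : 0 < d / 2 by rewrite divr_gt0.
rewrite (h3 d2) in h1; rewrite addr0 [leRHS]splitr.
apply: le_trans (ler_distD (g (d / 2)) _ _) _; apply: lerD; first exact: h1.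
by rewrite distrC; exact: h2.
Qed.

Lemma coordnP {R : realType} n (x y : 'rV[R]_n) (s : R) k :
  coordn (s *: x + y) k = s * coordn x k + coordn y k.
Proof.
rewrite /coordn mulr_sumr -big_split /=.
by apply: eq_bigr => i _; rewrite !mxE.
Qed.

Lemma smoothA_laplA {R : realType} {A : falgType R} n (U : set 'rV[R]_n) (g : 'rV[R]_n -> A) :
  open U -> smoothA U g -> smoothA U (laplA g).
Proof.
move=> oU sg; rewrite /smoothA (coordsA_laplA g).
apply: (smooth_sum _ oU) => i _.
exact: (smooth_pd i (smooth_pd i sg)).
Qed.

(** * Points with vanishing blocks *)

Section Degenerate.
Variables (R : realType) (t : nat -> nat) (tau sigma N : nat).
Hypotheses (st : steps t tau N) (s_tau : (sigma <= tau)%N).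
Local Notation n := ((t 0).+1 + tau)%N.
Local Notation n' := ((t sigma).+1 + (tau - sigma))%N.
Local Notation b_ := (@betai t tau).
Local Notation e_ := (ev R).
Local Notation proj := (@projsig R t tau sigma).
Variables (w : 'rV[R]_n') (L : 'I_(tau - sigma) -> 'rV[R]_N.+1).
Implicit Types (h k : 'I_tau) (s : R).

Definition degenerate h := (h < sigma)%N && (blocknorm w h == 0).

(* adding a small positive multiple of [escape] to [w] makes all the blocks [x^h] nonzero
   without changing the unit vectors [dirs w L] *)
Definition escape : 'rV[R]_n' :=
  \row_i (if [exists h, degenerate h && ((i : nat) == (t h).+1)] then 1 else 0).

Definition escape_stem : 'rV[R]_n :=
  \row_i (if [exists h, degenerate h && (i == b_ h)] then 1 else 0).

Lemma coordn_escape m : (m <= t sigma)%N ->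
  coordn escape m = if [exists h, degenerate h && (m == (t h).+1)] then 1 else 0.
Proof.
move=> ms; have mS : (m < (t sigma).+1)%N by [].
have -> : m = mir tau (Ordinal mS) :> nat by [].
by rewrite coordnE mxE.
Qed.

Lemma escape_block h m : (h < sigma)%N -> inblock t h m ->
  coordn escape m = if degenerate h && (m == (t h).+1) then 1 else 0.
Proof.
move=> hs hm; rewrite coordn_escape; last exact: (inblock_le_sigma st s_tau hs hm).
congr (if _ then _ else _); apply/existsP/idP => [[k /andP[dk /eqP mk]]|?]; last by exists h.
have km : inblock t k m by rewrite mk (inblock_first st).
have -> : h = k by apply/val_inj; exact: (inblock_uniq st (ltn_ord h) (ltn_ord k) hm km).
by rewrite dk mk /=.
Qed.

Lemma coordn_degenerate h m s : degenerate h -> inblock t h m ->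
  coordn (s *: escape + w) m = if m == (t h).+1 then s else 0.
Proof.
move=> dh hm; have /andP[hs /eqP w0] := dh.
rewrite coordnP (escape_block hs hm) dh (blocknorm_eq0 st s_tau hs w0 hm) addr0 /=.
by case: ifP; rewrite ?mulr1 ?mulr0.
Qed.

Lemma coordn_nondegenerate h m s : (h < sigma)%N -> ~~ degenerate h -> inblock t h m ->
  coordn (s *: escape + w) m = coordn w m.
Proof.
by move=> hs dh hm; rewrite coordnP (escape_block hs hm) (negbTE dh) mulr0 add0r.
Qed.

Lemma blocknorm_degenerate h s : 0 < s -> degenerate h ->
  blocknorm (s *: escape + w) h = s.
Proof.
move=> s0 dh; have /andP[hs _] := dh.
have fs : ((t h).+1 < (t sigma).+1)%N.
  by rewrite ltnS (inblock_le_sigma st s_tau hs (inblock_first st h)).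
rewrite /blocknorm (bigD1 (Ordinal fs)) /=; last exact: inblock_first st h.
rewrite (coordn_degenerate _ dh (inblock_first st h)) eqxx big1 ?addr0.
  by rewrite sqrtr_sqr gtr0_norm.
move=> a /andP[ha af]; rewrite (coordn_degenerate _ dh ha) ifN ?expr0n //.
Qed.

Lemma blocknorm_nondegenerate h s : (h < sigma)%N -> ~~ degenerate h ->
  blocknorm (s *: escape + w) h = blocknorm w h.
Proof.
by move=> hs dh; apply: eq_blocknorm => m hm; apply: coordn_nondegenerate hm.
Qed.

Lemma escape_generic s : 0 < s ->
  forall h, (h < sigma)%N -> blocknorm (s *: escape + w) h != 0.
Proof.
move=> s0 h hs; have [dh|dh] := boolP (degenerate h).
  by rewrite blocknorm_degenerate // gt_eqF.
rewrite blocknorm_nondegenerate //.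
by move: dh; rewrite /degenerate hs.
Qed.

Lemma dirs_escape s : 0 < s -> dirs (s *: escape + w) L = dirs w L.
Proof.
move=> s0; apply/funext => h; have [hs|sh] := ltnP h sigma; last first.
  by rewrite /dirs ltnNge sh.
have [dh|dh] := boolP (degenerate h); last first.
  by apply: eq_dirs => m hm; apply: coordn_nondegenerate hm.
rewrite /dirs hs blocknorm_degenerate // gt_eqF //.
have /andP[_ ->] := dh; apply/rowP => m; rewrite mxE (dirs_degenerate _ st).
have [hm|hm] := boolP (inblock t h m).
  rewrite (coordn_degenerate _ dh hm); case: eqP => _; last by rewrite mul0r.
  by rewrite divff // gt_eqF.
case: eqP => // mE; case/negP: hm; rewrite mE; exact: inblock_first st h.
Qed.

Lemma projsig_escape s : 0 < s -> proj (s *: escape + w) = s *: escape_stem + proj w.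
Proof.
move=> s0; apply: eq_rows_stem => [b|h]; rewrite [RHS]mxE [X in _ = X + _]mxE.
  have bs : (b <= t sigma)%N by apply: leq_trans (steps_le st (leq0n sigma) s_tau); rewrite -ltnS (ltn_ord b).
  rewrite !projsig_mirror coordnP coordn_escape // mxE; congr (_ * _ + _).
  rewrite [LHS]ifN; last first.
    apply/existsP => -[h /andP[_ /eqP bE]].
    have := inblock_gt0 st (ltn_ord h) (inblock_first st h).
    by rewrite -bE ltnNge -ltnS (ltn_ord b).
  rewrite ifN //; apply/existsP => -[h /andP[_]].
  by rewrite eq_lrshift.
have eE : escape_stem 0 (b_ h) = if degenerate h then 1 else 0.
  rewrite mxE; congr (if _ then _ else _); apply/existsP/idP => [[k /andP[dk]]|dh].
    by rewrite (inj_eq (@rshift_inj _ _)) => /eqP ->.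
  by exists h; rewrite dh eqxx.
rewrite eE; have [hs|sh] := ltnP h sigma.
  rewrite !projsig_block //; have [dh|dh] := boolP (degenerate h).
    rewrite blocknorm_degenerate // mulr1; have /andP[_ /eqP ->] := dh.
    by rewrite addr0.
  by rewrite blocknorm_nondegenerate // mulr0 add0r.
rewrite {1}/degenerate ltnNge sh mulr0 add0r !projsig_tail // coordnP.
have hj : (h - sigma < tau - sigma)%N by rewrite ltn_sub2r // (leq_ltn_trans sh).
have -> : ((t sigma).+1 + (h - sigma))%N = tail t (Ordinal hj) :> nat by [].
rewrite coordnE mxE ifN ?mulr0 ?add0r //.
apply/existsP => -[k /andP[/andP[ks _] /eqP E]].
have := inblock_le_sigma st s_tau ks (inblock_first st k).
by rewrite -E /= leqNgt ltnS leq_addr.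
Qed.

End Degenerate.

(** * Comparison of the two Laplacians *)

Section LaplacianComparison.
Variables (R : realType) (A : falgType R) (t : nat -> nat) (tau sigma N : nat).
Variables (v : 'I_N.+1 -> A) (p : regularity) (D : set 'rV[R]_((t 0).+1 + tau)).
Variable (F : {set 'I_tau} -> 'rV[R]_((t 0).+1 + tau) -> A).
Hypotheses (st : steps t tau N) (s_tau : (sigma <= tau)%N) (oD : open D).
Hypothesis pF : @stem_p R A p t tau D F.
Local Notation n' := ((t sigma).+1 + (tau - sigma))%N.
Local Notation proj := (@projsig R t tau sigma).
Local Notation Ds := (@Dsig R t tau sigma D).
Variable H : {set 'I_(tau - sigma)} -> 'rV[R]_n' -> A.
Hypothesis sH : forall K', smoothA Ds (H K').
Variable L : 'I_(tau - sigma) -> 'rV[R]_N.+1.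
Hypothesis HF : forall z, Ds z -> \sum_(K' : {set 'I_(tau - sigma)}) JK v L K' * H K' z =
  \sum_(K : {set 'I_tau}) JK v (dirs z L) K * F K (proj z).
Variable mu : A -> R.
Hypothesis lin_mu : functional mu.

Lemma smooth_stem K : smoothA D (F K).
Proof. exact: reg_smooth (pF.2 K). Qed.

Lemma smooth_correction K : smoothA D (correction sigma F K).
Proof. by have [_ /(_ K)] := correction_stem oD sigma pF; apply: reg_smooth. Qed.

Definition lhs z := mu (\sum_(K' : {set 'I_(tau - sigma)}) JK v L K' * laplA (H K') z).
Definition rhs J z := mu (\sum_(K : {set 'I_tau}) JK v J K * (laplA (F K) z + correction sigma F K z)).

(** On the line, [HF] makes both sums the same function of s near 0, and a second derivative is
    unique. No property of the individual components of [H] is used beyond smoothness. *)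
Lemma second_coord w i (c : {set 'I_tau} -> R) : Ds w ->
  (forall K, exists d, has_der2 (coord_term v F w L mu K i) 0 d (c K)) ->
  \sum_(K' : {set 'I_(tau - sigma)}) pd i (pd i (fun z => mu (JK v L K' * H K' z))) w =
  \sum_(K : {set 'I_tau}) c K.
Proof.
move=> Dw hc; have oDs := @open_Dsig R t tau sigma D oD.
pose d K := projT1 (cid (hc K)).
have hd K : has_der2 (coord_term v F w L mu K i) 0 (d K) (c K) := projT2 (cid (hc K)).
have h1 := has_der2_sum (index_enum {set 'I_tau}) hd.
have h2 := has_der2_sum (index_enum {set 'I_(tau - sigma)}) (fun K' =>
  has_der2_pd i oDs (smooth_functional oDs (functional_mulr (JK v L K') lin_mu) (sH K')) Dw).
apply: has_der2_unique h2 _; apply: has_der2_near h1.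
have nD : nbhs (0 : R) (fun s : R => Ds (s *: ev R i + w)).
  by apply: near_line; rewrite scale0r add0r; apply: open_nbhs_nbhs.
apply: filterS nD => s Dss; rewrite /coord_term -!(functional_sum _ _ _ lin_mu).
by rewrite -HF.
Qed.

Lemma lapl_generic w : Ds w -> (forall h : 'I_tau, (h < sigma)%N -> blocknorm w h != 0) ->
  lhs w = rhs (dirs w L) (proj w).
Proof.
move=> Dw gen; have oDs := @open_Dsig R t tau sigma D oD.
have linK' K' := functional_mulr (JK v L K') lin_mu.
rewrite /lhs (functional_sum _ _ _ lin_mu).
under eq_bigr => K' _ do rewrite (functional_laplA oDs (linK' K') (sH K') Dw).
rewrite exchange_big big_split_ord /=.
under eq_bigr => a _ do
  rewrite (second_coord Dw (coord_term_mir v st s_tau oD smooth_stem L Dw gen lin_mu ^~ a)).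
under [X in _ + X]eq_bigr => j _ do
  rewrite (second_coord Dw (coord_term_tail v st s_tau oD smooth_stem L Dw lin_mu ^~ j)).
rewrite exchange_big [X in _ + X]exchange_big -big_split /=.
rewrite /rhs (functional_sum _ _ _ lin_mu); apply: eq_bigr => K _.
rewrite (sum_second v F st s_tau L gen lin_mu K).
rewrite mulrDr (functionalD _ _ lin_mu); congr (_ + _).
have y0 : \prod_(h < tau | (h < sigma)%N) proj w 0 (betai t h) != 0.
  by rewrite prodf_seq_neq0; apply/allP => h _; apply/implyP => hs; rewrite projsig_block // gen.
rewrite (correctionE pF Dw y0) mulrDr (functionalD _ _ lin_mu) !mulr_sumr !(functional_sum _ _ _ lin_mu).
congr (_ + _); apply: eq_bigr => h.
  by move=> hs; rewrite -scalerAr (functionalZ _ _ lin_mu) projsig_block.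
by move=> /andP[hs _]; rewrite -scalerAr (functionalZ _ _ lin_mu) projsig_block.
Qed.

Lemma smooth_lhs : smooth Ds lhs.
Proof.
have oDs := @open_Dsig R t tau sigma D oD.
have -> : lhs = \sum_(K' : {set 'I_(tau - sigma)}) ((fun P => mu (JK v L K' * P)) \o laplA (H K')).
  by apply/funext => z; rewrite fct_sumE /lhs (functional_sum _ _ _ lin_mu).
apply: smooth_sum => // K' _; apply: smooth_functional => //.
  exact: functional_mulr.
exact: smoothA_laplA.
Qed.

(** [J] is kept fixed, since on the ray of [lapl_comparison] the unit vectors do not move; the
    continuity of G across beta_h = 0 is used through this lemma. *)
Lemma smooth_rhs J : smooth D (rhs J).
Proof.
have -> : rhs J = \sum_(K : {set 'I_tau}) (((fun P => mu (JK v J K * P)) \o laplA (F K)) +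
    ((fun P => mu (JK v J K * P)) \o correction sigma F K)).
  apply/funext => z; rewrite fct_sumE /rhs (functional_sum _ _ _ lin_mu).
  by apply: eq_bigr => K _; rewrite mulrDr (functionalD _ _ lin_mu).
apply: smooth_sum => // K _; apply: smoothD => //; apply: smooth_functional => //.
- exact: functional_mulr.
- exact: (smoothA_laplA oD (smooth_stem K)).
- exact: functional_mulr.
- exact: smooth_correction.
Qed.

Lemma lapl_comparison w : Ds w -> lhs w = rhs (dirs w L) (proj w).
Proof.
move=> Dw; have oDs := @open_Dsig R t tau sigma D oD.
have x0 m (u y : 'rV[R]_m) : 0 *: u + y = y by rewrite scale0r add0r.
(* Both sides along the ray through [w], with the unit vectors frozen at those of [w]; for s > 0 the
   point is generic and [lapl_generic] applies. *)
pose f s := lhs (s *: escape w + w).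
pose g s := rhs (dirs w L) (s *: escape_stem w + proj w).
have -> : lhs w = f 0 by rewrite /f x0.
have -> : rhs (dirs w L) (proj w) = g 0 by rewrite /g x0.
apply: eq_at_limit.
- by apply: continuous_line; rewrite x0; exact: (smooth_continuous smooth_lhs Dw).
- by apply: continuous_line; rewrite x0; exact: (smooth_continuous (smooth_rhs (dirs w L)) (Dw : D (proj w))).
have nD : nbhs (0 : R) (fun s : R => Ds (s *: escape w + w)).
  by apply: near_line; rewrite x0; apply: open_nbhs_nbhs.
apply: filterS nD => s Dss s0; rewrite /f /g (lapl_generic Dss (escape_generic st s_tau w s0)).
by rewrite (dirs_escape st s_tau w L s0) (projsig_escape st s_tau w s0).
Qed.

End LaplacianComparison.

Theorem theorem5p2 (R : realType) (A : falgType R) (c : A -> A)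
  (N : nat) (v : 'I_N.+1 -> A) (t : nat -> nat) (tau sigma : nat)
  (p : regularity) (D : set 'rV[R]_((t 0).+1 + tau))
  (F : {set 'I_tau} -> 'rV[R]_((t 0).+1 + tau) -> A) (f : A -> A) :
  star_involution c -> (exists J, sphA c J) -> (1 <= N)%N ->
  admissible_basis c v -> steps t tau N ->
  (1 <= sigma <= tau)%N ->
  open D -> @refl_invariant R t tau D ->
  @stem_p R A p t tau D F -> @induces R A t tau N v D F f ->
  exists G : {set 'I_tau} -> 'rV[R]_((t 0).+1 + tau) -> A,
    [/\ @stem_p R A p t tau D G,
        (* formula for G_K on D' *)
        forall y, D y -> \prod_(h < tau | (h < sigma)%N) y 0 (betai t h) != 0 ->
          forall K : {set 'I_tau},
            G K y =
              \sum_(h < tau | (h < sigma)%N)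
                 (((t h.+1)%:R - (t h)%:R - 1) / y 0 (betai t h)) *:
                   @pdA R A _ (betai t h) (F K) y
            + \sum_(h < tau | (h < sigma)%N && (h \in K))
                 ((1 + (t h)%:R - (t h.+1)%:R) / (y 0 (betai t h)) ^+ 2) *: F K y
      & (* Delta_{T_sigma} f = Delta_T f + g on Omega_D, where Delta_{T_sigma} f is
           computed through any T_sigma-stem function H of class C^p with
           I(H) = f *)
        forall H : {set 'I_(tau - sigma)} -> 'rV[R]_((t sigma).+1 + (tau - sigma)) -> A,
          @stem_p R A p (tsig t sigma) (tau - sigma) (@Dsig R t tau sigma D) H ->
          @induces R A (tsig t sigma) (tau - sigma) N v (@Dsig R t tau sigma D) H f ->
          forall y J y' J',
            D y -> @torus R t tau N J ->
            @Dsig R t tau sigma D y' -> @torus R (tsig t sigma) (tau - sigma) N J' ->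
            toA v (@pt R t tau N y J) = toA v (@pt R (tsig t sigma) (tau - sigma) N y' J') ->
            \sum_(K' : {set 'I_(tau - sigma)})
                 @JK R A N (tau - sigma) v J' K' * @lapl_stem R A _ _ H K' y'
            = \sum_(K : {set 'I_tau})
                 @JK R A N tau v J K * (@lapl_stem R A _ _ F K y + G K y)].
Proof.
move=> _ _ _ vb st /andP[_ s_tau] oD rD pF fF.
have [_ v_inj _ _ _] := vb.
have sF K : smoothA D (F K) := smooth_stem pF K.
have sG := correction_stem oD sigma pF.
exists (correction sigma F); split; [exact: sG | exact: (correctionE pF) |].
move=> H [_ rH] fH y J w L Dy tJ Dw tL ptE.
have sH K' : smoothA (Dsig D) (H K') := reg_smooth (rH K').
have tD := torus_dirs st s_tau w tL.
have HF z : Dsig D z -> \sum_(K' : {set 'I_(tau - sigma)}) JK v L K' * H K' z =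
    \sum_(K : {set 'I_tau}) JK v (dirs z L) K * F K (projsig z).
  move=> Dz; rewrite -(fH z L Dz tL) -(pt_dirs st s_tau z tL).
  exact: (fF _ _ Dz (torus_dirs st s_tau z tL)).
have sS := stemD (stem_lapl oD sF pF.1) sG.1.
(* Injectivity of [toA v] turns the equality of points of [A] into one of coordinates. *)
have ptE' : pt y J = pt (projsig w) (dirs w L).
  rewrite (pt_dirs st s_tau w tL); apply/eqP; rewrite -subr_eq0 -scaleN1r addrC; apply/eqP/v_inj.
  by rewrite toA_linear ptE scaleN1r addNr.
(* Delta_T F + G is a stem function, so the given presentation may be exchanged for the one derived
   from [w] and [L]. *)
rewrite [RHS](stem_sum_eq v st rD sS Dy Dw tJ tD ptE').
apply: functional_eq => mu lin_mu.
exact: (lapl_comparison st s_tau oD pF sH HF lin_mu Dw).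
Qed.
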